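(* Let $W_1,W_2\in W^{2,\infty}(\mathbb{T}^d)$, let $\phi\in H^{3+d}(\mathbb{T}^d)$ be a probability density on $\mathbb{T}^d$, and let $\rho_{W_1},\rho_{W_2}$ be the corresponding solutions on $[0,T]\times\mathbb{T}^d$ of the McKean-Vlasov equation with initial condition $\phi$ (see context). Suppose $\|W_i\|_{W^{2,\infty}}\le M$ for $i=1,2$. (i) For some constant $C=C(d,T,M,\|\phi\|_{H^d})$, $$\|\rho_{W_1}-\rho_{W_2}\|^2_{L^2(\mathcal X,\lambda)}\le C\int_0^T\|\nabla(W_1-W_2)\ast\rho_{W_2}(t)\|^2_{L^2(\mathbb{T}^d)}\,dt .$$ (ii) If in addition $\phi\in H^\beta(\mathbb{T}^d)$, where $\beta\ge3+d$ is an even integer, then $$\|\rho_{W_1}-\rho_{W_2}\|_{L^2(\mathcal X,\lambda)}\le C\|W_1-W_2\|_{H^{-\beta}}$$ for some constant $C=C(d,\beta,T,M,\|\phi\|_{H^\beta})$.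
   Context: $\mathbb{T}^d=\mathbb{R}^d/\mathbb{Z}^d$ is the $d$-dimensional torus with Lebesgue (probability) measure; $T>0$ is fixed, $\mathcal X=[0,T]\times\mathbb{T}^d$ and $\lambda$ is the uniform probability measure on $\mathcal X$. $H^s=H^s(\mathbb{T}^d)$, $s\in\mathbb{R}$, are the usual $L^2$-Sobolev spaces (for $s<0$ the dual of $H^{-s}$). $W^{2,\infty}(\mathbb{T}^d)$ is the space of continuous functions whose weak partial derivatives up to order 2 are bounded, with its usual norm. For $W\in W^{2,\infty}(\mathbb{T}^d)$ and a probability density $\phi\in H^{3+d}(\mathbb{T}^d)$, $\rho_W:[0,T]\times\mathbb{T}^d\to[0,\infty)$ denotes the unique classical periodic solution (a probability density in $x$ for each $t$; its existence and uniqueness is a known result) of the McKean-Vlasov equation $$\frac{\partial\rho}{\partial t}=\Delta\rho+\nabla\cdot\big(\rho\,\nabla(W\ast\rho)\big),\qquad \rho(0,\cdot)=\phi,$$ where $\ast$ is convolution in the space variable on $\mathbb{T}^d$. We write $\rho(t)=\rho(t,\cdot)$. *)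

(* Defs.v *)
From HB Require Import structures.
From mathcomp Require Import all_boot all_order all_algebra.
From mathcomp Require Import all_classical all_reals all_analysis.

Set Implicit Arguments.
Unset Strict Implicit.
Unset Printing Implicit Defensive.

Import Order.TTheory GRing.Theory Num.Theory.
Import numFieldNormedType.Exports.

Local Open Scope classical_set_scope.
Local Open Scope ring_scope.

(* Functions on the torus T^d = R^d / Z^d are Z^d-periodic functions on
   'rV[R]_d; integration over T^d is integration against [torus], the uniform
   probability on the fundamental cell [0, 1]^d. *)

Definition row_display : measure_display -> measure_display.
Proof. exact. Qed.

Definition row_coord (T : Type) (n : nat) (i : 'I_n) (x : 'rV[T]_n) : T :=
  x ord0 i.

Section measurable_row.
Context {dT : measure_display} {T : sigmaRingType dT}.
Variable n : nat.

Let row_set0 : g_sigma_preimage (@row_coord T n) set0.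
Proof. exact: sigma_algebra0. Qed.

Let row_setC A :
  g_sigma_preimage (@row_coord T n) A -> g_sigma_preimage (@row_coord T n) (~` A).
Proof. exact: sigma_algebraC. Qed.

Let row_bigcup (F : _^nat) : (forall i, g_sigma_preimage (@row_coord T n) (F i)) ->
  g_sigma_preimage (@row_coord T n) (\bigcup_i (F i)).
Proof. exact: sigma_algebra_bigcup. Qed.

HB.instance Definition _ := @isMeasurable.Build (row_display dT)
  'rV[T]_n (g_sigma_preimage (@row_coord T n)) row_set0 row_setC row_bigcup.

End measurable_row.

Lemma measurable_row_coord (dT : measure_display) (T : sigmaRingType dT)
    (n : nat) (i : 'I_n) :
  measurable_fun [set: 'rV[T]_n] (@row_coord T n i).
Proof.
move=> _ Y mY; rewrite setTI; apply: sub_sigma_algebra => /=.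
rewrite -bigcup_seq/=; exists i => /=; first by rewrite mem_index_enum.
by exists Y => //; rewrite setTI.
Qed.

Lemma measurable_fun_row (d1 d2 : measure_display) (T1 : measurableType d1)
    (T2 : measurableType d2) (n : nat) (f : T1 -> 'rV[T2]_n) :
  (forall i, measurable_fun [set: T1] (@row_coord T2 n i \o f)) ->
  measurable_fun [set: T1] f.
Proof.
move=> mf.
suff H : g_sigma_preimage (fun i => @row_coord T2 n i \o f) `<=` measurable.
  move: H; rewrite g_sigma_preimage_comp => H _ A mA.
  by apply: H; exists A.
apply: smallest_sub; first exact: sigma_algebra_measurable.
case: n => [|n] in f mf *; first by rewrite big_ord0.
rewrite -bigcup_mkord_ord; apply: bigcup_sub => i Ii.
by move=> A [B mB <-]; exact: mf.
Qed.

Section torus_measure.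
Context {R : realType}.

Definition row_cons (n : nat) (z : R * 'rV[R]_n) : 'rV[R]_(1 + n) :=
  row_mx (const_mx z.1) z.2.

Lemma measurable_row_cons (n : nat) :
  measurable_fun [set: R * 'rV[R]_n] (@row_cons n).
Proof.
apply: measurable_fun_row => i.
rewrite -(splitK i); case: (fintype.split i) => j /=.
  rewrite (_ : _ \o _ = fst)//.
  by apply/funext => z; rewrite /row_coord /= row_mxEl mxE.
rewrite (_ : _ \o _ = row_coord j \o snd).
  by apply: measurableT_comp => //; exact: measurable_row_coord.
by apply/funext => z; rewrite /row_coord /= row_mxEr.
Qed.

HB.instance Definition _ (n : nat) := isMeasurableFun.Build _ _ _ _
  (@row_cons n) (@measurable_row_cons n).

(* [uniform_prob] is attached to the measurable structure [measurableTypeR R];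
   this is the same measure on the canonical (Borel) one of [R]. *)
Definition uniformR (a b : R) (ab : a < b) : set R -> \bar R :=
  uniform_prob ab.

HB.instance Definition _ (a b : R) (ab : a < b) :=
  isMeasure.Build default_measure_display R R (uniformR ab)
    (measure0 (uniform_prob ab)) (measure_ge0 (uniform_prob ab))
    (@measure_semi_sigma_additive _ _ _ (uniform_prob ab)).

HB.instance Definition _ (a b : R) (ab : a < b) :=
  @Measure_isProbability.Build _ _ R (uniformR ab)
    (probability_setT (uniform_prob ab)).

Fixpoint torus (d : nat) : probability 'rV[R]_d R :=
  match d with
  | 0 => \d_(0 : 'rV[R]_0)
  | n.+1 => distribution (uniformR (@ltr01 R) \x torus n)%E (@row_cons n)
  end.
End torus_measure.

Section torus_functions.
Context {R : realType} {d : nat}.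
Implicit Types (f g : 'rV[R]_d -> R) (s : seq 'I_d).

Definition Zperiodic f : Prop :=
  forall (x : 'rV[R]_d) (k : 'rV[int]_d), f (x + map_mx intr k) = f x.

Definition torus_conv f g : 'rV[R]_d -> R :=
  fun x => \int[torus d]_y (f (x - y) * g y).

Definition prob_density f : Prop :=
  [/\ Zperiodic f, measurable_fun setT f, (forall x, 0 <= f x)
    & (\int[torus d]_x (f x)%:E = 1)%E].

Definition partial (i : 'I_d) f : 'rV[R]_d -> R :=
  fun x => 'D_(delta_mx ord0 i) f x.

Definition partials s f : 'rV[R]_d -> R := foldr partial f s.

Fixpoint Ck (n : nat) f : Prop :=
  continuous f /\
  match n with
  | 0 => True
  | m.+1 => forall i : 'I_d,
      (forall x, derivable f x (delta_mx ord0 i)) /\ Ck m (partial i f)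
  end.

Definition test_function f : Prop := Zperiodic f /\ forall n, Ck n f.

(* [s] lists the directions of differentiation, one entry per derivative. *)
Definition is_weak_deriv s f g : Prop :=
  [/\ Zperiodic g, measurable_fun setT g,
      (torus d).-integrable setT (EFin \o g)
    & forall psi, test_function psi ->
        \int[torus d]_x (f x * partials s psi x) =
        (-1) ^+ size s * \int[torus d]_x (g x * psi x)].

(* Weak derivatives are only unique almost everywhere: this picks a version,
   and is the junk value 0 when there is none. *)
Definition weak_deriv s f : 'rV[R]_d -> R :=
  xget (cst 0) [set g | is_weak_deriv s f g].

Definition in_W2inf f : Prop :=
  [/\ Zperiodic f, continuous f
    & forall s, (size s <= 2)%N -> exists2 g, is_weak_deriv s f g &
        ('N[torus d]_+oo[EFin \o g] < +oo)%E].

(* Sum of the sup-norms of D^a f over the multi-indices |a| <= 2; the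
   condition i <= j makes each second-order multi-index occur once. *)
Definition W2inf_norm f : \bar R :=
  ('N[torus d]_+oo[EFin \o f]
   + \sum_(i < d) 'N[torus d]_+oo[EFin \o weak_deriv [:: i] f]
   + \sum_(i < d) \sum_(j < d | (i <= j)%N)
       'N[torus d]_+oo[EFin \o weak_deriv [:: i; j] f])%E.

Definition freq (k : 'rV[int]_d) (x : 'rV[R]_d) : R :=
  2 * pi * \sum_(i < d) (k ord0 i)%:~R * x ord0 i.

(* |f^(k)|^2 for f^(k) = \int f(x) exp(- 2 i pi k.x) dx, f real-valued. *)
Definition fourier_sq f (k : 'rV[int]_d) : R :=
  (\int[torus d]_x (f x * cos (freq k x))) ^+ 2 +
  (\int[torus d]_x (f x * sin (freq k x))) ^+ 2.

Definition sobolev_norm_ge0 (s : R) f : \bar R :=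
  ((\esum_(k in [set: 'rV[int]_d])
     ((1 + (2 * pi) ^+ 2 * \sum_(i < d) (k ord0 i)%:~R ^+ 2) `^ s
      * fourier_sq f k)%:E) `^ 2^-1)%E.

(* Membership in H^s, for s >= 0. *)
Definition in_sobolev (s : R) f : Prop :=
  [/\ Zperiodic f, measurable_fun setT f,
      ('N[torus d]_2%:E[EFin \o f] < +oo)%E
    & (sobolev_norm_ge0 s f < +oo)%E].

(* For s < 0, the norm of f as an element of the dual of H^(-s), where
   f in L^2 acts by g |-> \int f g. *)
Definition sobolev_norm (s : R) f : \bar R :=
  if 0 <= s then sobolev_norm_ge0 s f
  else ereal_sup [set (`|\int[torus d]_x (f x * g x)|)%:E
         | g in [set g | in_sobolev (- s) g /\
                         (sobolev_norm_ge0 (- s) g <= 1)%E]].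

End torus_functions.

Section mckean_vlasov.
Context {R : realType} {d : nat}.

(* Classical solution: C^{1,2} in the interior of [0, T] x T^d and continuous
   up to the boundary; the values of [rho t] for t outside [0, T] play no role.
   The initial datum, an element of a Sobolev space, is attained almost
   everywhere, i.e. as an equivalence class. *)
Definition mv_solution (T : R) (W phi : 'rV[R]_d -> R)
    (rho : R -> 'rV[R]_d -> R) : Prop :=
  let inner := (`]0, T[%classic `*` setT : set (R * 'rV[R]_d)) in
  [/\ (forall t, t \in `[0, T] -> prob_density (rho t)),
      {within `[0, T]%classic `*` setT,
         continuous (fun z : R * 'rV[R]_d => rho z.1 z.2)},
      {ae torus d, forall x, rho 0 x = phi x},
      [/\ (forall t x, t \in `]0, T[ ->
            derivable (fun u => rho u x) t 1 /\
            forall i j : 'I_d, derivable (rho t) x (delta_mx ord0 i) /\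
              derivable (partial i (rho t)) x (delta_mx ord0 j)),
          {within inner, continuous (fun z : R * 'rV[R]_d =>
             derive1 (fun u => rho u z.2) z.1)},
          (forall i, {within inner, continuous (fun z : R * 'rV[R]_d =>
             partial i (rho z.1) z.2)})
        & (forall i j, {within inner, continuous (fun z : R * 'rV[R]_d =>
             partial j (partial i (rho z.1)) z.2)})]
    & forall t x, t \in `]0, T[ ->
        derive1 (fun u => rho u x) t =
          \sum_(i < d) partial i (partial i (rho t)) x +
          \sum_(i < d)
            partial i (fun y => rho t y * partial i (torus_conv W (rho t)) y) x].

Definition spacetime (T : R) (hT : 0 < T) : probability (R * 'rV[R]_d)%type R :=
  (uniformR hT \x torus d)%E.

Definition L2_spacetime (T : R) (hT : 0 < T) (u : R -> 'rV[R]_d -> R) : \bar R :=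
  let v : R * 'rV[R]_d -> R :=
    (fun z => u z.1 z.2) \_ (`[0, T]%classic `*` setT) in
  'N[spacetime hT]_2%:E[EFin \o v]%E.

End mckean_vlasov.

(* Main.v *)
(** Testing the equation against cos(2 pi k.x + th) turns it into ODEs for the
    Fourier coefficients: with e_k = |rho^(k)|^2, lam_k = |2 pi k|^2 and the flux
    q_i = rho (D_i W * rho), one gets e_k' <= - lam_k e_k + sum_i |q_i^(k)|^2.
    Since |D_i W * rho| <= M, Gronwall bounds the L^2 norm of rho; the gain of one
    power of 1 + lam_k in the Duhamel bound, together with a convolution estimate
    for q^, bootstraps this to sum_k (1 + lam_k)^s sup_t e_k for every s for which
    phi is in H^s.  For s = d this gives sup |rho| <= K (Fejer kernels replace
    Fourier inversion).
    The difference w = rho1 - rho2 solves the same kind of equation with flux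
    w (D W1 * rho1) + rho2 (D W1 * w) + rho2 (D (W1 - W2) * rho2), and Gronwall
    gives (i).  For (ii), V = W1 - W2 satisfies
    |V^(k)|^2 <= 2 (1 + lam_k)^beta |V|_{H^-beta}^2, by testing V against
    trigonometric functions, while dissipation gives the integrated gain
    sum_k (1 + lam_k)^(beta+1) int_0^T e_k <= C; Parseval applied to D V * rho2
    absorbs one factor in the other. *)

Require Import Defs.
From mathcomp Require Import all_boot all_order all_algebra.
From mathcomp Require Import all_classical all_reals all_analysis.
From mathcomp Require Import measurable_realfun ess_sup_inf.
From mathcomp Require Import ring lra.

Set Implicit Arguments.
Unset Strict Implicit.
Unset Printing Implicit Defensive.

Import Order.TTheory GRing.Theory Num.Theory.
Import numFieldNormedType.Exports.

Local Open Scope classical_set_scope.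
Local Open Scope ring_scope.

(** * Continuity and measurability on rows *)

(** The a priori bounds are kept frequency by frequency. A single sequence dominates |u^(k)| for all
    times in [0, T], because the Duhamel step acts on each k separately and needs a source bound
    that is constant in time. Each pass gains a full order because the bounded gradient D_i W has
    square-summable coefficients: D_i^ u^ is then a product of two square-summable sequences, hence
    summable with whatever weight u^ carries, and its convolution with u^ keeps that weight. One
    pointwise fact carries the Fourier analysis: a continuous h satisfies |h(0)| <= S as soon as its
    cosine coefficients have majorants whose finite sums are at most S. Applied to translates it
    gives the sup bound and uniqueness; applied to cross-correlations it gives Parseval and the
    bound for products. L^2 norms are reached only by summing over k, so they satisfy integrated
    inequalities and Gronwall is used in integral form. Time derivatives exist on the open interval
    only; monotonicity arguments combine them with continuity on [0, T]. *)

Lemma open_measurable_row (R : realType) (n : nat) (U : set 'rV[R]_n) :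
  open U -> measurable U.
Proof.
move=> oU.
(* The sigma-algebra on rows is generated by the coordinates, so U is written as a countable union
   of boxes centred in Z^n / (m + 1), of radius 1 / (m + 1). *)
pose box (p : 'rV[int]_n * nat) : set 'rV[R]_n :=
  [set x | forall i, `|x ord0 i - (p.1 ord0 i)%:~R / p.2.+1%:R| < p.2.+1%:R^-1].
rewrite (_ : U = \bigcup_(p in [set p | box p `<=` U]) box p).
  rewrite (_ : \bigcup_(p in _) _ =
    \bigcup_p (if `[< box p `<=` U >] then box p else set0)); last first.
    apply/seteqP; split => [x [p /= bp bx]|x [p _]].
      by exists p => //; rewrite asboolT.
    by case: asboolP => // bp bx; exists p.
  apply: countable_bigcupT_measurable => // p; case: asboolP => // _.
  rewrite (_ : box p = ~` \bigcup_i ~` (@row_coord R n i @^-1`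
     (ball ((p.1 ord0 i)%:~R / p.2.+1%:R : R) (p.2.+1%:R^-1)))).
    apply: measurableC; apply: countable_bigcupT_measurable => // i.
    apply: measurableC; rewrite -[X in measurable X]setTI.
    by apply: measurable_row_coord => //; exact: measurable_ball.
  rewrite setC_bigcup; apply/seteqP; split => x bx i.
    by move=> _; rewrite setCK /row_coord /ball/= distrC; exact: bx.
  by have := bx i I; rewrite setCK /row_coord /ball/= distrC.
apply/seteqP; split => [x Ux|x [p bp /bp//]].
move: oU; rewrite openE => /(_ _ Ux) /nbhs_ballP[e e0 be].
(* Two points of one box of index m differ by less than 2 / (m + 1) in each coordinate; rounding x
   down to the grid finds a box that contains it. *)
have [m me] : exists m : nat, 2 / m.+1%:R < e.
  exists (Num.trunc (2 / e)).
  rewrite ltr_pdivrMr// mulrC -ltr_pdivrMr//.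
  by rewrite truncnS_gt.
exists (\row_i Num.floor (x ord0 i * m.+1%:R), m) => /=; last first.
  move=> i; rewrite mxE.
  have m0 : 0 < (m.+1%:R : R) by [].
  rewrite -(ltr_pM2r m0) -[X in _ * X < _](ger0_norm (ltW m0)) -normrM mulVf ?gt_eqF//.
  rewrite mulrBl mulfVK ?gt_eqF// ger0_norm ?subr_ge0 ?floor_le//.
  by rewrite ltrBlDr addrC -intrD1 floorD1_gt.
move=> y by_; apply: be; split => // i j; rewrite /= /ball/=.
rewrite (ord1 i).
set c : R := (Num.floor (x ord0 j * m.+1%:R))%:~R / m.+1%:R.
have h1 := by_ j; rewrite /= mxE -/c in h1.
have h2 : `|x ord0 j - c| < m.+1%:R^-1.
  have m0 : 0 < (m.+1%:R : R) by [].
  rewrite -(ltr_pM2r m0) -[X in _ * X < _](ger0_norm (ltW m0)) -normrM mulVf ?gt_eqF//.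
  rewrite mulrBl mulfVK ?gt_eqF// ger0_norm ?subr_ge0 ?floor_le//.
  by rewrite ltrBlDr addrC -intrD1 floorD1_gt.
rewrite (_ : x ord0 j - y ord0 j = (x ord0 j - c) - (y ord0 j - c)); last by ring.
apply: le_lt_trans me; apply: le_trans (ler_normB _ _) _.
by rewrite (_ : 2 / m.+1%:R = m.+1%:R^-1 + m.+1%:R^-1) ?lerD ?ltW//; ring.
Qed.

Lemma continuous_measurable_row (R : realType) (n : nat) (f : 'rV[R]_n -> R) :
  continuous f -> measurable_fun setT f.
Proof.
move=> /continuousP cf; apply: (measurability _ (RGenOpens.measurableE R)) => //.
move=> _ [_ [a [b ->] <-]]; rewrite setTI; apply: open_measurable_row.
by apply: cf; exact: interval_open.
Qed.

Section global_continuity.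
Context {R : realType} {P : topologicalType}.
Implicit Types f g : P -> R.

(** The [gcont] rules take an arbitrary topological source, so that they also apply to [subspace]
    types, where they express continuity within [0, T]. *)
Lemma gcont_comp (Q S : topologicalType) (g : Q -> S) (f : P -> Q) :
  continuous g -> continuous f -> continuous (fun p => g (f p)).
Proof. by move=> cg cf p; apply: continuous_comp; [exact: cf|exact: cg]. Qed.

Lemma gcont_cst (Q : topologicalType) (a : Q) : continuous (fun _ : P => a).
Proof. by move=> p; exact: cvg_cst. Qed.

Lemma gcont_pair (Q S : topologicalType) (f : P -> Q) (g : P -> S) :
  continuous f -> continuous g -> continuous (fun p => (f p, g p)).
Proof. by move=> cf cg p; apply: cvg_pair; [exact: cf|exact: cg]. Qed.

Lemma gcontD (V : normedModType R) (f g : P -> V) :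
  continuous f -> continuous g -> continuous (fun p => f p + g p).
Proof. by move=> cf cg p; apply: cvgD; [exact: cf|exact: cg]. Qed.

Lemma gcontN (V : normedModType R) (f : P -> V) :
  continuous f -> continuous (fun p => - f p).
Proof. by move=> cf p; apply: cvgN; exact: cf. Qed.

Lemma gcontB (V : normedModType R) (f g : P -> V) :
  continuous f -> continuous g -> continuous (fun p => f p - g p).
Proof. by move=> cf cg p; apply: cvgB; [exact: cf|exact: cg]. Qed.

Lemma gcontM f g :
  continuous f -> continuous g -> continuous (fun p => f p * g p).
Proof. by move=> cf cg p; apply: cvgM; [exact: cf|exact: cg]. Qed.

Lemma gcontX n f : continuous f -> continuous (fun p => f p ^+ n).
Proof.
move=> cf; elim: n => [|n ih]; first exact: gcont_cst.
by under eq_fun do rewrite exprS; exact: gcontM.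
Qed.

Lemma gcont_norm f : continuous f -> continuous (fun p => `|f p|).
Proof. by move=> cf p; apply: cvg_norm; exact: cf. Qed.

Lemma gcont_sum (I : Type) (r : seq I) (Q : pred I) (F : I -> P -> R) :
  (forall i, Q i -> continuous (F i)) ->
  continuous (fun p => \sum_(i <- r | Q i) F i p).
Proof.
move=> cF; elim: r => [|i r ih].
  by under eq_fun do rewrite big_nil; exact: gcont_cst.
under eq_fun do rewrite big_cons.
by case: (boolP (Q i)) => // Qi; apply: gcontD => //; exact: cF.
Qed.

Lemma gcont_row (n : nat) (f : P -> 'rV[R]_n) :
  (forall i, continuous (fun p => f p ord0 i)) -> continuous f.
Proof.
move=> cf p; apply/cvg_ballP => e e0.
have : \forall q \near p, forall i, ball (f p ord0 i) e (f q ord0 i).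
  by apply: filter_forall => i; have /cvg_ballP := cf i p; exact.
by apply: filterS => q hq; split=> // i j; rewrite (ord1 i); exact: hq.
Qed.

Lemma gcont_coord (n : nat) (f : P -> 'rV[R]_n) (i : 'I_n) :
  continuous f -> continuous (fun p => f p ord0 i).
Proof.
apply: (@gcont_comp _ _ (fun v : 'rV[R]_n => v ord0 i)).
exact: coord_continuous.
Qed.

End global_continuity.

Section global_continuity_pair.
Context {P Q : topologicalType}.

Lemma gcont_id : continuous (fun p : P => p).
Proof. by move=> p; exact: cvg_id. Qed.

Lemma gcont_fst : continuous (fun p : P * Q => p.1).
Proof. by move=> p; exact: cvg_fst. Qed.

Lemma gcont_snd : continuous (fun p : P * Q => p.2).
Proof. by move=> p; exact: cvg_snd. Qed.

End global_continuity_pair.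

(** [row_cons] identifies R x R^n with R^(1 + n) measurably, which brings the case back to rows. *)
Lemma continuous_measurable_prod (R : realType) (n : nat)
    (f : R * 'rV[R]_n -> R) : continuous f -> measurable_fun setT f.
Proof.
move=> cf.
have -> : f = (fun v : 'rV[R]_(1 + n) => f (v ord0 ord0, rsubmx v)) \o @row_cons R n.
  apply/funext => -[t x]; rewrite /= /row_cons row_mxKr /=; congr (f (_, _)).
  rewrite (_ : ord0 = lshift n (ord0 : 'I_1)) ?row_mxEl ?mxE//.
  exact/val_inj.
apply: measurableT_comp; last exact: measurable_row_cons.
apply: continuous_measurable_row; apply: gcont_comp => //.
apply: gcont_pair; first by apply: gcont_coord; exact: gcont_id.
apply: gcont_row => i; under eq_fun do rewrite mxE.
by apply: gcont_coord; exact: gcont_id.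
Qed.

Lemma continuous_measurable_prod_row (R : realType) (m n : nat)
    (f : 'rV[R]_m * 'rV[R]_n -> R) : continuous f -> measurable_fun setT f.
Proof.
move=> cf.
have -> : f = (fun v : 'rV[R]_(m + n) => f (lsubmx v, rsubmx v)) \o
    (fun z => row_mx z.1 z.2).
  by apply/funext => -[t x]; rewrite /= row_mxKr row_mxKl.
apply: measurableT_comp.
  apply: continuous_measurable_row; apply: gcont_comp => //.
  by apply: gcont_pair; apply: gcont_row => i; under eq_fun do rewrite mxE;
    apply: gcont_coord; exact: gcont_id.
apply: measurable_fun_row => i; rewrite -(splitK i).
case: (fintype.split i) => j /=.
  rewrite (_ : _ \o _ = row_coord j \o fst).
    by apply: measurableT_comp => //; exact: measurable_row_coord.
  by apply/funext => z; rewrite /row_coord /= row_mxEl.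
rewrite (_ : _ \o _ = row_coord j \o snd).
  by apply: measurableT_comp => //; exact: measurable_row_coord.
by apply/funext => z; rewrite /row_coord /= row_mxEr.
Qed.

Lemma measurable_row_addr (R : realType) (n : nat) (a : 'rV[R]_n) :
  measurable_fun setT (fun x : 'rV[R]_n => x + a).
Proof.
apply: measurable_fun_row => i; apply: continuous_measurable_row.
rewrite /row_coord /comp; under eq_fun do rewrite !mxE.
by apply: gcontD; [apply: gcont_coord; exact: gcont_id|exact: gcont_cst].
Qed.

Lemma measurable_row_opp (R : realType) (n : nat) :
  measurable_fun setT (fun x : 'rV[R]_n => - x).
Proof.
apply: measurable_fun_row => i; apply: continuous_measurable_row.
rewrite /row_coord /comp; under eq_fun do rewrite !mxE.
by apply: gcontN; apply: gcont_coord; exact: gcont_id.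
Qed.

(** * Invariance of the torus measure *)

Section torus_invariance.
Context {R : realType}.
Local Notation mu := (@lebesgue_measure R).
Local Open Scope ereal_scope.

(** Lebesgue measure is determined by its values on half-open intervals, and a translation preserves
    their length. *)
Lemma lebesgue_measure_shift (a : R) (A : set R) : measurable A ->
  pushforward mu ((fun x => x + a)%R : _ -> measurableTypeR R) A = mu A.
Proof.
move=> mA.
have mf : measurable_fun setT ((fun x => x + a)%R : measurableTypeR R -> measurableTypeR R).
  exact: measurable_funD.
apply/esym; apply: (@lebesgue_measure_unique R
  _) => //.
move=> _ [[b c]] _ <-.
rewrite /= /pushforward.
rewrite (_ : _ @^-1` _ = `](b - a)%R, (c - a)%R]%classic); last first.
  by apply/seteqP; split => x; rewrite /= !in_itv/= ltrBlDr lerBrDr.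
rewrite !lebesgue_measure_itv/= !lte_fin ltrD2r -!EFinD.
by case: ifP => // _; congr (_%:E); ring.
Qed.

(** The reflection that maps [0, 1] to itself turns a half-open interval round, with the same
    length. *)
Lemma lebesgue_measure_refl1 (A : set R) : measurable A ->
  pushforward mu ((fun x => 1 - x)%R : _ -> measurableTypeR R) A = mu A.
Proof.
move=> mA.
have mf : measurable_fun setT ((fun x => 1 - x)%R : measurableTypeR R -> measurableTypeR R).
  exact: measurable_funB.
apply/esym; apply: (@lebesgue_measure_unique R
  _) => //.
move=> _ [[b c]] _ <-.
rewrite /= /pushforward.
rewrite (_ : _ @^-1` _ = `[(1 - c)%R, (1 - b)%R[%classic); last first.
  by apply/seteqP; split => x; rewrite /= !in_itv/= => /andP[? ?]; apply/andP; split; lra.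
rewrite !lebesgue_measure_itv/= !lte_fin ltrD2l ltrN2 -!EFinD.
by case: ifP => // _; congr (_%:E); ring.
Qed.

Lemma ge0_integral_shift (a : R) (D : set R) (f : R -> \bar R) :
  measurable D -> measurable_fun setT f -> (forall x, 0 <= f x) ->
  \int[mu]_(x in [set x | D (x + a)%R]) f (x + a)%R = \int[mu]_(x in D) f x.
Proof.
move=> mD mf f0.
have mg : measurable_fun setT ((fun x => x + a)%R : measurableTypeR R -> measurableTypeR R).
  exact: measurable_funD.
rewrite -[LHS](@ge0_integral_pushforward _ _ _ _ _ _ mg mu D f) //; last exact: measurable_funTS.
by apply: eq_measure_integral => //= A mA AS; exact: lebesgue_measure_shift.
Qed.

Lemma ge0_integral_refl1 (f : R -> \bar R) :
  measurable_fun setT f -> (forall x, 0 <= f x) ->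
  \int[mu]_(x in `[0%R, 1%R]) f (1 - x)%R = \int[mu]_(x in `[0%R, 1%R]) f x.
Proof.
move=> mf f0.
have mg : measurable_fun setT ((fun x => 1 - x)%R : measurableTypeR R -> measurableTypeR R).
  exact: measurable_funB.
rewrite [in LHS](_ : `[0%R, 1%R]%classic = (fun x => 1 - x)%R @^-1` `[0%R, 1%R]%classic); last first.
  by apply/seteqP; split => x; rewrite /= !in_itv/= => /andP[? ?]; apply/andP; split; lra.
rewrite -[LHS](@ge0_integral_pushforward _ _ _ _ _ _ mg mu `[0%R, 1%R]%classic f) //; last exact: measurable_funTS.
by apply: eq_measure_integral => //= A mA AS; exact: lebesgue_measure_refl1.
Qed.

Lemma ge0_integral_period (f : R -> \bar R) (a : R) :
  measurable_fun setT f -> (forall x, 0 <= f x) ->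
  (forall x (k : int), f (x + k%:~R)%R = f x) ->
  \int[mu]_(x in `[0%R, 1%R[) f (x + a)%R = \int[mu]_(x in `[0%R, 1%R[) f x.
Proof.
move=> mf f0 pf.
(* The integer part of a is absorbed by the periodicity of f. *)
wlog a01 : a / (0 <= a < 1)%R.
  move=> H; rewrite -(H (a - (Num.floor a)%:~R)%R).
    apply: eq_integral => x _; rewrite -(pf (x + a)%R (- Num.floor a)%R).
    by rewrite mulrNz addrA.
  by rewrite subr_ge0 floor_le/= ltrBlDr addrC -intrD1 floorD1_gt.
case/andP: a01 => a0 a1.
rewrite [in LHS](_ : `[0%R, 1%R[%classic = [set x | `[a, (1 + a)%R[%classic (x + a)%R]); last first.
  by apply/seteqP; split => x; rewrite /= !in_itv/= => /andP[? ?]; apply/andP; split; lra.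
rewrite ge0_integral_shift//.
(* The interval is cut at 1, and the part beyond 1 is moved back by one period. *)
rewrite (_ : `[a, (1 + a)%R[%classic = `[a, 1%R[ `|` `[1%R, (1 + a)%R[); last first.
  apply/seteqP; split => x; rewrite /= !in_itv/=.
    by move=> /andP[? ?]; have [?|?] := ltP x 1%R; [left|right]; apply/andP; split; lra.
  by move=> [/andP[? ?]|/andP[? ?]]; apply/andP; split; lra.
rewrite ge0_integral_setU//=; [|exact: measurable_funTS|]; last first.
  apply/disj_setPS => x; rewrite /= !in_itv/= => -[/andP[? ?] /andP[? ?]]; lra.
rewrite -[X in _ + X](@ge0_integral_shift 1%R)//.
rewrite (_ : [set x | _ (x + 1)%R] = `[0%R, a[%classic); last first.
  by apply/seteqP; split => x; rewrite /= !in_itv/= => /andP[? ?]; apply/andP; split; lra.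
under [X in _ + X]eq_integral do rewrite (pf _ 1%Z).
rewrite addeC -ge0_integral_setU//=; [|exact: measurable_funTS|]; last first.
  apply/disj_setPS => x; rewrite /= !in_itv/= => -[/andP[? ?] /andP[? ?]]; lra.
congr (\int[_]_(_ in _) _).
apply/seteqP; split => x; rewrite /= !in_itv/=.
  by move=> [/andP[? ?]|/andP[? ?]]; apply/andP; split; lra.
by move=> /andP[? ?]; have [?|?] := ltP x a; [left|right]; apply/andP; split; lra.
Qed.

Lemma uniformR_integral01 (f : R -> \bar R) :
  measurable_fun setT f -> (forall x, 0 <= f x) ->
  \int[uniformR (@ltr01 R)]_x f x = \int[mu]_(x in `[0%R, 1%R]) f x.
Proof.
move=> mf f0; have := @integral_uniform R _ _ (@ltr01 R) f mf f0.
rewrite subr0 invr1 mul1e => <-.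
have mid : measurable_fun setT (id : measurableTypeR R -> R).
  by move=> _ A mA; rewrite setTI.
exact: (@ge0_integral_pushforward _ _ _ _ _ _ mid (uniform_prob (@ltr01 R)) setT f measurableT mf (fun x _ => f0 x)).
Qed.

(** Translation and reflection are treated together through the sign; - x + a is the reflection 1 -
    x followed by the shift a - 1. *)
Lemma ge0_integral_uniformR_affine (s : bool) (a : R) (f : R -> \bar R) :
  measurable_fun setT f -> (forall x, 0 <= f x) ->
  (forall x (k : int), f (x + k%:~R)%R = f x) ->
  \int[uniformR (@ltr01 R)]_x f ((-1) ^+ s * x + a)%R =
  \int[uniformR (@ltr01 R)]_x f x.
Proof.
move=> mf f0 pf.
have shift (g : R -> \bar R) b : measurable_fun setT g -> (forall x, 0 <= g x) ->
  (forall x (k : int), g (x + k%:~R)%R = g x) ->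
  \int[mu]_(x in `[0%R, 1%R]) g (x + b)%R = \int[mu]_(x in `[0%R, 1%R]) g x.
  move=> mg g0 pg.
  rewrite -!integral_itv_bndo_bndc ?ge0_integral_period//.
    exact: measurable_funTS.
  by apply: measurable_funTS; apply: measurableT_comp => //; exact: measurable_funD.
have mfa : measurable_fun setT (fun x : R => f ((-1) ^+ s * x + a)%R).
  apply: measurableT_comp => //; apply: measurable_funD => //.
rewrite !uniformR_integral01//.
case: s mfa => [|] mfa; last first.
  by under eq_integral do rewrite expr0 mul1r; exact: shift.
under eq_integral do rewrite expr1 mulN1r.
rewrite -(ge0_integral_refl1 (f := fun x => f (- x + a)%R))//; last first.
  by move: mfa; under eq_fun do rewrite expr1 mulN1r.
under eq_integral do rewrite opprB -addrA addrC -addrA.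
under eq_integral do rewrite addrA.
rewrite -[RHS](shift _ (- 1 + a)%R)//.
by apply: eq_integral => x _; congr f; ring.
Qed.

Lemma Zperiodic_ge0_row_cons (n : nat) (f : 'rV[R]_n.+1 -> \bar R) :
  (forall x (k : 'rV[int]_n.+1), f (x + map_mx intr k)%R = f x) ->
  forall (t : R) (y : 'rV[R]_n) (j : int) (k : 'rV[int]_n),
  f (row_cons (t + j%:~R, y + map_mx intr k)%R) = f (row_cons (t, y)).
Proof.
move=> pf t y j k.
rewrite -(pf (row_cons (t, y)) (row_mx (const_mx j) k : 'rV_(1 + n))).
congr f; apply/matrixP => i l; rewrite !mxE.
by case: (fintype.split _) => m; rewrite !mxE.
Qed.

Lemma ge0_integral_torusS (n : nat) (f : 'rV[R]_n.+1 -> \bar R) :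
  measurable_fun setT f -> (forall x, 0 <= f x) ->
  \int[torus n.+1]_x f x =
  \int[uniformR (@ltr01 R)]_t \int[torus n]_y f (row_cons (t, y)).
Proof.
move=> mf f0.
rewrite /= /distribution ge0_integral_pushforward//.
rewrite preimage_setT fubini_tonelli1//.
  by apply: measurableT_comp => //; exact: measurable_row_cons.
by move=> x; exact: f0.
Qed.

(** Induction on the dimension: the first coordinate is the one-dimensional case, applied to the
    inner integral as a periodic function of t, and the remaining ones are the induction
    hypothesis. *)
Lemma ge0_integral_torus_affine (s : bool) (n : nat) (a : 'rV[R]_n) (f : 'rV[R]_n -> \bar R) :
  measurable_fun setT f -> (forall x, 0 <= f x) ->
  (forall x (k : 'rV[int]_n), f (x + map_mx intr k)%R = f x) ->
  \int[torus n]_x f ((-1) ^+ s *: x + a)%R = \int[torus n]_x f x.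
Proof.
elim: n => [|n ih] in a f *.
  move=> mf f0 pf; apply: eq_integral => x _; congr f.
  by rewrite [LHS]thinmx0 [RHS]thinmx0.
move=> mf f0 pf.
have maff m (b : 'rV[R]_m) : measurable_fun setT (fun x : 'rV[R]_m => (-1) ^+ s *: x + b)%R.
  case: (s); last by under eq_fun do rewrite expr0 scale1r; exact: measurable_row_addr.
  under eq_fun do rewrite expr1 scaleN1r.
  exact: (measurableT_comp (measurable_row_addr b) (@measurable_row_opp R m)).
have mrow : measurable_fun setT (f \o @row_cons R n).
  by apply: measurableT_comp => //; exact: measurable_row_cons.
rewrite [LHS]ge0_integral_torusS//; last by apply: measurableT_comp => //; exact: maff.
rewrite [RHS](ge0_integral_torusS mf f0).
have mF : measurable_fun setT (fun t : R => \int[torus n]_y f (row_cons (t, y))).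
  apply: (@measurable_fun_fubini_tonelli_F _ _ _ _ _ (torus n) (f \o @row_cons R n)) => // z.
  exact: f0.
apply: (etrans _ (ge0_integral_uniformR_affine s (a ord0 ord0) mF _ _)); last 2 first.
- by move=> t; apply: integral_ge0 => y _; exact: f0.
- move=> t k; apply: eq_integral => y _.
  by rewrite -(@Zperiodic_ge0_row_cons _ _ pf t y k 0) map_mx0 addr0.
apply: eq_integral => t _.
rewrite -[RHS](ih (rsubmx (a : 'rV[R]_(1 + n))))//.
- apply: eq_integral => y _; congr f; apply/matrixP => i j; rewrite !mxE.
  case: (@fintype.splitP 1 n j) => l jl; rewrite !mxE; congr (_ + a _ _)%R.
  + by rewrite (ord1 i).
  + by apply/val_inj; rewrite /= jl (ord1 l).
  + exact/val_inj.
- by apply: measurableT_comp mrow _; exact: measurable_pair1.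
- move=> y k; by rewrite -(@Zperiodic_ge0_row_cons _ _ pf _ y 0 k) addr0.
Qed.

End torus_invariance.

Lemma gcontP (R : realType) (P : topologicalType) (f : P -> R) :
  (forall p e, 0 < e -> \forall q \near p, `|f p - f q| < e) -> continuous f.
Proof. by move=> cf p; apply/cvgrPdist_lt => e e0; exact: cf. Qed.

(** * Calculus on the torus *)

Section torus_calculus.
Context {R : realType} {d : nat}.
Local Notation E := 'rV[R]_d.
Local Notation mu := (@torus R d).
Implicit Types f g : E -> R.

Definition tintegrable f := mu.-integrable setT (EFin \o f).

Definition mbounded f :=
  measurable_fun setT f /\ exists C : R, forall x, `|f x| <= C.

Definition cper f := continuous f /\ Zperiodic f.

Lemma integral_torus_affine (s : bool) (a : E) (f : E -> \bar R) :
  measurable_fun setT f ->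
  (forall x (k : 'rV[int]_d), f (x + map_mx intr k) = f x) ->
  (\int[mu]_x f ((-1) ^+ s *: x + a)%R = \int[mu]_x f x)%E.
Proof.
move=> mf pf; rewrite integralE [RHS]integralE; congr (_ - _)%E.
- rewrite -[RHS](ge0_integral_torus_affine s a (measurable_funepos mf))//; first by apply: eq_integral => x _; rewrite !(funeposE, funenegE).
  by move=> x k; rewrite !funeposE pf.
- rewrite -[RHS](ge0_integral_torus_affine s a (measurable_funeneg mf))//; first by apply: eq_integral => x _; rewrite !(funeposE, funenegE).
  by move=> x k; rewrite !funenegE pf.
Qed.

Lemma Rintegral_torus_affine (s : bool) (a : E) f :
  measurable_fun setT f -> Zperiodic f ->
  \int[mu]_x f ((-1) ^+ s *: x + a) = \int[mu]_x f x.
Proof.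
move=> mf pf; rewrite /Rintegral; congr fine.
rewrite -[RHS](integral_torus_affine s a)//; first exact/measurable_EFinP.
by move=> x k; rewrite pf.
Qed.

Lemma mbounded_tintegrable f : mbounded f -> tintegrable f.
Proof.
move=> [mf [C fC]]; apply: measurable_bounded_integrable => //.
  by rewrite -[ltLHS]/(mu setT) probability_setT ltry.
by exists C; split; [exact: num_real|move=> M CM x _; apply: le_trans (ltW CM)].
Qed.

Lemma mbounded_cst (a : R) : mbounded (fun=> a).
Proof. by split; [exact: measurable_cst|exists `|a|]. Qed.

Lemma mboundedD f g : mbounded f -> mbounded g -> mbounded (fun x => f x + g x).
Proof.
move=> [mf [C fC]] [mg [D gD]]; split; first exact: measurable_funD.
by exists (C + D) => x; rewrite (le_trans (ler_normD _ _))// lerD.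
Qed.

Lemma mboundedN f : mbounded f -> mbounded (fun x => - f x).
Proof.
move=> [mf [C fC]]; split; first exact: measurableT_comp.
by exists C => x; rewrite normrN.
Qed.

Lemma mboundedB f g : mbounded f -> mbounded g -> mbounded (fun x => f x - g x).
Proof. by move=> bf bg; apply: mboundedD => //; exact: mboundedN. Qed.

Lemma mboundedM f g : mbounded f -> mbounded g -> mbounded (fun x => f x * g x).
Proof.
move=> [mf [C fC]] [mg [D gD]]; split; first exact: measurable_funM.
by exists (C * D) => x; rewrite normrM ler_pM.
Qed.

Lemma mboundedZ (a : R) f : mbounded f -> mbounded (fun x => a * f x).
Proof. by move=> bf; apply: mboundedM => //; exact: mbounded_cst. Qed.

Lemma mboundedX n f : mbounded f -> mbounded (fun x => f x ^+ n).
Proof.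
move=> bf; elim: n => [|n ih]; first exact: mbounded_cst.
by under eq_fun do rewrite exprS; exact: mboundedM.
Qed.

Lemma mbounded_norm f : mbounded f -> mbounded (fun x => `|f x|).
Proof.
move=> [mf [C fC]]; split; first exact: measurableT_comp.
by exists C => x; rewrite normr_id.
Qed.

Lemma mbounded_sum (I : Type) (r : seq I) (Q : pred I) (F : I -> E -> R) :
  (forall i, Q i -> mbounded (F i)) -> mbounded (fun x => \sum_(i <- r | Q i) F i x).
Proof.
move=> bF; elim: r => [|i r ih].
  by under eq_fun do rewrite big_nil; exact: mbounded_cst.
under eq_fun do rewrite big_cons.
by case: (boolP (Q i)) => // Qi; apply: mboundedD => //; exact: bF.
Qed.

Lemma tintegrableM f g : tintegrable f -> mbounded g -> tintegrable (fun x => f x * g x).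
Proof.
move=> fi [mg [C gC]].
have gb : [bounded g x | x in setT].
  by exists C; split; [exact: num_real|move=> M CM x _; apply: le_trans (ltW CM)].
exact: (integrableMl measurableT fi mg gb).
Qed.

Lemma tintegrableMr f g : mbounded f -> tintegrable g -> tintegrable (fun x => f x * g x).
Proof. by move=> bf ig; under eq_fun do rewrite mulrC; exact: tintegrableM. Qed.

Lemma tintegrableD f g : tintegrable f -> tintegrable g -> tintegrable (fun x => f x + g x).
Proof. by move=> fi gi; exact: (integrableD measurableT fi gi). Qed.

Lemma tintegrableB f g : tintegrable f -> tintegrable g -> tintegrable (fun x => f x - g x).
Proof. by move=> fi gi; exact: (integrableB measurableT fi gi). Qed.

Lemma tintegrable_sum (I : Type) (r : seq I) (F : I -> E -> R) :
  (forall i, tintegrable (F i)) -> tintegrable (fun x => \sum_(i <- r) F i x).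
Proof.
move=> bF; elim: r => [|i r ih].
  by under eq_fun do rewrite big_nil; exact/mbounded_tintegrable/mbounded_cst.
under eq_fun do rewrite big_cons.
exact: tintegrableD.
Qed.

Lemma tintegral_sum (I : Type) (r : seq I) (F : I -> E -> R) :
  (forall i, tintegrable (F i)) ->
  \int[mu]_x (\sum_(i <- r) F i x) = \sum_(i <- r) \int[mu]_x F i x.
Proof.
move=> bF; elim: r => [|i r ih].
  under eq_Rintegral do rewrite big_nil.
  by rewrite big_nil Rintegral_cst//= mul0r.
under eq_Rintegral do rewrite big_cons.
by rewrite big_cons RintegralD// ?ih//; [exact: bF|exact: tintegrable_sum].
Qed.

Lemma tintegral_cst (a : R) : \int[mu]_x a = a.
Proof.
rewrite Rintegral_cst// [X in _ * fine X](_ : _ = 1%E) ?mulr1//.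
exact: (@probability_setT _ _ _ mu).
Qed.

Lemma tintegral_le_cst f (C : R) : tintegrable f -> (forall x, f x <= C) ->
  \int[mu]_x f x <= C.
Proof.
move=> fi fC; rewrite -[leRHS]tintegral_cst; apply: le_Rintegral => //.
exact/mbounded_tintegrable/mbounded_cst.
Qed.

Lemma tintegral_norm_le f g (C : R) : tintegrable g -> mbounded f ->
  (forall x, `|f x| <= C) ->
  `|\int[mu]_x (g x * f x)| <= C * \int[mu]_x `|g x|.
Proof.
move=> gi bf fC.
have ng : tintegrable (fun x => `|g x|).
  have := integrable_norm gi; exact.
apply: le_trans (le_normr_Rintegral _ _) _ => //; first exact: tintegrableM.
rewrite -RintegralZl//; apply: le_Rintegral => //.
- have := integrable_norm (tintegrableM gi bf); exact.
- by rewrite -[_.-integrable _ _]/(tintegrable _); under eq_fun do rewrite mulrC;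
    apply: tintegrableM => //; exact: mbounded_cst.
- by move=> x _; rewrite normrM mulrC ler_wpM2r.
Qed.

(** A compact set that meets every Z^d-orbit; it stands in for the compactness of the torus. *)
Definition cell : set E := [set x | forall i, `[0%R, 1%R]%classic (x ord0 i)].

Lemma compact_cell : compact cell.
Proof. by apply: (@rV_compact R d (fun=> `[0%R, 1%R]%classic)) => i; exact: segment_compact. Qed.

Lemma cell_repr (x : E) : exists k : 'rV[int]_d, cell (x + map_mx intr k).
Proof.
exists (\row_i - Num.floor (x ord0 i)) => i; rewrite /= !mxE in_itv/= mulrNz.
by rewrite subr_ge0 floor_le/= lerBlDr addrC -intrD1 ltW// floorD1_gt.
Qed.

Lemma cper_mbounded f : cper f -> mbounded f.
Proof.
move=> [cf pf]; split; first exact: continuous_measurable_row.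
have : bounded_set (f @` cell).
  apply: compact_bounded; apply: continuous_compact compact_cell.
  exact: continuous_subspaceT.
case=> M [_ hM]; exists (M + 1) => x.
have [k xk] := cell_repr x.
by apply: (hM (M + 1)); [rewrite ltrDl|exists (x + map_mx intr k)].
Qed.

Section tube.
Variables (P : topologicalType) (F : P -> E -> R) (p0 : P).
Hypothesis cF : forall x, F z.1 z.2 @[z --> (p0, x)] --> F p0 x.

Lemma tube_nbhs (x : E) (e : R) : 0 < e -> exists U : set P, exists V : set E,
  [/\ nbhs p0 U, nbhs x V & forall p y, U p -> V y -> `|F p y - F p0 x| < e].
Proof.
move=> e0; have /cvgrPdist_lt/(_ _ e0) := cF (x := x).
move=> [[U V] /= [nU nV] UV]; exists U, V; split => // p y Up Vy.
by rewrite distrC; exact: (UV (p, y)).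
Qed.

Lemma tube_slice : continuous (F p0).
Proof.
apply: gcontP => x e e0.
have [U [V [nU nV UV]]] := tube_nbhs x e0.
by apply: filterS nV => y Vy; rewrite distrC; apply: UV => //; exact: nbhs_singleton.
Qed.

Hypothesis pF : \forall p \near p0, Zperiodic (F p).

(** Compactness of [cell] turns joint continuity at the points (p0, x) into convergence uniform in
    x. Continuity is asked at the parameter p0 alone, since the derivatives of a solution are
    continuous only for 0 < t < T. *)
Lemma tube (e : R) : 0 < e -> \forall p \near p0, forall x, `|F p x - F p0 x| < e.
Proof.
move=> e0.
have /compact_near_coveringP := compact_cell.
move=> /(_ _ (nbhs p0) (fun p x => `|F p x - F p0 x| < e)) H.
have : \forall p \near p0, cell `<=` (fun x => `|F p x - F p0 x| < e).
  apply: H => x _.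
  have [U [V [nU nV UV]]] := tube_nbhs x (divr_gt0 e0 (ltr0n _ 2)).
  exists (V, U) => //= -[y p] /= [Vy Up].
  rewrite (splitr e) (_ : F p y - F p0 y = (F p y - F p0 x) - (F p0 y - F p0 x)); last by ring.
  apply: le_lt_trans (ler_normB _ _) _; apply: ltrD; apply: UV => //.
  exact: nbhs_singleton.
have pF0 := nbhs_singleton pF.
apply: filterS2 pF => p pFp Fp x; have [k xk] := cell_repr x.
by rewrite -(pFp x k) -(pF0 x k); exact: Fp.
Qed.

End tube.

Lemma tube_integral (P : topologicalType) (F : P -> E -> R) (p0 : P) (g : E -> R) :
  (forall x, F z.1 z.2 @[z --> (p0, x)] --> F p0 x) ->
  (forall p, Zperiodic (F p)) -> (forall p, mbounded (F p)) -> tintegrable g ->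
  \int[mu]_x (g x * F p x) @[p --> p0] --> \int[mu]_x (g x * F p0 x).
Proof.
move=> cF pF mF ig; apply/cvgrPdist_le => e e0.
have I0 : 0 <= \int[mu]_x `|g x| by apply: Rintegral_ge0.
set J := \int[mu]_x `|g x| in I0.
have J1 : 0 < J + 1 by rewrite ltr_pwDr.
have pFn : \forall p \near p0, Zperiodic (F p) by exact: nearW.
have := tube cF pFn (divr_gt0 e0 J1); apply: filterS => p hp.
rewrite distrC -RintegralB//; [|exact: tintegrableM..].
under eq_Rintegral do rewrite -mulrBr.
apply: (@le_trans _ _ (e / (J + 1) * J)).
  apply: tintegral_norm_le => //; first exact: mboundedB.
  by move=> x; exact: ltW.
by rewrite mulrAC ler_pdivrMr// ler_pM2l// lerDl.
Qed.

Lemma gcont_tintegral (P : topologicalType) (F : P -> E -> R) (g : E -> R) :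
  continuous (fun z : P * E => F z.1 z.2) ->
  (forall p, Zperiodic (F p)) -> tintegrable g ->
  continuous (fun p => \int[mu]_x (g x * F p x)).
Proof.
move=> cF pF ig p; apply: tube_integral => // [x|q].
  exact: (cF (p, x)).
apply: cper_mbounded; split => //.
by apply: (@tube_slice _ F q) => x; exact: (cF (q, x)).
Qed.

Lemma gcont_tintegral1 (P : topologicalType) (F : P -> E -> R) :
  continuous (fun z : P * E => F z.1 z.2) ->
  (forall p, Zperiodic (F p)) -> continuous (fun p => \int[mu]_x (F p x)).
Proof.
move=> cF pF; have := gcont_tintegral cF pF (mbounded_tintegrable (mbounded_cst 1)).
by under eq_fun do under eq_Rintegral do rewrite mul1r.
Qed.

(** By [tube] with tolerance 1, |F' t| <= C + 1 for t near a, where C bounds |F' a|; on a smaller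
    interval around a this gives the integrable majorant |g| (C + 1). *)
Lemma is_derive_tintegral (F F' : R -> E -> R) (u v a : R) (g : E -> R) :
  a \in `]u, v[ -> tintegrable g ->
  (forall t, t \in `]u, v[ -> mbounded (F t)) ->
  (forall t x, t \in `]u, v[ -> is_derive t 1 (F ^~ x) (F' t x)) ->
  (forall t, t \in `]u, v[ -> Zperiodic (F' t)) ->
  (forall x, F' z.1 z.2 @[z --> (a, x)] --> F' a x) ->
  is_derive a 1 (fun t => \int[mu]_x (g x * F t x)) (\int[mu]_x (g x * F' a x)).
Proof.
move=> auv ig mF dF pF' cF'.
have [_ [C F'C]] : mbounded (F' a).
  by apply: cper_mbounded; split; [exact: tube_slice cF'|exact: pF'].
have pF'n : \forall t \near a, Zperiodic (F' t).
  by apply: filterS (near_in_itvoo auv) => t; exact: pF'.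
have := tube cF' pF'n ltr01.
move=> /nbhs_ballP[r /= r0 hr].
have auv' := auv; rewrite in_itv/= in auv'; case/andP: auv' => ua av.
pose u' := Num.max u (a - r); pose v' := Num.min v (a + r).
have Ia : `]u', v'[%classic a.
  by rewrite /= in_itv/= gt_max lt_min ua av/= ltrBlDr !ltrDl r0.
have Isub t : `]u', v'[%classic t -> (t \in `]u, v[) /\ ball a r t.
  rewrite /= in_itv/= gt_max lt_min => /andP[/andP[h1 h2] /andP[h3 h4]].
  rewrite in_itv/= h1 h3; split => //; rewrite /ball/= ltr_norml; apply/andP; split; lra.
have dgF t x : t \in `]u, v[ -> is_derive t 1 (fun s => g x * F s x) (g x * F' t x).
  by move=> tuv; apply: is_deriveZ; exact: dF.
have d1E t x : t \in `]u, v[ -> partial1of2 (fun s y => g y * F s y) t x = g x * F' t x.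
  by move=> tuv; rewrite partial1of2E; apply: derive_val; exact: dgF.
have H1 : forall t, `]u', v'[%classic t -> mu.-integrable setT (EFin \o (fun y => g y * F t y)).
  by move=> t /Isub[tuv _]; apply: tintegrableM => //; exact: mF.
have H2 : forall t (y : E), `]u', v'[%classic t -> setT y ->
    derivable ((fun s y => g y * F s y) ^~ y) t 1.
  by move=> t y /Isub[tuv _] _; have [] := dgF t y tuv.
have H3 : forall y, 0 <= `|g y| * (C + 1).
  by move=> y; rewrite mulr_ge0// addr_ge0// (le_trans _ (F'C 0)).
have H4 : mu.-integrable setT (EFin \o (fun y => `|g y| * (C + 1))).
  apply: (@tintegrableM (fun y => `|g y|)); last exact: mbounded_cst.
  exact: (integrable_norm ig).
have H5 : forall t (y : E), `]u', v'[%classic t -> setT y ->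
    `|partial1of2 (fun s y => g y * F s y) t y| <= `|g y| * (C + 1).
  move=> t y /Isub[tuv bt] _; rewrite d1E// normrM ler_wpM2l//.
  rewrite (_ : F' t y = F' a y + (F' t y - F' a y)); last by ring.
  apply: le_trans (ler_normD _ _) _; rewrite lerD//.
  by apply/ltW/hr.
split.
  exact: (derivable_under_integral measurableT Ia H1 H2 H3 H4 H5).
rewrite -derive1E (differentiation_under_integral measurableT Ia H1 H2 H3 H4 H5).
by apply: eq_Rintegral => y _; rewrite d1E.
Qed.

(** Reduces directional derivatives on rows to one-variable calculus along a line. *)
Lemma derive_line f (x v : E) (s : R) :
  (derivable f (s *: v + x) v <-> derivable (fun t : R => f (t *: v + x)) s 1) /\
  'D_v f (s *: v + x) = 'D_1 (fun t : R => f (t *: v + x)) s.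
Proof.
have h : (fun h : R => h^-1 *: ((f \o shift (s *: v + x)) (h *: v) - f (s *: v + x))) =
   (fun h : R => h^-1 *: (((fun t : R => f (t *: v + x)) \o shift s) (h *: 1) - f (s *: v + x))).
  by apply/funext => h /=; rewrite -[h%:A]/(h * 1) mulr1 scalerDl addrA.
by rewrite /derivable /derive h.
Qed.

Definition basis (i : 'I_d) : E := delta_mx ord0 i.

Lemma partial_line f i x :
  (forall y, derivable f y (basis i)) ->
  forall s : R, is_derive s 1 (fun t : R => f (t *: basis i + x)) (partial i f (s *: basis i + x)).
Proof.
move=> df s; have [[h _] e] := derive_line f x (basis i) s.
by split; [exact: h|rewrite -e].
Qed.

Lemma Zperiodic_partial i f : Zperiodic f -> Zperiodic (partial i f).
Proof.
move=> pf x k; rewrite /partial /derive.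
have -> : (fun h : R => h^-1 *: ((f \o shift (x + map_mx intr k)) (h *: delta_mx ord0 i)
    - f (x + map_mx intr k))) =
  (fun h : R => h^-1 *: ((f \o shift x) (h *: delta_mx ord0 i) - f x)).
  by apply/funext => h /=; rewrite addrA !pf.
by [].
Qed.

(** Regularity in the single direction i, the unit in which convolution and integration by parts are
    stated. *)
Definition C1 i f := [/\ cper f, forall x, derivable f x (basis i) & continuous (partial i f)].

Lemma C1_partial_cper i f : C1 i f -> cper (partial i f).
Proof. by move=> [[_ pf] _ cf]; split => //; exact: Zperiodic_partial. Qed.

Lemma cper_reflect f (x : E) : cper f -> cper (fun y => f (x - y)).
Proof.
move=> [cf pf]; split.
  by apply: gcont_comp => //; apply: gcontB; [exact: gcont_cst|exact: gcont_id].
move=> y k; rewrite -(pf (x - (y + map_mx intr k)) k); congr f.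
by rewrite opprD addrA subrK.
Qed.

(** The derivative falls on f: the integral is differentiated at t = 0 along the line x + t e_i,
    with g as a fixed integrable weight. *)
Lemma conv_partial i f (g : E -> R) : tintegrable g -> C1 i f ->
  C1 i (fun x => \int[mu]_y (g y * f (x - y))) /\
  partial i (fun x => \int[mu]_y (g y * f (x - y))) =
  (fun x => \int[mu]_y (g y * partial i f (x - y))).
Proof.
move=> ig [[cf pf] df cpf].
have ppf := Zperiodic_partial i pf.
have cxy (h : E -> R) : cper h -> cper (fun x => \int[mu]_y (g y * h (x - y))).
  move=> ch; split.
    refine (@gcont_tintegral E (fun x y => h (x - y)) g _ _ ig).
      apply: gcont_comp; first by case: ch.
      by apply: gcontB; [exact: gcont_fst|exact: gcont_snd].
    by move=> x; have [] := cper_reflect x ch.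
  by move=> x k; apply: eq_Rintegral => y _; rewrite addrAC; have [_ ->] := ch.
have D x : is_derive (0 : R) 1 (fun t : R => \int[mu]_y (g y * f (t *: basis i + x - y)))
   (\int[mu]_y (g y * partial i f (x - y))).
  have := @is_derive_tintegral (fun t y => f (t *: basis i + x - y))
    (fun t y => partial i f (t *: basis i + x - y)) (- 1) 1 0 g.
  rewrite scale0r add0r; apply => //.
  - by rewrite in_itv/= ltrN10 ltr01.
  - by move=> t _; apply: cper_mbounded; exact: cper_reflect.
  - move=> t y _; rewrite -addrA; under eq_fun do rewrite -addrA.
    exact: partial_line.
  - by move=> t _; have [] := cper_reflect (t *: basis i + x) (conj cpf ppf).
  - move=> y.
    have : continuous (fun z : R * E => partial i f (z.1 *: basis i + x - z.2)).
      apply: gcont_comp => //; apply: gcontB; last exact: gcont_snd.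
      apply: gcontD; last exact: gcont_cst.
      apply: gcont_row => j; under eq_fun do rewrite mxE.
      by apply: gcontM; [exact: gcont_fst|exact: gcont_cst].
    by move=> /(_ (0, y)); rewrite /continuous_at/= scale0r add0r.
have L x := derive_line (fun z => \int[mu]_y (g y * f (z - y))) x (basis i) 0.
have pE : partial i (fun x => \int[mu]_y (g y * f (x - y))) =
  (fun x => \int[mu]_y (g y * partial i f (x - y))).
  apply/funext => x; have [_ h] := L x; rewrite scale0r add0r in h.
  by rewrite /partial h; have [_ ->] := D x.
split; last exact: pE.
split.
- exact: cxy.
- move=> x; have [[_ h] _] := L x; rewrite scale0r add0r in h.
  by apply: h; have [] := D x.
- by rewrite pE; have [] := cxy _ (conj cpf ppf).
Qed.

Lemma C1M i f g : C1 i f -> C1 i g -> C1 i (fun x => f x * g x) /\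
  partial i (fun x => f x * g x) = (fun x => partial i f x * g x + f x * partial i g x).
Proof.
move=> [[cf pf] df cpf] [[cg pg] dg cpg].
have pE : partial i (fun x => f x * g x) = (fun x => partial i f x * g x + f x * partial i g x).
  apply/funext => x; rewrite /partial (deriveM (df x) (dg x)) /GRing.scale/=.
  by rewrite addrC mulrC.
split; last exact: pE.
split.
- by split; [exact: gcontM|move=> x k; rewrite pf pg].
- by move=> x; exact: (derivableM (df x) (dg x)).
- by rewrite pE; apply: gcontD; exact: gcontM.
Qed.

Lemma tintegral_reflect f (x : E) : measurable_fun setT f -> Zperiodic f ->
  \int[mu]_y f (x - y) = \int[mu]_y f y.
Proof.
move=> mf pf; rewrite -[RHS](Rintegral_torus_affine true x mf pf).
by apply: eq_Rintegral => y _; rewrite expr1 scaleN1r addrC.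
Qed.

(** By invariance x |-> \int f(x - y) dy is constant, and its partial derivative at 0 is the
    integral of the partial derivative; no boundary term ever arises. *)
Lemma tintegral_partial0 i f : C1 i f -> \int[mu]_x partial i f x = 0.
Proof.
move=> Cf; have [[cf pf] df cpf] := Cf.
have [_ h] := conv_partial (mbounded_tintegrable (mbounded_cst 1)) Cf.
have [_ ppf] := C1_partial_cper Cf.
rewrite -(tintegral_reflect 0)//; last exact: continuous_measurable_row.
have /(congr1 (@^~ 0)) := h.
under [X in _ = X]eq_Rintegral do rewrite mul1r.
move=> <-.
rewrite (_ : (fun x => _) = cst (\int[mu]_y f y)); last first.
  apply/funext => x; under eq_Rintegral do rewrite mul1r.
  by apply: tintegral_reflect => //; exact: continuous_measurable_row.
by rewrite /partial derive_cst.
Qed.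

Lemma tintegral_ibp i f g : C1 i f -> C1 i g ->
  \int[mu]_x (partial i f x * g x) = - \int[mu]_x (f x * partial i g x).
Proof.
move=> Cf Cg; have [Cfg fgE] := C1M Cf Cg.
have := tintegral_partial0 Cfg; rewrite fgE.
have bf : mbounded f by apply: cper_mbounded; case: Cf.
have bg : mbounded g by apply: cper_mbounded; case: Cg.
have bpf : mbounded (partial i f) by apply: cper_mbounded; exact: C1_partial_cper.
have bpg : mbounded (partial i g) by apply: cper_mbounded; exact: C1_partial_cper.
rewrite RintegralD//; [|exact/mbounded_tintegrable/mboundedM..].
by move/eqP; rewrite addr_eq0 => /eqP.
Qed.

End torus_calculus.

(** * Fourier coefficients *)

Section fourier.
Context {R : realType} {d : nat}.
Local Notation E := 'rV[R]_d.
Local Notation Z := 'rV[int]_d.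
Local Notation mu := (@torus R d).
Implicit Types (f g : E -> R) (k l : Z) (th : R).

(** The phase replaces complex exponentials: a derivative shifts it by pi / 2, a translation by y
    shifts it by [freq k y], and the sine is the phase - pi / 2. *)
Definition tr k th (x : E) : R := cos (freq k x + th).

(* With phases 0 and - pi / 2 this is the cosine, resp. sine, coefficient. *)
Definition fc f k th : R := \int[mu]_x (f x * tr k th x).

Definition kap k (i : 'I_d) : R := 2 * pi * (k ord0 i)%:~R.

Lemma freqD k l (x : E) : freq (k + l) x = freq k x + freq l x.
Proof.
rewrite /freq -mulrDr -big_split; congr (_ * _); apply: eq_bigr => i _ /=.
by rewrite mxE intrD mulrDl.
Qed.

Lemma freqN k (x : E) : freq (- k) x = - freq k x.
Proof.
rewrite /freq -mulrN -sumrN; congr (_ * _); apply: eq_bigr => i _ /=.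
by rewrite mxE mulrNz mulNr.
Qed.

Lemma freqB k l (x : E) : freq (k - l) x = freq k x - freq l x.
Proof. by rewrite freqD freqN. Qed.

Lemma freq0 (x : E) : freq 0 x = 0.
Proof. by rewrite /freq big1 ?mulr0// => i _; rewrite mxE mul0r. Qed.

Lemma freqDr k (x y : E) : freq k (x + y) = freq k x + freq k y.
Proof.
rewrite /freq -mulrDr -big_split; congr (_ * _); apply: eq_bigr => i _ /=.
by rewrite mxE mulrDr.
Qed.

Lemma freqZr k (a : R) (x : E) : freq k (a *: x) = a * freq k x.
Proof.
rewrite /freq mulrCA; congr (_ * _); rewrite mulr_sumr; apply: eq_bigr => i _ /=.
by rewrite mxE mulrCA.
Qed.

Lemma freqNr k (x : E) : freq k (- x) = - freq k x.
Proof. by rewrite -scaleN1r freqZr mulN1r. Qed.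

Lemma freq_basis k i : freq k (basis i : E) = kap k i.
Proof.
rewrite /freq /kap; congr (_ * _).
rewrite (bigD1 i)//= big1 ?addr0 => [|j ji]; rewrite mxE eqxx/=.
  by rewrite eqxx mulr1.
by rewrite (negbTE ji) mulr0.
Qed.

Lemma cosD2pin (n : nat) (x : R) : cos (x + 2 * pi * n%:R) = cos x.
Proof.
elim: n => [|n ih]; first by rewrite mulr0 addr0.
rewrite (_ : x + _ = x + 2 * pi * n%:R + pi *+ 2) ?cosD2pi//.
by rewrite -natr1 mulr2n; ring.
Qed.

Lemma cosD2piz (z : int) (x : R) : cos (x + 2 * pi * z%:~R) = cos x.
Proof.
case: z => n; first by rewrite -pmulrn cosD2pin.
rewrite NegzE mulrNz mulrN -pmulrn -(cosD2pin n.+1 (x - _)).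
by congr cos; ring.
Qed.

Lemma continuous_freq k : continuous (freq k : E -> R).
Proof.
apply: gcontM; first exact: gcont_cst.
apply: gcont_sum => i _; apply: gcontM; first exact: gcont_cst.
by apply: gcont_coord; exact: gcont_id.
Qed.

Lemma cper_tr k th : cper (tr k th).
Proof.
split.
  apply: (gcont_comp (g := cos)); first exact: continuous_cos.
  by apply: gcontD; [exact: continuous_freq|exact: gcont_cst].
move=> x j; rewrite /tr freqDr addrAC {2}/freq.
have -> : \sum_(i < d) (k ord0 i)%:~R * (map_mx intr j : E) ord0 i =
    (\sum_(i < d) (k ord0 i) * (j ord0 i))%:~R :> R.
  by rewrite rmorph_sum/=; apply: eq_bigr => i _; rewrite mxE intrM.
by rewrite cosD2piz.
Qed.

Lemma mbounded_tr k th : mbounded (tr k th).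
Proof. exact/cper_mbounded/cper_tr. Qed.

Lemma tr_norm_le1 k th x : `|tr k th x| <= 1.
Proof. exact: cos_max. Qed.

Lemma derive_tr i k th x :
  derivable (tr k th) x (basis i) /\ partial i (tr k th) x = kap k i * tr k (th + pi / 2) x.
Proof.
have [] := derive_line (tr k th) x (basis i) 0.
rewrite scale0r add0r => h e.
have D : is_derive (0 : R) 1 (fun t : R => tr k th (t *: basis i + x))
    (kap k i * tr k (th + pi / 2) x).
  have -> : (fun t : R => tr k th (t *: basis i + x)) =
      cos \o (fun t : R => t * kap k i + (freq k x + th)).
    by apply/funext => t; rewrite /tr/= freqDr freqZr freq_basis addrA.
  have Dl : is_derive (0 : R) 1 (fun t : R => t * kap k i + (freq k x + th)) (kap k i).
    have := is_deriveD (is_deriveM (is_derive_id (0 : R) 1) (is_derive_cst (kap k i) (0 : R) 1))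
      (is_derive_cst (freq k x + th) (0 : R) 1).
    by move=> H; apply: is_derive_eq; rewrite /GRing.scale/= mulr0 add0r mulr1 addr0.
  set u := (fun t : R => t * kap k i + (freq k x + th)) in Dl *.
  have Dc := is_derive_cos (u 0).
  have D := @is_derive1_comp _ cos u _ _ _ Dc Dl.
  apply: is_derive_eq.
  by rewrite /u mul0r add0r /tr addrA cosDpihalf mulrC.
by split; [apply/h; case: D|rewrite /partial e; case: D].
Qed.

Lemma partial_tr i k th : partial i (tr k th) = (fun x => kap k i * tr k (th + pi / 2) x).
Proof. by apply/funext => x; have [] := derive_tr i k th x. Qed.

Lemma C1_tr i k th : C1 i (tr k th).
Proof.
split; [exact: cper_tr|by move=> x; have [] := derive_tr i k th x|].
rewrite partial_tr; apply: gcontM; first exact: gcont_cst.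
by have [] := cper_tr k (th + pi / 2).
Qed.

(** The factor a makes the family closed under partial derivatives, which multiply by [kap k i], so
    that the induction hypothesis applies to them. *)
Lemma Ck_tr n k th (a : R) : Ck n (fun x => a * tr k th x).
Proof.
elim: n th a => [|n ih] th a; (split; first by apply: gcontM;
  [exact: gcont_cst|have [] := cper_tr k th]) => // i.
have D x : derivable (fun y => a * tr k th y) x (basis i) :=
  derivableZ (derive_tr i k th x).1.
split; first by move=> x; exact: D.
rewrite (_ : partial i _ = (fun x => (a * kap k i) * tr k (th + pi / 2) x)); first exact: ih.
apply/funext => x; rewrite /partial.
rewrite (deriveZ a (derive_tr i k th x).1).
have [_] := derive_tr i k th x.
by rewrite /partial => ->; rewrite /GRing.scale/= mulrA.
Qed.

Lemma test_function_tr k th : test_function (tr k th).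
Proof.
split; first by have [] := cper_tr k th.
by move=> n; have := Ck_tr n k th 1; under eq_fun do rewrite mul1r.
Qed.

Lemma tr_mul k l th et x :
  tr k th x * tr l et x = (tr (k + l) (th + et) x + tr (k - l) (th - et) x) / 2.
Proof.
rewrite /tr freqD freqB.
rewrite (_ : _ + _ + (th + et) = (freq k x + th) + (freq l x + et)); last by ring.
rewrite (_ : _ - _ + (th - et) = (freq k x + th) - (freq l x + et)); last by ring.
set a := freq k x + th; set b := freq l x + et.
by rewrite (cosB a b) (cosD a b); field.
Qed.

Lemma kap_eq0 k : k != 0 -> exists i, kap k i != 0.
Proof.
move=> k0; have [i ki] : exists i, k ord0 i != 0.
  apply/existsP; apply: contraNT k0; rewrite negb_exists => /forallP h.
  by apply/eqP/rowP => i; rewrite mxE; apply/eqP; have := h i; rewrite negbK.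
exists i; rewrite /kap !mulf_neq0 ?pnatr_eq0 ?intr_eq0//.
by rewrite gt_eqF// pi_gt0.
Qed.

(** For k != 0 some [kap k i] is nonzero, and the translation by pi / kap k i along e_i adds pi to
    the phase: the integral equals its own opposite. *)
Lemma tintegral_tr k th : \int[mu]_x tr k th x = (k == 0)%:R * cos th.
Proof.
have [->|/kap_eq0[i ki]] := eqVneq k 0.
  under eq_Rintegral do rewrite /tr freq0 add0r.
  by rewrite tintegral_cst mul1r.
rewrite mul0r.
have [ct pt] := cper_tr k th.
have := Rintegral_torus_affine false ((pi / kap k i) *: basis i) (continuous_measurable_row ct) pt.
under eq_Rintegral do rewrite expr0 scale1r /tr freqDr freqZr freq_basis divfK// addrAC cosDpi.
have It : tintegrable (tr k th) by exact/mbounded_tintegrable/mbounded_tr.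
under eq_Rintegral do rewrite -mulN1r.
rewrite RintegralZl// mulN1r => /eqP.
rewrite -[X in - X](_ : \int[mu]_x tr k th x = _)//.
by rewrite eq_sym -addr_eq0 -mulr2n mulrn_eq0/= => /eqP.
Qed.

Lemma tintegral_tr_mul k l th et : \int[mu]_x (tr k th x * tr l et x) =
  ((k + l == 0)%:R * cos (th + et) + (k == l)%:R * cos (th - et)) / 2.
Proof.
under eq_Rintegral do rewrite tr_mul mulrC.
have It j ze : tintegrable (tr j ze) by exact/mbounded_tintegrable/mbounded_tr.
rewrite RintegralZl//; last exact: tintegrableD.
rewrite RintegralD; [|by []|exact: It|exact: It].
by rewrite !tintegral_tr subr_eq0 mulrC.
Qed.

Definition cosc f k := \int[mu]_x (f x * cos (freq k x)).
Definition sinc f k := \int[mu]_x (f x * sin (freq k x)).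

Lemma fourier_sqE f k : fourier_sq f k = cosc f k ^+ 2 + sinc f k ^+ 2.
Proof. by []. Qed.

Lemma coscE f k : cosc f k = fc f k 0.
Proof. by apply: eq_Rintegral => x _; rewrite /tr addr0. Qed.

Lemma sincE f k : sinc f k = fc f k (- (pi / 2)).
Proof. by apply: eq_Rintegral => x _; rewrite /tr cosBpihalf. Qed.

Lemma mbounded_cos k : mbounded (fun x : E => cos (freq k x)).
Proof. by have := mbounded_tr k 0; rewrite /tr; under eq_fun do rewrite addr0. Qed.

Lemma mbounded_sin k : mbounded (fun x : E => sin (freq k x)).
Proof. by have := mbounded_tr k (- (pi / 2)); rewrite /tr; under eq_fun do rewrite cosBpihalf. Qed.

Lemma fc_phase f k th : tintegrable f -> fc f k th = cos th * cosc f k - sin th * sinc f k.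
Proof.
move=> fi; rewrite /fc /tr.
have h x : f x * cos (freq k x + th) =
    cos th * (f x * cos (freq k x)) - sin th * (f x * sin (freq k x)).
  by rewrite cosD; ring.
under eq_Rintegral do rewrite h.
have ci := tintegrableM fi (mbounded_cos k).
have si := tintegrableM fi (mbounded_sin k).
by rewrite RintegralB ?RintegralZl//; apply: tintegrableMr => //; exact: mbounded_cst.
Qed.

Lemma fourier_sq_ge0 f k : 0 <= fourier_sq f k.
Proof. by rewrite addr_ge0 ?sqr_ge0. Qed.

Lemma fc_sq_le f k th : tintegrable f -> fc f k th ^+ 2 <= fourier_sq f k.
Proof.
move=> fi; rewrite fc_phase// fourier_sqE.
have := cos2Dsin2 th; set a := cos th; set b := sin th => ab.
rewrite -subr_ge0 -[X in X - _]mul1r -ab.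
(* The defect in Cauchy-Schwarz is a square, by the Lagrange identity in the plane. *)
rewrite (_ : _ - _ = (a * sinc f k + b * cosc f k) ^+ 2) ?sqr_ge0//; ring.
Qed.

(** The modulus |f^(k)|, which bounds the coefficient at every phase. *)
Definition famp f k : R := Num.sqrt (fourier_sq f k).

Lemma famp_ge0 f k : 0 <= famp f k. Proof. exact: sqrtr_ge0. Qed.

Lemma famp_sq f k : famp f k ^+ 2 = fourier_sq f k.
Proof. by rewrite sqr_sqrtr// fourier_sq_ge0. Qed.

Lemma fc_le f k th : tintegrable f -> `|fc f k th| <= famp f k.
Proof. by move=> fi; rewrite -sqrtr_sqr ler_wsqrtr// fc_sq_le. Qed.

Lemma fourier_sqN f k : tintegrable f -> fourier_sq f (- k) = fourier_sq f k.
Proof.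
move=> fi; rewrite /fourier_sq; congr (_ + _).
  by congr (_ ^+ 2); apply: eq_Rintegral => x _; rewrite freqN cosN.
rewrite -[RHS]sqrrN; congr (_ ^+ 2); rewrite -[RHS]mulN1r -RintegralZl//.
  by apply: eq_Rintegral => x _; rewrite freqN sinN; ring.
exact: tintegrableM fi (mbounded_sin k).
Qed.

Lemma fampN f k : tintegrable f -> famp f (- k) = famp f k.
Proof. by move=> fi; rewrite /famp fourier_sqN. Qed.

Lemma fcD f g k th : tintegrable f -> tintegrable g ->
  fc (fun x => f x + g x) k th = fc f k th + fc g k th.
Proof.
move=> fi gi; rewrite /fc -RintegralD//.
- by apply: eq_Rintegral => x _; rewrite mulrDl.
- exact: tintegrableM fi (mbounded_tr k th).
- exact: tintegrableM gi (mbounded_tr k th).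
Qed.

Lemma fcB f g k th : tintegrable f -> tintegrable g ->
  fc (fun x => f x - g x) k th = fc f k th - fc g k th.
Proof.
move=> fi gi; rewrite /fc -RintegralB//.
- by apply: eq_Rintegral => x _; rewrite mulrBl.
- exact: tintegrableM fi (mbounded_tr k th).
- exact: tintegrableM gi (mbounded_tr k th).
Qed.

Lemma fc_sum (I : Type) (r : seq I) (F : I -> E -> R) k th :
  (forall i, tintegrable (F i)) ->
  fc (fun x => \sum_(i <- r) F i x) k th = \sum_(i <- r) fc (F i) k th.
Proof.
move=> Fi; rewrite /fc -tintegral_sum.
  by apply: eq_Rintegral => x _; rewrite mulr_suml.
by move=> i; apply: tintegrableM (mbounded_tr k th).
Qed.

Lemma fc_partial i f k th : C1 i f ->
  fc (partial i f) k th = - (kap k i * fc f k (th + pi / 2)).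
Proof.
move=> Cf; rewrite /fc tintegral_ibp//; last exact: C1_tr.
rewrite partial_tr -RintegralZl//.
  by congr (- _); apply: eq_Rintegral => x _; ring.
have [cf _ _] := Cf.
exact: mbounded_tintegrable (mboundedM (cper_mbounded cf) (mbounded_tr _ _)).
Qed.

Lemma sum_sum_delta (s : seq Z) (F : Z -> Z -> R) : uniq s ->
  \sum_(k <- s) \sum_(l <- s) F k l * (k == l)%:R = \sum_(k <- s) F k k.
Proof.
move=> us; apply: eq_big_seq => k ks.
rewrite (bigD1_seq k)//= eqxx mulr1 big1 ?addr0// => l lk.
by rewrite eq_sym (negbTE lk) mulr0.
Qed.

Lemma bessel f (s : seq Z) : mbounded f -> uniq s ->
  \sum_(k <- s) fourier_sq f k <= \int[mu]_x f x ^+ 2.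
Proof.
move=> bf us.
have fi := mbounded_tintegrable bf.
pose c := cosc f; pose t := sinc f.
(* P + i Q is the sum of f^(k) e^(2 i pi k.x) over s. Since s need not be stable under k |-> - k, Q
   need not vanish, and the square to expand is |f - (P + i Q)|^2 = (f - P)^2 + Q^2. *)
pose P x := \sum_(k <- s) (c k * cos (freq k x) + t k * sin (freq k x)).
pose Q x := \sum_(k <- s) (c k * sin (freq k x) - t k * cos (freq k x)).
have bP : mbounded P.
  by apply: mbounded_sum => k _; apply: mboundedD; apply: mboundedZ;
    [exact: mbounded_cos|exact: mbounded_sin].
have bQ : mbounded Q.
  by apply: mbounded_sum => k _; apply: mboundedB; apply: mboundedZ;
    [exact: mbounded_sin|exact: mbounded_cos].
set S := \sum_(k <- s) _.
have IfP : \int[mu]_x (f x * P x) = S.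
  rewrite /P; under eq_Rintegral do rewrite mulr_sumr.
  rewrite tintegral_sum; last first.
    move=> k; apply: tintegrableM => //; apply: mboundedD; apply: mboundedZ;
    [exact: mbounded_cos|exact: mbounded_sin].
  apply: eq_bigr => k _; under eq_Rintegral do rewrite mulrDr 2!(mulrCA (f _)).
  have ci := tintegrableM fi (mbounded_cos k).
  have si := tintegrableM fi (mbounded_sin k).
  rewrite RintegralD//; [|exact: (tintegrableMr (mbounded_cst _))..].
  by rewrite !RintegralZl// fourier_sqE !expr2.
have IPQ : \int[mu]_x (P x ^+ 2 + Q x ^+ 2) = S.
  have PQE x : P x ^+ 2 + Q x ^+ 2 = \sum_(k <- s) \sum_(l <- s)
     ((c k * c l + t k * t l) * tr (k - l) 0 x + (c k * t l - t k * c l) * tr (l - k) (- (pi / 2)) x).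
    rewrite !expr2 {1}/P mulr_suml {1}/Q mulr_suml -big_split/=.
    apply: eq_bigr => k _; rewrite /P /Q !mulr_sumr -big_split/=.
    apply: eq_bigr => l _.
    by rewrite /tr addr0 cosBpihalf !freqB cosB sinB; ring.
  under eq_Rintegral do rewrite PQE.
  have Ti k l : tintegrable (fun x => (c k * c l + t k * t l) * tr (k - l) 0 x +
      (c k * t l - t k * c l) * tr (l - k) (- (pi / 2)) x).
    by apply/mbounded_tintegrable; apply: mboundedD; apply: mboundedZ; exact: mbounded_tr.
  rewrite tintegral_sum; last by move=> k; apply: tintegrable_sum.
  transitivity (\sum_(k <- s) \sum_(l <- s) (c k * c l + t k * t l) * (k == l)%:R).
    apply: eq_bigr => k _; rewrite tintegral_sum//; apply: eq_bigr => l _.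
    rewrite RintegralD//; [|by apply/mbounded_tintegrable; apply: mboundedZ; exact: mbounded_tr..].
    rewrite !RintegralZl//; [|by apply/mbounded_tintegrable; exact: mbounded_tr..].
    by rewrite !tintegral_tr cosN cos_pihalf !mulr0 addr0 cos0 mulr1 subr_eq0.
  by rewrite sum_sum_delta//; apply: eq_bigr => k _; rewrite fourier_sqE !expr2.
have : 0 <= \int[mu]_x ((f x - P x) ^+ 2 + Q x ^+ 2).
  by apply: Rintegral_ge0 => x _; rewrite addr_ge0 ?sqr_ge0.
have -> : \int[mu]_x ((f x - P x) ^+ 2 + Q x ^+ 2) =
    \int[mu]_x (f x ^+ 2 - 2 * (f x * P x) + (P x ^+ 2 + Q x ^+ 2)).
  by apply: eq_Rintegral => x _; ring.
have bfP := mboundedM bf bP.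
rewrite RintegralD//; last 2 first.
- apply/mbounded_tintegrable/mboundedB; [exact: mboundedX|exact: mboundedZ].
- by apply/mbounded_tintegrable/mboundedD; exact: mboundedX.
rewrite RintegralB//; last 2 first.
- by apply/mbounded_tintegrable; exact: mboundedX.
- by apply/mbounded_tintegrable; exact: mboundedZ.
rewrite RintegralZl//; last exact/mbounded_tintegrable.
by rewrite IfP IPQ; lra.
Qed.

End fourier.

(** * Fejer kernels *)

Section fejer.
Context {R : realType} {d : nat}.
Local Notation E := 'rV[R]_d.
Local Notation Z := 'rV[int]_d.
Local Notation mu := (@torus R d).

(** The indicator of j i = 0 is a product over the coordinates, so its sum factors; the resulting
    proportion 1 / (N + 1) is the one in [tintegral_fejer_moment]. *)
Lemma card_ffun_slice (N : nat) (i : 'I_d) :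
  (N.+1 * \sum_(j : {ffun 'I_d -> 'I_N.+1}) (j i == ord0) = N.+1 ^ d)%N.
Proof.
have -> : (\sum_(j : {ffun 'I_d -> 'I_N.+1}) (j i == ord0) =
    \sum_(j : {ffun 'I_d -> 'I_N.+1}) \prod_(l < d) (if l == i then (j l == ord0 : nat) else 1))%N.
  apply: eq_bigr => j _; rewrite (bigD1 i)//= eqxx big1 ?muln1// => l li.
  by rewrite (negbTE li).
rewrite -(bigA_distr_bigA (fun l a => if l == i then (a == ord0 : nat) else 1)).
rewrite (bigD1 i)//= mulnA.
have -> : (\sum_(j < N.+1) (if i == i then (j == ord0 : nat) else 1) = 1)%N.
  by rewrite eqxx (bigD1 ord0)//= big1 // => a /negbTE ->.
rewrite muln1.
rewrite (eq_bigr (fun=> N.+1)) => [|l li]; last first.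
  by rewrite (negbTE li) sum1_card card_ord.
rewrite prod_nat_const cardC1 card_ord.
by case: (d) i => [[]//|n] i; rewrite -expnS.
Qed.

Definition box_idx (N : nat) (j : {ffun 'I_d -> 'I_N.+1}) : Z := \row_i (j i : nat)%:Z.

Lemma box_idx_inj N : injective (@box_idx N).
Proof.
move=> j l /rowP h; apply/ffunP => i; apply/val_inj.
by have := h i; rewrite !mxE => -[].
Qed.

Local Notation J N := {ffun 'I_d -> 'I_N.+1}.

(** The kernel (N + 1)^(- d) |sum_j e^(2 i pi j.x)|^2, j in {0, ..., N}^d, expanded as a double
    sum. *)
Definition fejer N (x : E) : R :=
  #|J N|%:R^-1 * \sum_(j : J N) \sum_(l : J N) tr (box_idx j - box_idx l) 0 x.

Lemma card_box_gt0 N : 0 < #|J N|%:R :> R.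
Proof. by rewrite ltr0n card_ffun !card_ord expn_gt0. Qed.

Lemma fejer_ge0 N x : 0 <= fejer N x.
Proof.
rewrite mulr_ge0 ?invr_ge0 ?ler0n//.
rewrite (_ : \sum_(j : J N) _ = (\sum_(j : J N) cos (freq (box_idx j) x)) ^+ 2 +
   (\sum_(j : J N) sin (freq (box_idx j) x)) ^+ 2) ?addr_ge0 ?sqr_ge0//.
rewrite !expr2 !mulr_suml -big_split/=; apply: eq_bigr => j _.
rewrite !mulr_sumr -big_split/=; apply: eq_bigr => l _.
by rewrite /tr addr0 freqB cosB.
Qed.

Lemma mbounded_fejer N : mbounded (fejer N).
Proof.
by apply: mboundedZ; apply: mbounded_sum => j _; apply: mbounded_sum => l _;
  exact: mbounded_tr.
Qed.

Lemma tintegral_fejer_mul N (h : E -> R) : mbounded h ->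
  \int[mu]_x (fejer N x * h x) =
  #|J N|%:R^-1 * \sum_(j : J N) \sum_(l : J N) fc h (box_idx j - box_idx l) 0.
Proof.
move=> bh.
have Ti (k : Z) : tintegrable (fun x => tr k 0 x * h x).
  by apply/mbounded_tintegrable/mboundedM => //; exact: mbounded_tr.
have TT (j : J N) : tintegrable (fun x => \sum_(l : J N) tr (box_idx j - box_idx l) 0 x * h x).
  by apply: tintegrable_sum.
transitivity (\int[mu]_x (#|J N|%:R^-1 *
    \sum_(j : J N) \sum_(l : J N) (tr (box_idx j - box_idx l) 0 x * h x))).
  apply: eq_Rintegral => x _; rewrite /fejer -mulrA mulr_suml; congr (_ * _).
  by apply: eq_bigr => j _; rewrite mulr_suml.
rewrite RintegralZl//; last exact: tintegrable_sum.
congr (_ * _); rewrite tintegral_sum//; apply: eq_bigr => j _.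
rewrite tintegral_sum//; apply: eq_bigr => l _.
by apply: eq_Rintegral => x _; rewrite mulrC.
Qed.

Lemma tintegral_fejer N : \int[mu]_x fejer N x = 1.
Proof.
under eq_Rintegral do rewrite -[fejer _ _]mulr1.
rewrite (tintegral_fejer_mul N (mbounded_cst 1)).
rewrite (_ : \sum_(j : J N) _ = #|J N|%:R) ?mulVf ?gt_eqF ?card_box_gt0//.
rewrite -sum1_card natr_sum; apply: eq_bigr => j _.
rewrite (bigD1 j)//= big1 ?addr0 => [|l lj]; rewrite /fc.
  under eq_Rintegral do rewrite mul1r.
  by rewrite tintegral_tr subrr eqxx cos0 mulr1.
under eq_Rintegral do rewrite mul1r.
rewrite tintegral_tr subr_eq0 (_ : (_ == _) = false) ?mul0r//.
by apply: contra_neqF lj => /eqP/box_idx_inj ->.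
Qed.

(** For fixed j the map l |-> j - l is injective, so each inner sum is at most S, and so is the mean
    over j. *)
Lemma tintegral_fejer_sup N (h : E -> R) (m : Z -> R) (S : R) : mbounded h ->
  (forall k, `|fc h k 0| <= m k) ->
  (forall s : seq Z, uniq s -> \sum_(k <- s) m k <= S) ->
  `|\int[mu]_x (fejer N x * h x)| <= S.
Proof.
move=> bh hm mS; rewrite tintegral_fejer_mul// normrM gtr0_norm ?invr_gt0 ?card_box_gt0//.
rewrite mulrC ler_pdivrMr ?card_box_gt0//.
apply: le_trans (ler_norm_sum _ _ _) _.
rewrite -sum1_card natr_sum mulr_sumr; apply: ler_sum => j _; rewrite mulr1.
apply: le_trans (ler_norm_sum _ _ _) _.
apply: (@le_trans _ _ (\sum_(l : J N) m (box_idx j - box_idx l))).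
  by apply: ler_sum => l _; exact: hm.
have := mS [seq box_idx j - box_idx l | l <- index_enum (J N)].
rewrite big_map; apply; rewrite map_inj_uniq; first exact: index_enum_uniq.
by move=> l l' /addrI/oppr_inj/box_idx_inj.
Qed.

(** The kernel has mass 1, and its pairing with cos(2 pi x_i) is at least the proportion of j with j
    i != 0, that is 1 - 1 / (N + 1): for those j some l satisfies j - l = e_i. *)
Lemma tintegral_fejer_moment N (i : 'I_d) :
  \int[mu]_x (fejer N x * (1 - cos (2 * pi * x ord0 i))) <= N.+1%:R^-1.
Proof.
pose e : Z := delta_mx ord0 i.
have eE (x : E) : cos (2 * pi * x ord0 i) = tr e 0 x.
  rewrite /tr addr0 /freq (bigD1 i)//= big1 ?addr0 => [|j ji]; rewrite mxE eqxx/=.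
    by rewrite eqxx mul1r.
  by rewrite (negbTE ji) mul0r.
under eq_Rintegral do rewrite eE mulrBr mulr1.
have bf := mbounded_fejer N.
rewrite RintegralB//; last 2 first.
- exact: mbounded_tintegrable.
- by apply/mbounded_tintegrable/mboundedM => //; exact: mbounded_tr.
rewrite tintegral_fejer (tintegral_fejer_mul N (mbounded_tr e 0)).
rewrite lerBlDl -lerBlDr ler_pdivlMl ?card_box_gt0//.
have fcE k : fc (tr e 0) k 0 = ((k == e)%:R + (k == - e)%:R) / 2 :> R.
  rewrite /fc tintegral_tr_mul addr0 subrr cos0 !mulr1 addrC eq_sym.
  by rewrite addrC [e + k]addrC addr_eq0 [in LHS]addrC addrC.
have cnt : (#|J N|%:R : R) * (1 - N.+1%:R^-1) <=
    \sum_(j : J N) \sum_(l : J N) (box_idx j - box_idx l == e)%:R.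
  have -> : (#|J N|%:R : R) * (1 - N.+1%:R^-1) = \sum_(j : J N) (j i != ord0)%:R.
    have -> : \sum_(j : J N) ((j i != ord0)%:R : R) = \sum_(j : J N) (1 - (j i == ord0)%:R).
      by apply: eq_bigr => j _; case: eqP; rewrite ?subrr ?subr0.
    rewrite sumrB sumr_const -natr_sum mulrBr mulr1; congr (_ - _).
    have N0 : (N.+1%:R : R) != 0 by rewrite pnatr_eq0.
    apply: (mulIf N0); rewrite divfK// -natrM mulnC card_ffun_slice.
    by rewrite card_ffun !card_ord.
  apply: ler_sum => j _; case: (boolP (j i == ord0)) => [_|ji]; first by apply: sumr_ge0.
  (* j with its coordinate i lowered by one, which is possible because j i != 0. *)
  pose l : J N := [ffun a => if a == i then inord (j i).-1 else j a].
  rewrite (bigD1 l)//= (_ : _ == _ = true) ?lerDl ?sumr_ge0//.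
  apply/eqP/rowP => a; rewrite !mxE ffunE eqxx/=; case: eqP => [->|_]; last by rewrite subrr.
  have j0 : (0 < j i)%N by rewrite lt0n; apply: contra ji => /eqP h; apply/eqP/val_inj.
  rewrite inordK; last by rewrite (leq_ltn_trans (leq_pred _))// ltn_ord.
  move: j0; case: (nat_of_ord (j i)) => // n _ /=.
  by rewrite -addn1 PoszD addrAC subrr add0r.
have cntN : (#|J N|%:R : R) * (1 - N.+1%:R^-1) <=
    \sum_(j : J N) \sum_(l : J N) (box_idx j - box_idx l == - e)%:R.
  rewrite exchange_big/=; apply: (le_trans cnt); apply: ler_sum => j _; apply: ler_sum => l _.
  by rewrite -[_ == - e]eqr_opp opprB opprK.
under eq_bigr do under eq_bigr do rewrite fcE mulrDl.
under eq_bigr do rewrite big_split/= -!mulr_suml.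
rewrite big_split/= -!mulr_suml.
by rewrite [leLHS]splitr lerD// ler_pM2r.
Qed.

Lemma one_sub_cos_ge (dl : R) : 0 < dl -> dl < 1 / 2 ->
  exists2 et : R, 0 < et & forall t : R, dl <= `|t| -> `|t| <= 1 / 2 -> et <= 1 - cos (2 * pi * t).
Proof.
move=> d0 d1; have pi0 := pi_gt0 R.
have dI : 2 * pi * dl \in `[0, pi].
  by rewrite in_itv/= !mulr_ge0 ?(ltW d0) ?(ltW pi0)//= mulrAC ler_piMl ?(ltW pi0)//; lra.
exists (1 - cos (2 * pi * dl)).
  rewrite subr_gt0 -[ltRHS]cos0 ltr_cos//; last by rewrite in_itv/= lexx ltW.
  by rewrite !mulr_gt0.
move=> t t1 t2; rewrite lerD2l lerN2.
have -> : cos (2 * pi * t) = cos (2 * pi * `|t|).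
  by case: (ger0P t) => // _; rewrite mulrN cosN.
have tI : 2 * pi * `|t| \in `[0, pi].
  by rewrite in_itv/= !mulr_ge0 ?(ltW pi0)//= mulrAC ler_piMl ?(ltW pi0)//; lra.
rewrite leNgt ltr_cos// -leNgt ler_pM2l// mulr_gt0//.
Qed.

(* Korovkin: with [tintegral_fejer_moment], this makes the Fejer means of h converge to h at 0. *)
Lemma cper_korovkin (h : E -> R) (ep : R) : cper h -> 0 < ep ->
  exists2 A : R, 0 <= A & forall x, `|h x - h 0| <= ep + A * \sum_(i < d) (1 - cos (2 * pi * x ord0 i)).
Proof.
move=> ch ep0; have [cf pf] := ch.
have [_ [C hC]] := cper_mbounded ch.
have /cvgrPdist_lt/(_ _ ep0) := cf 0.
move=> /nbhs_ballP[r /= r0 hr].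
(* r / 2 keeps the box inside the ball of continuity; 1 / 4 keeps dl below the 1 / 2 that
   [one_sub_cos_ge] asks for. *)
pose dl := Num.min (r / 2) (1 / 4).
have dl0 : 0 < dl by rewrite lt_min divr_gt0//=.
have dl2 : dl < 1 / 2 by rewrite gt_min; apply/orP; right; lra.
have [et et0 H] := one_sub_cos_ge dl0 dl2.
have C0 : 0 <= C := le_trans (normr_ge0 _) (hC 0).
(* Away from 0 one coordinate contributes at least et to the sum, which pays for the trivial bound 2
   C on |h x - h 0|. *)
exists (2 * C / et); first by rewrite divr_ge0 ?(ltW et0)// mulr_ge0.
have main (x : E) : (forall i, `|x ord0 i| <= 1 / 2) ->
    `|h x - h 0| <= ep + 2 * C / et * \sum_(i < d) (1 - cos (2 * pi * x ord0 i)).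
  move=> x12.
  have S0 : 0 <= \sum_(i < d) (1 - cos (2 * pi * x ord0 i)).
    by apply: sumr_ge0 => i _; rewrite subr_ge0 cos_le1.
  have [/existsP[i hi]|/negP hn] := boolP [exists i, dl <= `|x ord0 i|].
    apply: (@le_trans _ _ (2 * C)).
      by rewrite (le_trans (ler_normB _ _))// mulr_natl mulr2n lerD.
    rewrite -[leLHS]add0r lerD ?(ltW ep0)//.
    rewrite mulrAC ler_pdivlMr// ler_wpM2l ?mulr_ge0//.
    rewrite (bigD1 i)//= -[leLHS]addr0 lerD//; first exact: H.
    by apply: sumr_ge0 => j _; rewrite subr_ge0 cos_le1.
  rewrite -[leLHS]addr0 lerD//; last by rewrite mulr_ge0// divr_ge0 ?(ltW et0)// mulr_ge0.
  rewrite distrC ltW//; apply: hr; split=> // a b.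
  rewrite (ord1 a) mxE /ball/= sub0r normrN.
  have : `|x ord0 b| < dl by rewrite ltNge; apply/negP => hb; apply: hn; apply/existsP; exists b.
  rewrite lt_min => /andP[h1 _]; lra.
(* Subtracting nearest integers moves x into [- 1 / 2, 1 / 2]^d, where [main] applies, and changes
   neither side. *)
move=> x; pose k : Z := \row_i - Num.floor (x ord0 i + 1 / 2).
have := main (x + map_mx intr k); rewrite pf => H2; apply: le_trans (H2 _) _; last first.
  rewrite lerD2l ler_wpM2l ?divr_ge0 ?mulr_ge0 ?(ltW et0)//.
  by apply: ler_sum => i _; rewrite !mxE mulrDr cosD2piz.
move=> i; rewrite !mxE mulrNz.
have := floor_le (x ord0 i + 1 / 2); have := floorD1_gt (x ord0 i + 1 / 2).
rewrite intrD1 ler_norml => h1 h2; apply/andP; split; lra.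
Qed.

(** Evaluation at 0 sees the cosine coefficients only, hence the phase 0 in the hypothesis. The
    Fejer means of h at 0 are at most S in modulus for every N, and they approach h 0. *)
Lemma fourier_sup0 (h : E -> R) (m : Z -> R) (S : R) : cper h ->
  (forall k, `|fc h k 0| <= m k) ->
  (forall s : seq Z, uniq s -> \sum_(k <- s) m k <= S) ->
  `|h 0| <= S.
Proof.
move=> ch hm mS; have bh := cper_mbounded ch.
apply/ler_addgt0Pl => ep ep0.
have ep2 : 0 < ep / 2 by rewrite divr_gt0.
have [A A0 HA] := cper_korovkin ch ep2.
(* With N + 1 > A d / (ep / 2), the d moments weighted by A add up to at most ep / 2. *)
pose N := Num.trunc (A * d%:R / (ep / 2)).
have bf := mbounded_fejer N.
have bM (i : 'I_d) : mbounded (fun x : E => fejer N x * (1 - cos (2 * pi * x ord0 i))).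
  apply: mboundedM => //; apply: mboundedB; first exact: mbounded_cst.
  have := mbounded_cos (delta_mx ord0 i : Z) (R := R).
  congr mbounded; apply/funext => x; congr cos; rewrite /freq; congr (_ * _).
  rewrite (bigD1 i)//= big1 ?addr0 => [|j ji]; rewrite mxE eqxx/=.
    by rewrite eqxx mul1r.
  by rewrite (negbTE ji) mul0r.
have -> : h 0 = \int[mu]_x (fejer N x * h x) - \int[mu]_x (fejer N x * (h x - h 0)).
  rewrite -RintegralB//; last 2 first.
  - exact/mbounded_tintegrable/mboundedM.
  - by apply/mbounded_tintegrable/mboundedM => //; apply: mboundedB => //; exact: mbounded_cst.
  under eq_Rintegral do rewrite -mulrBr opprB addrCA subrr addr0 mulrC.
  rewrite RintegralZl//; last exact: mbounded_tintegrable.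
  by rewrite tintegral_fejer mulr1.
apply: le_trans (ler_normB _ _) _; rewrite addrC; apply: lerD; last exact: tintegral_fejer_sup hm mS.
have bd : mbounded (fun x => fejer N x * (h x - h 0)).
  by apply: mboundedM => //; apply: mboundedB => //; exact: mbounded_cst.
apply: le_trans (le_normr_Rintegral _ _) _ => //; first exact: mbounded_tintegrable.
apply: (@le_trans _ _ (\int[mu]_x (ep / 2 * fejer N x + A * \sum_(i < d) (fejer N x * (1 - cos (2 * pi * x ord0 i)))))).
  apply: le_Rintegral => //.
  - exact/mbounded_tintegrable/mbounded_norm.
  - apply/mbounded_tintegrable/mboundedD; first exact: mboundedZ.
    by apply: mboundedZ; exact: mbounded_sum.
  - move=> x _; rewrite normrM (ger0_norm (fejer_ge0 N x)).
    apply: le_trans (ler_wpM2l (fejer_ge0 N x) (HA x)) _.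
    by rewrite mulrDr mulrC -mulr_sumr (mulrCA A).
rewrite RintegralD//; last 2 first.
- exact/mbounded_tintegrable/mboundedZ.
- by apply/mbounded_tintegrable/mboundedZ; exact: mbounded_sum.
rewrite (@RintegralZl _ _ _ mu setT (fejer N))//; last exact: mbounded_tintegrable.
rewrite (@RintegralZl _ _ _ mu setT (fun x => \sum_(i < d) (fejer N x * (1 - cos (2 * pi * x ord0 i)))))//;
  last by apply/mbounded_tintegrable; exact: mbounded_sum.
rewrite tintegral_fejer mulr1 tintegral_sum; last by move=> i; exact: mbounded_tintegrable.
rewrite [leRHS](splitr ep) lerD2l.
apply: (@le_trans _ _ (A * (d%:R * N.+1%:R^-1))).
  rewrite ler_wpM2l// [leRHS](_ : _ = \sum_(i < d) N.+1%:R^-1); last first.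
    by rewrite sumr_const card_ord mulr_natl.
  by apply: ler_sum => i _; exact: tintegral_fejer_moment.
rewrite mulrA ler_pdivrMr// -ler_pdivrMl// mulrC.
exact/ltW/truncnS_gt.
Qed.

End fejer.

(** * Inversion, Parseval and convolution *)

Section fourier_consequences.
Context {R : realType} {d : nat}.
Local Notation E := 'rV[R]_d.
Local Notation Z := 'rV[int]_d.
Local Notation mu := (@torus R d).
Implicit Types (f g b : E -> R) (k l : Z) (th : R).

Lemma cperM f g : cper f -> cper g -> cper (fun x => f x * g x).
Proof. by move=> [cf pf] [cg pg]; split; [exact: gcontM|move=> x k; rewrite pf pg]. Qed.

Lemma cperB f g : cper f -> cper g -> cper (fun x => f x - g x).
Proof. by move=> [cf pf] [cg pg]; split; [exact: gcontB|move=> x k; rewrite pf pg]. Qed.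

Lemma cper_tintegrable f : cper f -> tintegrable f.
Proof. by move/cper_mbounded/mbounded_tintegrable. Qed.

Lemma cper_measurable f : cper f -> measurable_fun setT f.
Proof. by case/cper_mbounded. Qed.

Lemma tintegral_shift f (x : E) : measurable_fun setT f -> Zperiodic f ->
  \int[mu]_y f (y + x) = \int[mu]_y f y.
Proof.
move=> mf pf; rewrite -[RHS](Rintegral_torus_affine false x mf pf).
by apply: eq_Rintegral => y _; rewrite expr0 scale1r.
Qed.

(** The product is integrable on the square because C |g| dominates its inner integrals. *)
Lemma tfubini (g : E -> R) (G : E -> E -> R) (C : R) : tintegrable g ->
  measurable_fun setT (fun z : E * E => G z.1 z.2) ->
  (forall x y, `|G x y| <= C) ->
  \int[mu]_x (g x * \int[mu]_y G x y) = \int[mu]_y \int[mu]_x (g x * G x y).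
Proof.
move=> ig mG GC.
have mg : measurable_fun setT g by have /integrableP[/measurable_EFinP] := ig.
have bG1 x : mbounded (G x).
  by split; [exact: (measurableT_comp mG (measurable_pair1 x))|exists C].
have bG2 y : mbounded (G ^~ y).
  by split; [exact: (measurableT_comp mG (measurable_pair2 y))|exists C].
have mgG : measurable_fun setT (fun z : E * E => (g z.1 * G z.1 z.2)%:E).
  apply/measurable_EFinP; apply: measurable_funM => //.
  exact: measurableT_comp mg measurable_fst.
have I1 x : (\int[mu]_y (g x * G x y)%:E = (g x * \int[mu]_y G x y)%:E)%E.
  rewrite -RintegralZl//; last exact: mbounded_tintegrable.
  rewrite /Rintegral fineK//; apply: integrable_fin_num => //.
  by apply: mbounded_tintegrable; exact: mboundedZ.
have I2 y : (\int[mu]_x (g x * G x y)%:E = (\int[mu]_x (g x * G x y))%:E)%E.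
  rewrite /Rintegral fineK//; apply: integrable_fin_num => //.
  exact: tintegrableM.
have ifin : (mu \x mu)%E.-integrable setT (fun z : E * E => (g z.1 * G z.1 z.2)%:E).
  apply/integrable12ltyP => //.
  apply: (@le_lt_trans _ _ (\int[mu]_x (C * `|g x|)%:E)%E).
    apply: ge0_le_integral => //.
    - by move=> x _; apply: integral_ge0.
    - apply: (@measurable_fun_fubini_tonelli_F _ _ _ _ _ mu (fun z => `|(g z.1 * G z.1 z.2)%:E|%E)) => //.
      exact: measurableT_comp.
    - by apply/measurable_EFinP; apply: measurable_funM => //; exact: measurableT_comp.
    - move=> x _; apply: (@le_trans _ _ (\int[mu]_y (C * `|g x|)%:E)%E).
        apply: ge0_le_integral => //.
        + apply: measurableT_comp => //; apply/measurable_EFinP.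
          by case: (mboundedZ (g x) (bG1 x)).
        + by move=> y _; rewrite lee_fin normrM mulrC ler_wpM2r.
      by rewrite integral_cst// [X in (_ * X)%E](_ : _ = 1%E) ?mule1//; exact: (@probability_setT _ _ _ mu).
  have := tintegrableMr (mbounded_cst C) (integrable_norm ig : tintegrable (fun x => `|g x|)).
  move=> /integrableP[_]; apply: le_lt_trans; apply: ge0_le_integral => //.
  - by move=> x _; rewrite lee_fin mulr_ge0// (le_trans _ (GC 0 0)).
  - by apply/measurable_EFinP; apply: measurable_funM => //; exact: measurableT_comp.
  - apply: measurableT_comp => //; apply/measurable_EFinP.
    by apply: measurable_funM => //; exact: measurableT_comp.
  - by move=> x _; rewrite lee_fin ler_norm.
have := Fubini ifin; rewrite /=.
under eq_integral do rewrite I1.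
under [X in _ = X]eq_integral do rewrite I2.
by rewrite /Rintegral => ->.
Qed.

Lemma tr_shift k th (x y : E) : tr k th (x + y) = tr k (th + freq k y) x.
Proof. by rewrite /tr freqDr; congr cos; ring. Qed.

Lemma fc_shift f k th (y : E) : cper f ->
  fc (fun x => f (x + y)) k th = fc f k (th - freq k y).
Proof.
move=> cf; have [? pf] := cf; have [? pt] := cper_tr k (th - freq k y) (R := R).
have cft := cperM cf (cper_tr k (th - freq k y)).
rewrite /fc -(tintegral_shift y (cper_measurable cft) (proj2 cft)).
by apply: eq_Rintegral => x _; rewrite tr_shift subrK.
Qed.

(** A translation moves x to 0 and changes only the phases, all of which [famp] bounds. *)
Lemma fourier_sup f (S : R) (x : E) : cper f ->
  (forall s : seq Z, uniq s -> \sum_(k <- s) famp f k <= S) -> `|f x| <= S.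
Proof.
move=> cf fS; have [ctf pf] := cf.
rewrite -[x in f x]add0r.
apply: (@fourier_sup0 _ _ (fun y => f (y + x)) (famp f)) => //.
  split; last by move=> y k; rewrite addrAC pf.
  by apply: gcont_comp => //; apply: gcontD; [exact: gcont_id|exact: gcont_cst].
by move=> k; rewrite fc_shift//; apply: fc_le; exact: cper_tintegrable.
Qed.

(** This is [fourier_sup] with S = 0 for the difference f - g. *)
Lemma fourier_inj f g : cper f -> cper g ->
  (forall k th, fc f k th = fc g k th) -> f = g.
Proof.
move=> cf cg fgE; apply/funext => x; apply/eqP; rewrite -subr_eq0 -normr_le0.
apply: (@fourier_sup (fun x => f x - g x)); first exact: cperB.
move=> s _; rewrite big1// => k _; rewrite /famp fourier_sqE !coscE !sincE.
rewrite !fcB; [|exact: cper_tintegrable..].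
by rewrite !fgE !subrr expr0n addr0 sqrtr0.
Qed.

(** The cross-correlation takes the value \int f g at y = 0, so that [fourier_sup0] becomes a bound
    on an L^2 pairing. *)
Lemma cross_corr_cper f g : tintegrable f -> cper g ->
  cper (fun y => \int[mu]_z (f z * g (z + y))).
Proof.
move=> fi [cg pg]; split.
  refine (@gcont_tintegral _ _ E (fun y z => g (z + y)) f _ _ fi).
    by apply: gcont_comp => //; apply: gcontD; [exact: gcont_snd|exact: gcont_fst].
  by move=> y z k; rewrite addrAC pg.
by move=> y k; apply: eq_Rintegral => z _; rewrite addrA pg.
Qed.

(** Fubini moves the test function onto g, where [fc_shift] turns the translation by z into a phase;
    the result is the real part of f^(k) times the conjugate of g^(k). *)
Lemma cross_corr_fc f g k : tintegrable f -> cper g ->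
  fc (fun y => \int[mu]_z (f z * g (z + y))) k 0 =
  cosc f k * cosc g k + sinc f k * sinc g k.
Proof.
move=> fi cg; have [ctg pg] := cg.
have [mg [C gC]] := cper_mbounded cg.
transitivity (\int[mu]_z (f z * fc g k (- freq k z))).
  rewrite /fc; under eq_Rintegral do rewrite mulrC.
  under [RHS]eq_Rintegral => z _.
    rewrite (_ : \int[mu]_x _ = \int[mu]_y (g (z + y) * tr k 0 y)); first over.
    have := fc_shift k 0 z cg; rewrite sub0r /fc => <-.
    by apply: eq_Rintegral => y _; rewrite addrC.
  rewrite (tfubini (C := C) fi)//; last 2 first.
  - apply: (@continuous_measurable_prod_row R d d); apply: gcontM.
      by apply: gcont_comp => //; apply: gcontD; [exact: gcont_fst|exact: gcont_snd].
    by apply: (gcont_comp (g := tr k 0)); [have [] := cper_tr k 0 (R := R)|exact: gcont_snd].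
  - by move=> x y; rewrite normrM -[leRHS]mulr1 ler_pM// tr_norm_le1.
  apply: eq_Rintegral => y _; rewrite -RintegralZl//.
    by apply: eq_Rintegral => z _; ring.
  apply: tintegrableM => //; apply: cper_mbounded; split.
    by apply: gcont_comp => //; apply: gcontD; [exact: gcont_id|exact: gcont_cst].
  by move=> z j; rewrite addrAC pg.
have gi := cper_tintegrable cg.
under eq_Rintegral do rewrite (fc_phase _ _ gi) cosN sinN.
have ci := tintegrableM fi (mbounded_cos k).
have si := tintegrableM fi (mbounded_sin k).
have h z : f z * (cos (freq k z) * cosc g k - - sin (freq k z) * sinc g k) =
  cosc g k * (f z * cos (freq k z)) + sinc g k * (f z * sin (freq k z)) by ring.
under eq_Rintegral do rewrite h.
rewrite RintegralD//; [|exact: (tintegrableMr (mbounded_cst _))..].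
by rewrite !RintegralZl// mulrC [X in _ + X]mulrC.
Qed.

(** The autocorrelation of f has the value \int f^2 at 0 and the cosine coefficients |f^(k)|^2. *)
Lemma parseval_le f (S : R) : cper f ->
  (forall s : seq Z, uniq s -> \sum_(k <- s) fourier_sq f k <= S) ->
  \int[mu]_x f x ^+ 2 <= S.
Proof.
move=> cf fS; apply: le_trans (ler_norm _) _.
have := @fourier_sup0 _ _ _ (fourier_sq f) S (cross_corr_cper (cper_tintegrable cf) cf).
under eq_Rintegral do rewrite addr0 -expr2.
apply => // k; rewrite cross_corr_fc//; last exact: cper_tintegrable.
by rewrite -!expr2 ger0_norm// fourier_sq_ge0.
Qed.

(** The coefficient of f b is the value at 0 of the cross-correlation of f [tr k th] with b, and the
    coefficients of f [tr k th] at l are half-sums over k + l and k - l. Each phase is thus at most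
    2 S, and two squared phases give 8 S^2. *)
Lemma fourier_sqM_le f b k (S : R) : cper f -> cper b ->
  (forall s : seq Z, uniq s -> \sum_(l <- s) famp b l * famp f (k - l) <= S) ->
  fourier_sq (fun x => f x * b x) k <= 8 * S ^+ 2.
Proof.
move=> cf cb fS.
have S0 : 0 <= S by have := fS [::] isT; rewrite big_nil.
have fi := cper_tintegrable cf; have bi := cper_tintegrable cb.
have H th : `|fc (fun x => f x * b x) k th| <= 2 * S.
  have cft := cperM cf (cper_tr k th).
  have fti := cper_tintegrable cft.
  have := @fourier_sup0 _ _ _ (fun l => famp b l * (famp f (k + l) + famp f (k - l))) (2 * S)
    (cross_corr_cper fti cb).
  under eq_Rintegral do rewrite addr0 mulrAC.
  apply.
    move=> l; rewrite cross_corr_fc//.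
    have E1 : cosc (fun x => f x * tr k th x) l = (fc f (k + l) th + fc f (k - l) th) / 2.
      rewrite coscE /fc -RintegralD//; last 2 first.
      - exact: tintegrableM fi (mbounded_tr _ _).
      - exact: tintegrableM fi (mbounded_tr _ _).
      rewrite [RHS]mulrC -RintegralZl//; last by apply: tintegrableD; apply: tintegrableM fi (mbounded_tr _ _).
      by apply: eq_Rintegral => x _; rewrite -mulrA tr_mul addr0 subr0; ring.
    have E2 : sinc (fun x => f x * tr k th x) l =
        (fc f (k + l) (th - pi / 2) + fc f (k - l) (th + pi / 2)) / 2.
      rewrite sincE /fc -RintegralD//; last 2 first.
      - exact: tintegrableM fi (mbounded_tr _ _).
      - exact: tintegrableM fi (mbounded_tr _ _).
      rewrite [RHS]mulrC -RintegralZl//; last by apply: tintegrableD; apply: tintegrableM fi (mbounded_tr _ _).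
      by apply: eq_Rintegral => x _; rewrite -mulrA tr_mul opprK; ring.
    rewrite E1 E2.
    have a1 := fc_le (k + l) th fi; have a2 := fc_le (k - l) th fi.
    have a3 := fc_le (k + l) (th - pi / 2) fi; have a4 := fc_le (k - l) (th + pi / 2) fi.
    have b1 : `|cosc b l| <= famp b l by rewrite coscE; exact: fc_le.
    have b2 : `|sinc b l| <= famp b l by rewrite sincE; exact: fc_le.
    have half (u v p q : R) : `|u| <= p -> `|v| <= q -> `|(u + v) / 2| <= (p + q) / 2.
      move=> up vq; rewrite normrM [X in _ * X]ger0_norm// ler_pM2r//.
      by rewrite (le_trans (ler_normD _ _))// lerD.
    apply: le_trans (ler_normD _ _) _; rewrite !normrM -/(_ / _).
    rewrite -[X in X * `|cosc b l|]normrM -[X in X * `|sinc b l|]normrM.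
    rewrite (_ : famp b l * _ = (famp f (k + l) + famp f (k - l)) / 2 * famp b l +
       (famp f (k + l) + famp f (k - l)) / 2 * famp b l); last by field.
    by apply: lerD; apply: ler_pM => //; exact: half.
  move=> s us; under eq_bigr do rewrite mulrDr.
  rewrite big_split/= mulr_natl mulr2n; apply: lerD; last exact: fS.
  have := fS [seq - l | l <- s]; rewrite map_inj_uniq; last exact: oppr_inj.
  move=> /(_ us); rewrite big_map; under eq_bigr do rewrite fampN// opprK.
  by [].
rewrite fourier_sqE coscE sincE (_ : 8 * S ^+ 2 = (2 * S) ^+ 2 + (2 * S) ^+ 2); last by ring.
by apply: lerD; rewrite -real_normK ?num_real// lerXn2r ?nnegrE ?mulr_ge0.
Qed.

(** Unlike in [torus_conv], the shifted factor is the second one, which is continuous in all uses,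
    while g may be a weak derivative; [torus_convE] passes between the two by reflection. *)
Definition tconv g f (x : E) : R := \int[mu]_y (g y * f (x - y)).

Lemma tconv_cper g f : tintegrable g -> cper f -> cper (tconv g f).
Proof.
move=> gi [cf pf]; split.
  refine (@gcont_tintegral _ _ E (fun x y => f (x - y)) g _ _ gi).
    by apply: gcont_comp => //; apply: gcontB; [exact: gcont_fst|exact: gcont_snd].
  by move=> x; have [] := cper_reflect x (conj cf pf).
by move=> x k; apply: eq_Rintegral => y _; rewrite addrAC pf.
Qed.

(** The convolution theorem without complex numbers: multiplication by f^(k) is a combination of the
    phases th and th - pi / 2. *)
Lemma tconv_fc g f k th : tintegrable g -> cper f ->
  fc (tconv g f) k th = cosc f k * fc g k th - sinc f k * fc g k (th - pi / 2).
Proof.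
move=> gi cf; have [ctf pf] := cf.
have [mf [C fC]] := cper_mbounded cf.
transitivity (\int[mu]_y (g y * fc f k (th + freq k y))).
  rewrite /fc /tconv; under eq_Rintegral do rewrite mulrC.
  under [RHS]eq_Rintegral => y _.
    rewrite (_ : \int[mu]_x _ = \int[mu]_x (f (x - y) * tr k th x)); first over.
    by have := fc_shift k th (- y) cf; rewrite freqNr opprK /fc => <-.
  rewrite (tfubini (C := C) gi)//; last 2 first.
  - apply: (@continuous_measurable_prod_row R d d); apply: gcontM.
      by apply: gcont_comp => //; apply: gcontB; [exact: gcont_snd|exact: gcont_fst].
    by apply: (gcont_comp (g := tr k th)); [have [] := cper_tr k th (R := R)|exact: gcont_snd].
  - by move=> x y; rewrite normrM -[leRHS]mulr1 ler_pM// tr_norm_le1.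
  apply: eq_Rintegral => x _; rewrite -RintegralZl//.
    by apply: eq_Rintegral => z _; ring.
  by apply: tintegrableM => //; apply: cper_mbounded; exact: cper_reflect.
have fi := cper_tintegrable cf.
under eq_Rintegral do rewrite (fc_phase _ _ fi).
have h y : g y * (cos (th + freq k y) * cosc f k - sin (th + freq k y) * sinc f k) =
  cosc f k * (g y * tr k th y) - sinc f k * (g y * tr k (th - pi / 2) y).
  rewrite /tr [freq k y + th]addrC (_ : freq k y + (th - pi / 2) = th + freq k y - pi / 2); last by ring.
  by rewrite cosBpihalf; ring.
under eq_Rintegral do rewrite h.
have ti et := tintegrableM gi (mbounded_tr k et).
rewrite RintegralB//; [|exact: (tintegrableMr (mbounded_cst _))..].
by rewrite !RintegralZl//; exact: ti.
Qed.

Lemma tconv_fourier_sq g f k : tintegrable g -> cper f ->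
  fourier_sq (tconv g f) k = fourier_sq g k * fourier_sq f k.
Proof.
move=> gi cf; rewrite !fourier_sqE [cosc (tconv _ _) k]coscE [sinc (tconv _ _) k]sincE.
rewrite !tconv_fc// -coscE add0r -sincE fc_phase//.
rewrite (_ : - (pi / 2) - pi / 2 = - pi); last by field.
by rewrite cosN sinN cospi sinpi; ring.
Qed.

Lemma torus_convE f g x : tintegrable f -> measurable_fun setT f -> Zperiodic f -> cper g ->
  torus_conv f g x = tconv f g x.
Proof.
move=> fi mf pf cg; have [ctg pg] := cg.
rewrite /tconv -(tintegral_reflect x); last 2 first.
- by apply: measurable_funM => //; apply: cper_measurable; exact: cper_reflect.
- by move=> y k; rewrite pf; have [_ ->] := cper_reflect x cg.
by apply: eq_Rintegral => y _; rewrite subKr.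
Qed.

End fourier_consequences.

(** * Gronwall and dissipation inequalities *)

Section time_integral.
Context {R : realType}.
Local Notation leb := (@lebesgue_measure R).
Implicit Types (f g y F : R -> R) (t T : R).

Definition prim f t : R := \int[leb]_(s in `[0%R, t]) f s.

Lemma prim_integrable f t : continuous f -> leb.-integrable `[0%R, t] (EFin \o f).
Proof.
move=> cf; apply: continuous_compact_integrable; first exact: segment_compact.
exact: continuous_subspaceT.
Qed.

Lemma prim0 f : prim f 0 = 0.
Proof. by rewrite /prim set_itv1 Rintegral_set1. Qed.

Lemma is_derive_prim f t : continuous f -> 0 < t -> is_derive t 1 (prim f) (f t).
Proof.
move=> cf t0; have tt : t < t + 1 by rewrite ltrDl.
have [D e] := continuous_FTC1_closed tt (prim_integrable _ cf) t0 (cf t).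
by apply: DeriveDef; [exact: D|rewrite -derive1E; exact: e].
Qed.

Lemma prim_continuous f T : 0 <= T -> continuous f -> {within `[0%R, T], continuous (prim f)}.
Proof. by move=> T0 cf; apply: parameterized_integral_continuous => //; exact: prim_integrable. Qed.

Lemma primD f g t : continuous f -> continuous g ->
  prim (fun s => f s + g s) t = prim f t + prim g t.
Proof. by move=> cf cg; rewrite /prim RintegralD//; exact: prim_integrable. Qed.

Lemma primZ (a : R) f t : continuous f -> prim (fun s => a * f s) t = a * prim f t.
Proof. by move=> cf; rewrite /prim RintegralZl//; exact: prim_integrable. Qed.

Lemma prim_sum (I : Type) (r : seq I) (G : I -> R -> R) t :
  (forall i, continuous (G i)) ->
  prim (fun s => \sum_(i <- r) G i s) t = \sum_(i <- r) prim (G i) t.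
Proof.
move=> cG; elim: r => [|i r ih].
  rewrite big_nil /prim; under eq_Rintegral do rewrite big_nil.
  by rewrite Rintegral_cst//= mul0r.
rewrite big_cons -ih -primD//; last by apply: gcont_sum.
by apply: eq_Rintegral => s _; rewrite big_cons.
Qed.

Lemma prim_le f g t : continuous f -> continuous g ->
  (forall s, 0 <= s <= t -> f s <= g s) -> prim f t <= prim g t.
Proof.
move=> cf cg fg; apply: le_Rintegral; [by []|exact: prim_integrable|exact: prim_integrable|].
by move=> s /=; rewrite in_itv/=; exact: fg.
Qed.

Lemma prim_ge0 f t : (forall s, 0 <= s <= t -> 0 <= f s) -> 0 <= prim f t.
Proof. by move=> f0; apply: Rintegral_ge0 => s /=; rewrite in_itv/=; exact: f0. Qed.

Lemma prim_cst (a : R) t : 0 <= t -> prim (fun=> a) t = a * t.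
Proof.
move=> t0; rewrite /prim Rintegral_cst//= lebesgue_measure_itv/= lte_fin.
case: ltP => [_|t1]; first by rewrite /= subr0.
by have -> : t = 0 by apply/eqP; rewrite eq_le t0 t1.
Qed.

Lemma derive_le0_le g g' T : 0 < T -> {within `[0%R, T], continuous g} ->
  (forall t, 0 < t < T -> is_derive t 1 g (g' t)) ->
  (forall t, 0 < t < T -> g' t <= 0) ->
  forall t, 0 <= t <= T -> g t <= g 0.
Proof.
move=> T0 cg dg g0 t /andP[t0 tT].
have D x : x \in `]0%R, T[ -> is_derive x 1 g (g' x) by rewrite in_itv/= => /dg.
apply: (@ler0_derive1_le_cc _ g 0 T) => //.
- by move=> x /D[].
- move=> x xT; rewrite derive1E; have [_ ->] := D x xT.
  by move: xT; rewrite in_itv/= => /g0.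
- by rewrite in_itv/= t0.
- by rewrite in_itv/= lexx ltW.
Qed.

Lemma prim_mono f t T : continuous f -> (forall s, 0 <= s <= T -> 0 <= f s) ->
  0 <= t <= T -> prim f t <= prim f T.
Proof.
move=> cf f0 /andP[t0 tT].
have [->|tT'] := eqVneq t T; first exact: lexx.
have T0 : 0 < T by rewrite (le_lt_trans t0)// lt_neqAle tT' tT.
have D x : x \in `]0%R, T[ -> is_derive x 1 (prim f) (f x).
  by rewrite in_itv/= => /andP[x0 _]; exact: is_derive_prim.
apply: (@ger0_derive1_le_cc _ (prim f) 0 T) => //.
- by move=> x /D[].
- move=> x xT; rewrite derive1E; have [_ ->] := D x xT.
  by move: xT; rewrite in_itv/= => /andP[? ?]; apply: f0; rewrite !ltW.
- exact: prim_continuous (ltW T0) cf.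
- by rewrite in_itv/= t0.
- by rewrite in_itv/= lexx ltW.
Qed.

Lemma is_derive_expZ (a t : R) : is_derive t 1 (fun s : R => expR (a * s)) (a * expR (a * t)).
Proof.
have Dl : is_derive t 1 (fun s : R => a * s) a.
  have := is_deriveM (is_derive_cst a t 1) (is_derive_id t 1).
  by move=> H; apply: is_derive_eq; rewrite /GRing.scale/= mulr1 mulr0 addr0.
have De := is_derive_expR (a * t).
have D := @is_derive1_comp _ expR (fun s => a * s) _ _ _ De Dl.
by apply: is_derive_eq; rewrite mulrC.
Qed.

Lemma continuous_expZ (a : R) : continuous (fun s : R => expR (a * s)).
Proof.
apply: (gcont_comp (g := expR)); first exact: continuous_expR.
by apply: gcontM; [exact: gcont_cst|exact: gcont_id].
Qed.

(** With I the right-hand side of the integral inequality, exp(- A s) I(s) - \int_0^s F does not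
    increase, because y <= I, F >= 0 and exp(- A s) <= 1. *)
Lemma gronwall y F (A Y0 T : R) : 0 < T -> 0 <= A -> continuous y -> continuous F ->
  (forall t, 0 <= t <= T -> 0 <= F t) ->
  (forall t, 0 <= t <= T -> y t <= Y0 + prim (fun s => A * y s + F s) t) ->
  forall t, 0 <= t <= T -> y t <= expR (A * t) * (Y0 + prim F t).
Proof.
move=> T0 A0 cy cF F0 H t tT.
pose h s := A * y s + F s.
have ch : continuous h by apply: gcontD => //; apply: gcontM => //; exact: gcont_cst.
pose I s := Y0 + prim h s.
pose G s := expR (- A * s) * I s - prim F s.
have cG : {within `[0%R, T], continuous G}.
  have cp (u : R -> R) (cu : continuous u) := prim_continuous (ltW T0) cu.
  have cE : {within `[0%R, T], continuous (fun s : R => expR (- A * s))}.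
    by apply: continuous_subspaceT; exact: continuous_expZ.
  apply: (@gcontB _ (subspace `[0%R, T])); last exact: cp.
  apply: (@gcontM _ (subspace `[0%R, T])).
    exact: cE.
  by apply: (@gcontD _ (subspace `[0%R, T])); [exact: gcont_cst|exact: cp].
have DG s : 0 < s < T -> is_derive s 1 G (expR (- A * s) * h s + I s * (- A * expR (- A * s)) - F s).
  move=> /andP[s0 sT].
  have D1 := is_derive_expZ (- A) s.
  have D2 : is_derive s 1 I (h s).
    have := is_deriveD (is_derive_cst Y0 s 1) (is_derive_prim ch s0).
    by move=> D; apply: is_derive_eq; rewrite add0r.
  have D3 := is_derive_prim cF s0.
  exact: (is_deriveB (is_deriveM D1 D2) D3).
have G0 s : 0 < s < T -> expR (- A * s) * h s + I s * (- A * expR (- A * s)) - F s <= 0.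
  move=> /andP[s0 sT].
  have sI : 0 <= s <= T by rewrite !ltW.
  have yI := H s sI; have Fs := F0 s sI.
  have e0 := expR_gt0 (- A * s).
  have e1 : expR (- A * s) <= 1.
    by rewrite -expR0 ler_expR mulNr oppr_le0 mulr_ge0// ltW.
  have : expR (- A * s) * (A * (y s - I s)) <= 0.
    by rewrite pmulr_rle0// mulr_ge0_le0// subr_le0.
  have : (expR (- A * s) - 1) * F s <= 0 by rewrite mulr_le0_ge0// subr_le0.
  rewrite /h; nra.
have := derive_le0_le T0 cG DG G0 tT.
rewrite /G /I !prim0 mulr0 expR0 mul1r addr0 subr0 => GE.
apply: (le_trans (H t tT)); rewrite -/h.
have := expR_gt0 (A * t); have : expR (A * t) * expR (- A * t) = 1 by rewrite -expRD mulNr subrr expR0.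
move: GE; set p := Y0 + prim h t; set q := prim F t; set a := expR (A * t); set b := expR (- A * t).
move=> GE ab a0; rewrite -[leLHS]mul1r -ab -mulrA ler_pM2l//; lra.
Qed.

(** The dissipated energy lam \int e is kept on the left: it is the source of the integrated gain of
    one order. *)
Lemma dissipation_integral e N (e' : R -> R) (lam T : R) : 0 < T ->
  continuous e -> continuous N ->
  (forall t, 0 < t < T -> is_derive t 1 e (e' t)) ->
  (forall t, 0 < t < T -> e' t <= - lam * e t + N t) ->
  forall t, 0 <= t <= T -> e t + lam * prim e t <= e 0 + prim N t.
Proof.
move=> T0 ce cN de He t tT.
pose G s := e s + lam * prim e s - prim N s.
have cG : {within `[0%R, T], continuous G}.
  have cp (u : R -> R) (cu : continuous u) := prim_continuous (ltW T0) cu.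
  apply: (@gcontB _ (subspace `[0%R, T])); last exact: cp.
  apply: (@gcontD _ (subspace `[0%R, T])); first exact: continuous_subspaceT.
  by apply: (@gcontM _ (subspace `[0%R, T])); [exact: gcont_cst|exact: cp].
have DG s : 0 < s < T -> is_derive s 1 G (e' s + lam * e s - N s).
  move=> sT; have /andP[s0 _] := sT.
  have D2 : is_derive s 1 (fun u => lam * prim e u) (lam * e s).
    by apply: is_deriveZ; exact: is_derive_prim.
  exact: (is_deriveB (is_deriveD (de s sT) D2) (is_derive_prim cN s0)).
have G0 s : 0 < s < T -> e' s + lam * e s - N s <= 0.
  by move=> sT; have := He s sT; lra.
have := derive_le0_le T0 cG DG G0 tT.
rewrite /G !prim0 mulr0; lra.
Qed.

(** Duhamel in differential form: exp(q s) (e - be / q) does not increase. The factor 1 / q is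
    gained because be is constant in time. *)
Lemma dissipation_sup (e e' : R -> R) (q be T : R) : 0 < T -> 0 < q -> 0 <= be ->
  continuous e -> 0 <= e 0 ->
  (forall t, 0 < t < T -> is_derive t 1 e (e' t)) ->
  (forall t, 0 < t < T -> e' t <= - q * e t + be) ->
  forall t, 0 <= t <= T -> e t <= e 0 + be / q.
Proof.
move=> T0 q0 be0 ce e00 de He t tT.
pose G s := expR (q * s) * (e s - be / q).
have cG : {within `[0%R, T], continuous G}.
  apply: continuous_subspaceT; apply: gcontM; first exact: continuous_expZ.
  by apply: gcontB => //; exact: gcont_cst.
have DG s : 0 < s < T -> is_derive s 1 G (expR (q * s) * e' s + (e s - be / q) * (q * expR (q * s))).
  move=> sT; have D1 := is_derive_expZ q s.
  have D2 : is_derive s 1 (fun u => e u - be / q) (e' s).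
    have := is_deriveB (de s sT) (is_derive_cst (be / q) s 1).
    by move=> D; apply: is_derive_eq; rewrite subr0.
  exact: (is_deriveM D1 D2).
have G0 s : 0 < s < T -> expR (q * s) * e' s + (e s - be / q) * (q * expR (q * s)) <= 0.
  move=> sT; have := He s sT; have := expR_gt0 (q * s).
  have bq : be / q * q = be by rewrite divfK// gt_eqF.
  rewrite (_ : _ + _ = expR (q * s) * (e' s + e s * q - be / q * q)); last by ring.
  by rewrite bq => ? ?; rewrite pmulr_rle0//; lra.
have := derive_le0_le T0 cG DG G0 tT.
rewrite /G mulr0 expR0 mul1r => GE.
have /andP[t0 _] := tT.
have e1 : 1 <= expR (q * t) by rewrite -expR0 ler_expR mulr_ge0// ltW.
have bq0 : 0 <= be / q by rewrite divr_ge0// ltW.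
(* If e t exceeds be / q, the factor exp(q t) >= 1 may be dropped and e t <= e 0 follows; otherwise
   e 0 >= 0 concludes. *)
have [le|gt] := lerP (e t - be / q) 0; first lra.
have : e t - be / q <= expR (q * t) * (e t - be / q) by rewrite ler_peMl// ltW.
lra.
Qed.

End time_integral.

(** * Weighted sums over the frequencies *)

Section bounded_sums.
Context {R : realType} {K : countType}.
Implicit Types (m u v : K -> R) (s : seq K).

(** For nonnegative m: summable with sum at most S. Stated on finite sets, it passes through the
    estimates without limits. *)
Definition bsum m (S : R) := forall s, uniq s -> \sum_(k <- s) m k <= S.

Lemma bsum_ge0 m S : bsum m S -> 0 <= S.
Proof. by move=> /(_ [::] isT); rewrite big_nil. Qed.

Lemma bsum_le m m' S : (forall k, m k <= m' k) -> bsum m' S -> bsum m S.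
Proof. by move=> mm' h s us; apply: le_trans (h s us); apply: ler_sum. Qed.

Lemma bsumD m m' S S' : bsum m S -> bsum m' S' -> bsum (fun k => m k + m' k) (S + S').
Proof. by move=> h h' s us; rewrite big_split/= lerD ?h ?h'. Qed.

Lemma bsumZ (a : R) m S : 0 <= a -> bsum m S -> bsum (fun k => a * m k) (a * S).
Proof. by move=> a0 h s us; rewrite -mulr_sumr ler_wpM2l ?h. Qed.

Lemma bsum_sum (I : finType) (m : I -> K -> R) (S : R) :
  (forall i, bsum (m i) S) -> bsum (fun k => \sum_i m i k) (#|I|%:R * S).
Proof.
move=> h s us; rewrite exchange_big/= -sum1_card natr_sum mulr_suml.
by apply: ler_sum => i _; rewrite mul1r h.
Qed.

Lemma bsum1 m S k : bsum m S -> m k <= S.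
Proof. by move=> /(_ [:: k] isT); rewrite big_seq1. Qed.

Lemma ler_sum_sub m s s' : (forall k, 0 <= m k) -> uniq s -> uniq s' -> {subset s <= s'} ->
  \sum_(k <- s) m k <= \sum_(k <- s') m k.
Proof.
move=> m0 us us' ss'; rewrite [leRHS](bigID (mem s))/= -[leLHS]addr0 lerD ?sumr_ge0//.
have E : perm_eq s [seq k <- s' | k \in s].
  apply: uniq_perm => //; first exact: filter_uniq.
  by move=> k; rewrite mem_filter/=; case: (boolP (k \in s)) => // /ss'.
by rewrite (perm_big _ E)/= big_filter.
Qed.

Definition enum_idx (n : nat) : seq K := pmap (@pickle_inv K) (iota 0 n).

Lemma enum_idx_uniq n : uniq (enum_idx n).
Proof. by apply: (pmap_uniq (@pickle_invK K)); exact: iota_uniq. Qed.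

Lemma mem_enum_idx n k : (k \in enum_idx n) = (pickle k < n)%N.
Proof.
rewrite mem_pmap; apply/mapP/idP => [[i]|kn].
  rewrite mem_iota/= add0n => iN /esym ki.
  by have := @pickle_invK K i; rewrite ki/= => ->.
by exists (pickle k); rewrite ?mem_iota ?pickleK_inv.
Qed.

Lemma enum_idx_exhaust s : exists n, {subset s <= enum_idx n}.
Proof.
exists (\max_(k <- s) pickle k).+1 => k ks.
by rewrite mem_enum_idx ltnS; exact: leq_bigmax_seq.
Qed.

(** The sum of the series along the numbering of K. It gives [young_sum] the convolution itself, one
    bound valid for all finite sums. *)
Definition tsum m := limn (fun n => \sum_(k <- enum_idx n) m k).

Section tsum.
Variables (m : K -> R) (S : R).
Hypotheses (m0 : forall k, 0 <= m k) (mS : bsum m S).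

Lemma tsum_ndecr : nondecreasing_seq (fun n => \sum_(k <- enum_idx n) m k).
Proof.
move=> a b ab; apply: ler_sum_sub => //; [exact: enum_idx_uniq|exact: enum_idx_uniq|].
by move=> k; rewrite !mem_enum_idx => /leq_trans; exact.
Qed.

Lemma tsum_cvg : cvgn (fun n => \sum_(k <- enum_idx n) m k).
Proof.
apply: nondecreasing_is_cvgn; first exact: tsum_ndecr.
by exists S => _ [n _ <-]; apply: mS; exact: enum_idx_uniq.
Qed.

Lemma bsum_tsum : bsum m (tsum m).
Proof.
move=> s us; have [n sn] := enum_idx_exhaust s.
apply: (le_trans (ler_sum_sub m0 us (enum_idx_uniq n) sn)).
exact: nondecreasing_cvgn_le tsum_ndecr tsum_cvg n.
Qed.

End tsum.

(** Lagrange identity: twice the defect is the double sum of v_k v_l (u_k - u_l)^2. *)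
Lemma weighted_cauchy_schwarz s u v : (forall k, 0 <= v k) ->
  (\sum_(k <- s) v k * u k) ^+ 2 <= (\sum_(k <- s) v k) * \sum_(k <- s) v k * u k ^+ 2.
Proof.
move=> v0; rewrite -subr_ge0 -(pmulr_rge0 _ (ltr0n R 2)).
have -> : 2 * ((\sum_(k <- s) v k) * (\sum_(k <- s) v k * u k ^+ 2) - (\sum_(k <- s) v k * u k) ^+ 2) =
  \sum_(k <- s) \sum_(l <- s) v k * v l * (u k - u l) ^+ 2.
  transitivity (\sum_(k <- s) \sum_(l <- s)
    (v k * (v l * u l ^+ 2) + v k * u k ^+ 2 * v l - 2 * ((v k * u k) * (v l * u l)))).
    under [RHS]eq_bigr do rewrite sumrB big_split/= -!mulr_sumr.
    rewrite sumrB big_split/= -!mulr_suml -mulr_sumr -mulr_suml expr2; ring.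
  by apply: eq_bigr => k _; apply: eq_bigr => l _; ring.
apply: sumr_ge0 => k _; apply: sumr_ge0 => l _.
by apply: mulr_ge0; [exact: mulr_ge0|exact: sqr_ge0].
Qed.

End bounded_sums.

Section convolution_sums.
Context {R : realType} {d : nat}.
Local Notation Z := 'rV[int]_d.
Implicit Types (u v : Z -> R).

(** Young's inequality for the convolution of an l^1 and an l^2 sequence: c is that convolution.
    Truncations in l are bounded by Cauchy-Schwarz with weight v, and the bound passes to the
    limit. *)
Lemma young_sum u v (A B : R) : (forall k, 0 <= u k) -> (forall k, 0 <= v k) ->
  bsum (fun k => u k ^+ 2) A -> bsum v B ->
  exists c : Z -> R, [/\ forall k, 0 <= c k, forall k, bsum (fun l => v l * u (k - l)) (c k) &
    bsum (fun k => c k ^+ 2) (B * (B * A))].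
Proof.
move=> u0 v0 uA vB; have A0 := bsum_ge0 uA; have B0 := bsum_ge0 vB.
pose m (k l : Z) := v l * u (k - l).
have m0 k l : 0 <= m k l by rewrite mulr_ge0.
have uA' k : u k <= Num.sqrt A.
  rewrite -[u k]ger0_norm ?u0// -sqrtr_sqr ler_wsqrtr//; exact: (bsum1 k uA).
have mb k : bsum (m k) (Num.sqrt A * B).
  by apply: bsum_le (bsumZ (sqrtr_ge0 A) vB) => l; rewrite /m mulrC ler_wpM2r.
exists (fun k => tsum (m k)); split => [k|k|s us].
- by have := bsum_ge0 (bsum_tsum (m0 k) (mb k)).
- exact: bsum_tsum (mb k).
pose Ln n : seq Z := enum_idx n.
have uLn n : uniq (Ln n) by exact: enum_idx_uniq.
pose p n k := \sum_(l <- Ln n) m k l.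
have pc k : p n k @[n --> \oo] --> tsum (m k) by exact: tsum_cvg (mb k).
have sc (t : seq Z) : \sum_(k <- t) p n k ^+ 2 @[n --> \oo] --> \sum_(k <- t) tsum (m k) ^+ 2.
  elim: t => [|k t ih].
    by rewrite big_nil; under eq_fun do rewrite big_nil; exact: cvg_cst.
  rewrite big_cons; under eq_fun do rewrite big_cons.
  apply: cvgD => //; rewrite expr2; under eq_fun do rewrite expr2.
  exact: cvgM.
rewrite -(cvg_lim _ (sc s))//; apply: limr_le; first by apply/cvg_ex; eexists; exact: sc.
apply: nearW => n; rewrite /p; move: (Ln n) (uLn n) => L uL.
apply: (@le_trans _ _ (\sum_(k <- s) B * \sum_(l <- L) v l * u (k - l) ^+ 2)).
  apply: ler_sum => k _; apply: le_trans (weighted_cauchy_schwarz L (fun l => u (k - l)) v0) _.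
  rewrite ler_wpM2r ?vB//.
  by apply: sumr_ge0 => l _; rewrite mulr_ge0 ?sqr_ge0.
rewrite -mulr_sumr ler_wpM2l// exchange_big/=.
apply: (@le_trans _ _ (\sum_(l <- L) v l * A)).
  apply: ler_sum => l _; rewrite -mulr_sumr ler_wpM2l//.
  have := uA [seq k - l | k <- s]; rewrite map_inj_uniq; last exact: addIr.
  by move=> /(_ us); rewrite big_map.
by rewrite -mulr_suml ler_wpM2r// vB.
Qed.

Definition lamk (k : Z) : R := \sum_(i < d) kap k i ^+ 2.
Definition qk (k : Z) : R := 1 + lamk k.
(** [qk k ^+ s] is the square of [rk k ^+ s], the form of the weight that can be distributed inside
    a convolution. *)
Definition rk (k : Z) : R := Num.sqrt (qk k).

Lemma lamk_ge0 k : 0 <= lamk k.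
Proof. by apply: sumr_ge0 => i _; rewrite sqr_ge0. Qed.

Lemma qk_ge1 k : 1 <= qk k.
Proof. by rewrite lerDl lamk_ge0. Qed.

Lemma qk_gt0 k : 0 < qk k.
Proof. exact: lt_le_trans ltr01 (qk_ge1 k). Qed.

Lemma rk_sq k : rk k ^+ 2 = qk k.
Proof. by rewrite sqr_sqrtr// ltW// qk_gt0. Qed.

Lemma rk_gt0 k : 0 < rk k.
Proof. by rewrite sqrtr_gt0 qk_gt0. Qed.

(** Peetre's inequality, from |k|^2 <= 2 |k - l|^2 + 2 |l|^2. *)
Lemma qk_peetre k l : qk k <= 2 * (qk (k - l) * qk l).
Proof.
have : lamk k <= 2 * lamk (k - l) + 2 * lamk l.
  rewrite /lamk !mulr_sumr -big_split/=; apply: ler_sum => i _.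
  have -> : kap k i = kap (k - l) i + kap l i :> R.
    by rewrite /kap !mxE -mulrDr -intrD subrK.
  have := sqr_ge0 (kap (k - l) i - kap l i : R).
  rewrite sqrrB sqrrD; lra.
have := mulr_ge0 (lamk_ge0 (k - l)) (lamk_ge0 l).
rewrite /qk; nra.
Qed.

Lemma rk_peetre k l : rk k <= 2 * (rk l * rk (k - l)).
Proof.
rewrite -[leRHS]ger0_norm ?mulr_ge0 ?(ltW (rk_gt0 _))// -sqrtr_sqr ler_wsqrtr//.
rewrite !exprMn !rk_sq; apply: le_trans (qk_peetre k l) _.
rewrite [qk l * _]mulrC ler_wpM2r ?mulr_ge0 ?ltW ?qk_gt0//; lra.
Qed.

(** Peetre splits the weight rk^s between the two factors al. Then D (rk^s al) is a product of two
    square-summable sequences, hence summable, and [young_sum] applies. D carries no weight, so one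
    bound on it serves every s. *)
Lemma bootstrap_sum (s : nat) (D al : Z -> R) (A M2 : R) :
  (forall k, 0 <= D k) -> (forall k, 0 <= al k) ->
  bsum (fun k => qk k ^+ s * al k ^+ 2) A -> bsum (fun k => D k ^+ 2) M2 ->
  exists2 c : Z -> R, forall k, bsum (fun l => (D l * al l) * al (k - l)) (c k) &
    bsum (fun k => qk k ^+ s * c k ^+ 2) ((2 ^+ s * (M2 + A)) ^+ 2 * A).
Proof.
move=> D0 al0 hA hD.
have A0 := bsum_ge0 hA; have M0 := bsum_ge0 hD.
pose u k := rk k ^+ s * al k; pose v k := 2 ^+ s * (D k * u k).
have r0 k : 0 < rk k ^+ s by rewrite exprn_gt0// rk_gt0.
have u0 k : 0 <= u k by rewrite mulr_ge0// ltW.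
have v0 k : 0 <= v k.
  by apply: mulr_ge0; [exact: exprn_ge0|exact: mulr_ge0].
have uA : bsum (fun k => u k ^+ 2) A.
  by apply: bsum_le hA => k; rewrite /u exprMn -exprM mulnC exprM rk_sq.
have vB : bsum v (2 ^+ s * (M2 + A)).
  apply: bsumZ; first by rewrite exprn_ge0.
  apply: bsum_le (bsumD hD uA) => k.
  have := sqr_ge0 (D k - u k); have := sqr_ge0 (D k + u k); rewrite sqrrB sqrrD; lra.
have [c [c0 hc hc2]] := young_sum u0 v0 uA vB.
exists (fun k => c k / rk k ^+ s) => [k t ut|].
  rewrite ler_pdivlMr//; apply: le_trans (hc k t ut).
  rewrite mulr_suml; apply: ler_sum => l _.
  have -> : v l * u (k - l) = D l * al l * al (k - l) * (2 * (rk l * rk (k - l))) ^+ s.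
    by rewrite /v /u !exprMn; ring.
  by rewrite ler_wpM2l ?mulr_ge0// lerXn2r ?nnegrE ?rk_peetre ?mulr_ge0 ?ltW ?rk_gt0.
have -> : (2 ^+ s * (M2 + A)) ^+ 2 * A = 2 ^+ s * (M2 + A) * (2 ^+ s * (M2 + A) * A).
  by ring.
apply: bsum_le hc2 => k; rewrite expr_div_n -exprM mulnC exprM rk_sq mulrC divfK//.
by rewrite gt_eqF// exprn_gt0// qk_gt0.
Qed.

Lemma bsum_inv_sqr : bsum (fun a : int => (1 + a%:~R ^+ 2)^-1 : R) 6.
Proof.
(* Telescoping from N = 1, where the bound is 1 = 3 - 2: for n >= 1, 1 / (1 + n^2) <= 2 / n - 2 / (n
   + 1). *)
have P (N : nat) : \sum_(0 <= n < N) (1 + n%:R ^+ 2)^-1 <= 3 - 2 / N%:R + 2 * (N == 0%N)%:R :> R.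
  case: N => [|N]; first by rewrite big_geq// invr0; lra.
  rewrite mulr0 addr0; elim: N => [|N ih].
    by rewrite big_nat1 expr0n/= addr0 invr1; lra.
  rewrite big_nat_recr//=.
  have a0 : 0 < N.+1%:R :> R by [].
  have b0 : 0 < N.+2%:R :> R by [].
  have ba : N.+2%:R = N.+1%:R + 1 :> R by rewrite -natr1.
  have h : (1 + N.+1%:R ^+ 2)^-1 <= 2 / N.+1%:R - 2 / N.+2%:R :> R.
    have -> : 2 / N.+1%:R - 2 / N.+2%:R = 2 / (N.+1%:R * N.+2%:R) :> R.
      have aux (a : R) : 0 < a -> 2 / a - 2 / (a + 1) = 2 / (a * (a + 1)).
        move=> a0'; have an : a != 0 by rewrite gt_eqF.
        have an1 : a + 1 != 0 by rewrite gt_eqF// addr_gt0.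
        by field; rewrite an an1.
      by rewrite ba aux.
    rewrite -[leLHS]mul1r ler_pdivlMr ?mulr_gt0// mulrAC ler_pdivrMr ?ltr_pwDl ?sqr_ge0//.
    have : 0 <= (N.+1%:R - 1) ^+ 2 :> R := sqr_ge0 _.
    rewrite ba sqrrB; nra.
  by apply: le_trans (lerD ih h) _; rewrite addrA subrK.
have P3 N : \sum_(0 <= n < N) (1 + n%:R ^+ 2)^-1 <= 3 :> R.
  case: N => [|N]; first by rewrite big_geq.
  apply: le_trans (P N.+1) _; rewrite mulr0 addr0 gerBl; exact: divr_ge0.
move=> s us; have [N aN] : exists N, forall a, a \in s -> (`|a|%N < N)%N.
  by exists (\max_(a <- s) `|a|%N).+1 => a sa; rewrite ltnS; apply: leq_bigmax_seq.
(* The integers from - N to N - 1. [Negz n] is - (n + 1), whose term is at most that of n. *)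
pose t := [seq Posz n | n <- iota 0 N] ++ [seq Negz n | n <- iota 0 N].
apply: (@le_trans _ _ (\sum_(a <- t) (1 + a%:~R ^+ 2)^-1)).
  apply: ler_sum_sub => //.
  - by move=> a; rewrite invr_ge0 addr_ge0// sqr_ge0.
  - rewrite cat_uniq !map_inj_uniq ?iota_uniq ?andbT/=; [|by move=> ? ? []..].
    by apply/hasPn => x /mapP[n _ ->]; apply/negP => /mapP[].
  - move=> a sa; rewrite mem_cat; apply/orP.
    case: a {sa} (aN a sa) => n /= nN; [left|right]; apply/mapP; exists n => //;
      rewrite mem_iota//= add0n; exact: leq_trans (leqnSn _) nN.
rewrite big_cat/= !big_map.
have -> : (6 : R) = 3 + 3 by rewrite -natrD.
apply: lerD; first by have := P3 N; rewrite /index_iota subn0.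
have := P3 N; rewrite /index_iota subn0; apply: le_trans; apply: ler_sum => n _.
have h0 : 0 < 1 + n%:R ^+ 2 :> R by rewrite ltr_pwDl ?sqr_ge0.
rewrite lef_pV2 ?posrE//; last by rewrite ltr_pwDl ?sqr_ge0.
by rewrite lerD2l NegzE mulrNz sqrrN lerXn2r ?nnegrE// ler_nat.
Qed.

(** A finite s lies in the grid P^d, where P collects all coordinates of its members, and over a
    grid the sum of products factors. *)
Lemma bsum_prod (g : int -> R) (S : R) : (forall a, 0 <= g a) -> bsum g S ->
  bsum (fun k : Z => \prod_(i < d) g (k ord0 i)) (S ^+ d).
Proof.
move=> g0 gS s us.
pose P := undup (flatten [seq [seq k ord0 i | i <- enum 'I_d] | k : Z <- s]).
have uP : uniq P := undup_uniq _.
pose phi (f : {ffun 'I_d -> 'I_(size P)}) : Z := \row_i nth 0 P (f i).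
have phi_inj : injective phi.
  move=> f f' /rowP h; apply/ffunP => i; have := h i; rewrite !mxE => /eqP.
  by rewrite nth_uniq// => /eqP/val_inj.
apply: (@le_trans _ _ (\sum_(k <- [seq phi f | f <- index_enum {ffun 'I_d -> 'I_(size P)}])
    \prod_(i < d) g (k ord0 i))).
  apply: ler_sum_sub => //.
  - by move=> k; apply: prodr_ge0.
  - by rewrite map_inj_uniq// index_enum_uniq.
  - move=> k ks; have kP i : k ord0 i \in P.
      rewrite mem_undup; apply/flattenP; exists [seq k ord0 i | i <- enum 'I_d].
        by apply/mapP; exists k.
      by apply/mapP; exists i => //; rewrite mem_enum.
    have kI i : (index (k ord0 i) P < size P)%N by rewrite index_mem.
    apply/mapP; exists [ffun i => Ordinal (kI i)]; first exact: mem_index_enum.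
    by apply/rowP => i; rewrite !mxE ffunE/= nth_index.
rewrite big_map; under eq_bigr do under eq_bigr do rewrite mxE.
rewrite -(bigA_distr_bigA (fun (_ : 'I_d) (a : 'I_(size P)) => g (nth 0 P a)))/=.
rewrite -[X in _ <= _ ^+ X]card_ord -prodr_const; apply: ler_prod => i _.
rewrite sumr_ge0//=.
have := gS P uP; rewrite (big_nth 0) big_mkord; exact.
Qed.

(** Each of the d factors 1 + k_i^2 is at most [qk k], because (2 pi)^2 >= 1; the 6 of
    [bsum_inv_sqr] is raised to the power d. *)
Lemma bsum_qk_inv : bsum (fun k : Z => (qk k ^+ d)^-1) (6 ^+ d).
Proof.
have g0 (a : int) : 0 <= (1 + a%:~R ^+ 2)^-1 :> R by rewrite invr_ge0 addr_ge0// sqr_ge0.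
apply: bsum_le (bsum_prod g0 bsum_inv_sqr) => k.
rewrite -[X in _ ^- X](card_ord d) -prodr_const -prodfV.
apply: ler_prod => i _; rewrite invr_ge0 ltW ?qk_gt0//=.
rewrite lef_pV2 ?posrE ?qk_gt0 ?ltr_pwDl ?sqr_ge0//.
rewrite /qk lerD2l /lamk (bigD1 i)//= -[leLHS]addr0 lerD ?sumr_ge0//; last by move=> j _; rewrite sqr_ge0.
rewrite /kap exprMn ler_peMl ?sqr_ge0//.
have := pi_ge2 R => h; rewrite exprn_ege1//; lra.
Qed.

End convolution_sums.

(** * The McKean-Vlasov equation on the Fourier side *)

Section weak_derivatives.
Context {R : realType} {d : nat}.
Local Notation E := 'rV[R]_d.
Local Notation Z := 'rV[int]_d.
Local Notation mu := (@torus R d).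
Implicit Types (f g W : E -> R) (k : Z) (th : R).

(** The trigonometric functions are admissible test functions, and differentiating one only shifts
    its phase and multiplies by [kap k i]. *)
Lemma weak_deriv_fc i f g k th : tintegrable f -> is_weak_deriv [:: i] f g ->
  fc g k th = - (kap k i * fc f k (th + pi / 2)).
Proof.
move=> fi [_ _ gi /(_ _ (test_function_tr k th))] /=.
rewrite expr1 mulN1r -/(fc g k th) partial_tr => h.
rewrite -[LHS]opprK -h; congr (- _); rewrite /fc -RintegralZl//.
  by apply: eq_Rintegral => x _; ring.
exact: tintegrableM fi (mbounded_tr _ _).
Qed.

Lemma ae_eq_fc f g k th : measurable_fun setT f -> measurable_fun setT g ->
  {ae mu, forall x, f x = g x} -> fc f k th = fc g k th.
Proof.
move=> mf mg fg; rewrite /fc /Rintegral; congr fine.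
have [mt _] := mbounded_tr k th (R := R).
apply: ae_eq_integral => //.
- by apply/measurable_EFinP; exact: measurable_funM.
- by apply/measurable_EFinP; exact: measurable_funM.
- by apply: filterS fg => x fgx _; rewrite /= fgx.
Qed.

Lemma Lnormy_ae f (M : R) : ('N[mu]_+oo[EFin \o f] <= M%:E)%E ->
  {ae mu, forall x, `|f x| <= M}.
Proof.
rewrite unlock; case: ifPn => [_ /ess_supP|/negP[]].
  by apply: filterS => x; rewrite /= lee_fin.
(* A measure of zero total mass, which the definition of the norm singles out, is excluded: the
   torus has mass 1. *)
by rewrite [X in (_ < X)%E](_ : _ = 1%E) ?lte01//; exact: (@probability_setT _ _ _ mu).
Qed.

Lemma W2inf_weak_deriv W i : in_W2inf W -> is_weak_deriv [:: i] W (weak_deriv [:: i] W).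
Proof.
move=> [_ _ /(_ [:: i] isT)[g gW _]].
by rewrite /weak_deriv; apply: (xgetPex (cst 0)); exists g.
Qed.

Lemma W2inf_norm_deriv W i (M : R) : (W2inf_norm W <= M%:E)%E ->
  ('N[mu]_+oo[EFin \o weak_deriv [:: i] W] <= M%:E)%E.
Proof.
apply: le_trans; rewrite /W2inf_norm.
apply: (@le_trans _ _ (\sum_(i < d) 'N[mu]_+oo[EFin \o weak_deriv [:: i] W])%E).
  rewrite (bigD1 i)//= leeDl// sume_ge0// => j _; exact: Lnorm_ge0.
rewrite -addeA addeC -addeA leeDl// adde_ge0//; last exact: Lnorm_ge0.
by apply: sume_ge0 => j _; apply: sume_ge0 => l _; exact: Lnorm_ge0.
Qed.

(* [D i] is an everywhere bounded version of the weak derivative D_i W. *)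
Definition deriv_of W (M : R) (D : 'I_d -> E -> R) : Prop :=
  forall i, [/\ mbounded (D i), Zperiodic (D i), forall x, `|D i x| <= M &
    forall k th, fc (D i) k th = - (kap k i * fc W k (th + pi / 2))].

Lemma W2inf_deriv W (M : R) : in_W2inf W -> (W2inf_norm W <= M%:E)%E ->
  exists D, deriv_of W M D.
Proof.
move=> W2 WM.
pose g i := weak_deriv [:: i] W.
(* Truncation at M turns the almost everywhere bound into one valid everywhere, without changing the
   Fourier coefficients. *)
exists (fun i x => if `|g i x| <= M then g i x else 0) => i.
have [pg mg gi gW] := W2inf_weak_deriv i W2.
have gM := Lnormy_ae (W2inf_norm_deriv i WM).
have M0 : 0 <= M.
  rewrite -lee_fin; apply: le_trans (W2inf_norm_deriv i WM); exact: Lnorm_ge0.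
have mD : measurable_fun setT (fun x => if `|g i x| <= M then g i x else 0).
  apply: measurable_fun_ifT => //.
  by apply: measurable_fun_ler => //; exact: measurableT_comp.
have DM x : `|if `|g i x| <= M then g i x else 0| <= M.
  by case: ifPn => // _; rewrite normr0.
split => //.
- by split => //; exists M.
- by move=> x k; rewrite /g pg.
move=> k th; rewrite (@ae_eq_fc _ (g i))//.
  have [pW cW _] := W2; apply: weak_deriv_fc (W2inf_weak_deriv i W2).
  by apply: cper_tintegrable; split.
by apply: filterS gM => x ->.
Qed.

End weak_derivatives.

Section flux.
Context {R : realType} {d : nat}.
Local Notation E := 'rV[R]_d.
Local Notation Z := 'rV[int]_d.
Local Notation mu := (@torus R d).

(** Joint continuity is asked over all real times: [ext] provides it, and time integrals then meet
    globally continuous functions. *)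
Definition cper2 (u : R -> E -> R) :=
  continuous (fun z : R * E => u z.1 z.2) /\ forall t, Zperiodic (u t).

Lemma cper2_cper u t : cper2 u -> cper (u t).
Proof.
move=> [cu pu]; split => //.
apply: (gcont_comp (g := fun z : R * E => u z.1 z.2) (f := fun x => (t, x))) => //.
by apply: gcont_pair; [exact: gcont_cst|exact: gcont_id].
Qed.

Lemma cper2B u v : cper2 u -> cper2 v -> cper2 (fun t x => u t x - v t x).
Proof. by move=> [cu pu] [cv pv]; split; [exact: gcontB|move=> t x k; rewrite pu pv]. Qed.

Lemma cper2M u v : cper2 u -> cper2 v -> cper2 (fun t x => u t x * v t x).
Proof. by move=> [cu pu] [cv pv]; split; [exact: gcontM|move=> t x k; rewrite pu pv]. Qed.

Lemma cper2_tconv g u : tintegrable g -> cper2 u -> cper2 (fun t => tconv g (u t)).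
Proof.
move=> gi cu2; have [cu pu] := cu2; split; last first.
  by move=> t; have [] := tconv_cper gi (cper2_cper t cu2).
refine (@gcont_tintegral _ _ (R * E)%type (fun z y => u z.1 (z.2 - y)) g _ _ gi); last first.
  by move=> z; have [] := cper_reflect z.2 (cper2_cper z.1 cu2).
apply: (gcont_comp (g := fun z : R * E => u z.1 z.2)
  (f := fun w : (R * E) * E => (w.1.1, w.1.2 - w.2))) => //.
apply: gcont_pair; first exact: (gcont_comp gcont_fst gcont_fst).
by apply: gcontB; [exact: (gcont_comp gcont_snd gcont_fst)|exact: gcont_snd].
Qed.

Lemma continuous_fc u k th : cper2 u -> continuous (fun t => fc (u t) k th).
Proof.
move=> [cu pu].
have := gcont_tintegral cu pu (mbounded_tintegrable (mbounded_tr k th)).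
by rewrite /fc; under eq_fun do under eq_Rintegral do rewrite mulrC.
Qed.

Lemma continuous_fourier_sq u k : cper2 u -> continuous (fun t => fourier_sq (u t) k).
Proof.
move=> cu; have cf th := continuous_fc (k := k) (th := th) cu.
rewrite (_ : (fun t => _) = (fun t => fc (u t) k 0 ^+ 2 + fc (u t) k (- (pi / 2)) ^+ 2)); last first.
  by apply/funext => t; rewrite fourier_sqE coscE sincE.
by apply: gcontD; apply: gcontX.
Qed.

Lemma continuous_sqnorm u : cper2 u -> continuous (fun t => \int[mu]_x u t x ^+ 2).
Proof.
move=> [cu pu]; apply: gcont_tintegral1; first exact: gcontX.
by move=> t x k; rewrite pu.
Qed.

(* u' = Delta u + div G on the Fourier side, for 0 < t < T *)
Definition fourier_flux (T : R) (u : R -> E -> R) (G : 'I_d -> R -> E -> R) :=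
  forall k th t, 0 < t < T -> is_derive t 1 (fun s => fc (u s) k th)
    (- lamk k * fc (u t) k th - \sum_(i < d) kap k i * fc (G i t) k (th + pi / 2)).

Lemma fourier_fluxB T u v G H : cper2 u -> cper2 v ->
  (forall i, cper2 (G i)) -> (forall i, cper2 (H i)) ->
  fourier_flux T u G -> fourier_flux T v H ->
  fourier_flux T (fun t x => u t x - v t x) (fun i t x => G i t x - H i t x).
Proof.
move=> cu cv cG cH fu fv k th t tT.
have ti w s : cper2 w -> tintegrable (w s) by move=> cw; exact/cper_tintegrable/cper2_cper.
rewrite (_ : (fun s => _) = (fun s => fc (u s) k th - fc (v s) k th)); last first.
  by apply/funext => s; rewrite fcB//; exact: ti.
have D := is_deriveB (fu k th t tT) (fv k th t tT).
apply: is_derive_eq; rewrite fcB; [|exact: ti|exact: ti].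
have E i : kap k i * fc (fun x => G i t x - H i t x) k (th + pi / 2) =
    kap k i * fc (G i t) k (th + pi / 2) - kap k i * fc (H i t) k (th + pi / 2).
  by rewrite fcB ?mulrBr//; exact: ti.
by rewrite (eq_bigr _ (fun i _ => E i)) sumrB; ring.
Qed.

Section energy.
Variables (T : R) (u : R -> E -> R) (G : 'I_d -> R -> E -> R).
Hypotheses (T0 : 0 < T) (cu : cper2 u) (cG : forall i, cper2 (G i)).
Hypothesis fu : fourier_flux T u G.

Let e k t := fourier_sq (u t) k.
Let N k t := \sum_(i < d) fourier_sq (G i t) k.

(** The exact derivative contains - 2 lam_k e_k; one half absorbs the cross terms by 2 a b <= a^2 +
    b^2, which leaves the squared flux coefficients. *)
Lemma flux_energy k : exists e', (forall t, 0 < t < T -> is_derive t 1 (e k) (e' t)) /\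
  forall t, 0 < t < T -> e' t <= - lamk k * e k t + N k t.
Proof.
pose c t := fc (u t) k 0; pose s t := fc (u t) k (- (pi / 2)).
pose c' t := - lamk k * c t - \sum_(i < d) kap k i * fc (G i t) k (pi / 2).
pose s' t := - lamk k * s t - \sum_(i < d) kap k i * fc (G i t) k 0.
exists (fun t => 2 * (c t * c' t + s t * s' t)); split => t tT.
  rewrite (_ : e k = (fun t => c t ^+ 2 + s t ^+ 2)); last first.
    by apply/funext => r; rewrite /e fourier_sqE coscE sincE.
  have Dc : is_derive t 1 c (c' t) by have := fu k 0 tT; rewrite add0r.
  have Ds : is_derive t 1 s (s' t) by have := fu k (- (pi / 2)) tT; rewrite addNr.
  have -> : (fun t => c t ^+ 2 + s t ^+ 2) = (fun t => c t * c t + s t * s t).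
    by apply/funext => r; rewrite !expr2.
  have D := is_deriveD (is_deriveM Dc Dc) (is_deriveM Ds Ds).
  by apply: is_derive_eq; rewrite /GRing.scale/=; ring.
have Gi i : tintegrable (G i t) by exact/cper_tintegrable/cper2_cper.
have E1 : \sum_(i < d) kap k i * fc (G i t) k (pi / 2) = - \sum_(i < d) kap k i * sinc (G i t) k.
  rewrite -sumrN; apply: eq_bigr => i _; rewrite (fc_phase _ _ (Gi i)) cos_pihalf sin_pihalf; ring.
rewrite /c' /s' E1.
have -> : 2 * (c t * (- lamk k * c t - - \sum_(i < d) kap k i * sinc (G i t) k) +
   s t * (- lamk k * s t - \sum_(i < d) kap k i * fc (G i t) k 0)) =
   - lamk k * e k t - lamk k * (c t ^+ 2 + s t ^+ 2) +
    \sum_(i < d) 2 * (kap k i * (c t * sinc (G i t) k - s t * cosc (G i t) k)).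
  rewrite {1}/e fourier_sqE coscE sincE -/(c t) -/(s t).
  have E2 i : 2 * (kap k i * (c t * sinc (G i t) k - s t * cosc (G i t) k)) =
      (2 * c t) * (kap k i * sinc (G i t) k) - (2 * s t) * (kap k i * fc (G i t) k 0).
    by rewrite coscE; ring.
  by rewrite (eq_bigr _ (fun i _ => E2 i)) sumrB -!mulr_sumr; ring.
rewrite -addrA lerD2l /lamk mulr_suml -sumrN -big_split/= /N; apply: ler_sum => i _.
rewrite fourier_sqE.
have := sqr_ge0 (kap k i * c t - sinc (G i t) k).
have := sqr_ge0 (kap k i * s t + cosc (G i t) k).
rewrite sqrrB sqrrD; nra.
Qed.

Lemma continuous_flux_energy k : continuous (N k).
Proof. by apply: gcont_sum => i _; exact: continuous_fourier_sq. Qed.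

Lemma flux_dissipation k t : 0 <= t <= T ->
  e k t + lamk k * prim (e k) t <= e k 0 + prim (N k) t.
Proof.
move=> tT; have [e' [De He]] := flux_energy k.
apply: (dissipation_integral T0 _ _ De He tT); first exact: continuous_fourier_sq.
exact: continuous_flux_energy.
Qed.

Lemma prim_fourier_ge0 k t : 0 <= prim (e k) t.
Proof. by apply: prim_ge0 => s _; exact: fourier_sq_ge0. Qed.

(** [flux_dissipation] is summed over finite sets of k, with Bessel for the data and the flux and
    Parseval for u; the L^2 norm itself is never differentiated. *)
Lemma flux_sqnorm t : 0 <= t <= T ->
  \int[mu]_x u t x ^+ 2 <= \int[mu]_x u 0 x ^+ 2 +
    prim (fun s => \sum_(i < d) \int[mu]_x G i s x ^+ 2) t.
Proof.
move=> tT; apply: parseval_le; first exact: cper2_cper.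
move=> s us; apply: (@le_trans _ _ (\sum_(k <- s) (e k 0 + prim (N k) t))).
  apply: ler_sum => k _; apply: le_trans (flux_dissipation k tT).
  by rewrite lerDl mulr_ge0 ?lamk_ge0 ?prim_fourier_ge0.
rewrite big_split/=; apply: lerD; first exact: bessel (cper_mbounded (cper2_cper 0 cu)) us.
rewrite -prim_sum; last by move=> k; exact: continuous_flux_energy.
apply: prim_le.
- by apply: gcont_sum => k _; exact: continuous_flux_energy.
- by apply: gcont_sum => i _; exact: continuous_sqnorm.
move=> r _; rewrite exchange_big/=; apply: ler_sum => i _.
exact: bessel (cper_mbounded (cper2_cper r (cG i))) us.
Qed.

End energy.
End flux.

Section mv_fourier.
Context {R : realType} {d : nat}.
Local Notation E := 'rV[R]_d.
Local Notation Z := 'rV[int]_d.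
Local Notation mu := (@torus R d).
Implicit Types (W phi f : E -> R) (rho : R -> E -> R) (T M : R).

Definition clamp T (t : R) : R := Num.max 0 (Num.min t T).

Lemma clamp_itv T t : 0 <= T -> 0 <= clamp T t <= T.
Proof.
by move=> T0; rewrite /clamp le_max lexx/= ge_max T0/= ge_min lexx orbT.
Qed.

Lemma clamp_id T t : 0 <= t <= T -> clamp T t = t.
Proof. by move=> /andP[t0 tT]; rewrite /clamp min_l// max_r. Qed.

Lemma continuous_clamp T : continuous (clamp T).
Proof.
have cm : continuous (fun t : R => Num.min t T).
  under eq_fun do rewrite minr_absE.
  apply: gcontM; last exact: gcont_cst.
  apply: gcontB; first by apply: gcontD; [exact: gcont_id|exact: gcont_cst].
  by apply: gcont_norm; apply: gcontB; [exact: gcont_id|exact: gcont_cst].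
rewrite /clamp; under eq_fun do rewrite maxr_absE.
apply: gcontM; last exact: gcont_cst.
apply: gcontD; first by apply: gcontD; [exact: gcont_cst|exact: cm].
by apply: gcont_norm; apply: gcontB; [exact: gcont_cst|exact: cm].
Qed.

(* Freezing rho outside [0, T] makes it jointly continuous on R x T^d. *)
Definition ext T rho : R -> E -> R := fun t => rho (clamp T t).

Lemma ext_id T rho t : 0 <= t <= T -> ext T rho t = rho t.
Proof. by move=> tT; rewrite /ext clamp_id. Qed.

Lemma within_comp_continuous (P Q S : topologicalType) (A : set Q) (f : Q -> S) (g : P -> Q) :
  {within A, continuous f} -> continuous g -> (forall p, A (g p)) ->
  continuous (fun p => f (g p)).
Proof.
move=> /subspace_continuousP cf cg gA p.
apply: (@cvg_comp _ _ _ g f (nbhs p) (within A (nbhs (g p)))); last exact: cf.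
move=> B wB; have {}wB : nbhs (g p) [set q | A q -> B q] by exact: wB.
have h : nbhs p [set q | A (g q) -> B (g q)] := cg p _ wB.
by apply: filterS h => q /= hq; exact: (hq (gA q)).
Qed.

Lemma mv_cper2 T W phi rho : 0 < T -> mv_solution T W phi rho -> cper2 (ext T rho).
Proof.
move=> T0 [dens cr _ _ _]; have T0' := ltW T0; split; last first.
  by move=> t; have [] := dens (clamp T t); rewrite ?in_itv/= ?clamp_itv.
apply: (within_comp_continuous (f := fun z => rho z.1 z.2)
  (g := fun z : R * E => (clamp T z.1, z.2)) cr).
  apply: gcont_pair; last exact: gcont_snd.
  by apply: gcont_comp; [exact: continuous_clamp|exact: gcont_fst].
by move=> z; split => //=; rewrite in_itv/= clamp_itv.
Qed.

Lemma mv_density T W phi rho t : 0 < T -> mv_solution T W phi rho -> prob_density (ext T rho t).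
Proof.
by move=> T0 [dens _ _ _ _]; apply: dens; rewrite in_itv/= clamp_itv// ltW.
Qed.

Lemma mv_init T W phi rho k th : 0 < T -> prob_density phi -> mv_solution T W phi rho ->
  fc (ext T rho 0) k th = fc phi k th.
Proof.
move=> T0 [_ mphi _ _] mv; have [_ m0 _ _] := mv_density 0 T0 mv.
apply: ae_eq_fc => //; rewrite ext_id ?lexx ?ltW//.
by case: mv.
Qed.

Lemma open_inner T : open (`]0%R, T[%classic `*` setT : set (R * E)).
Proof.
rewrite (_ : _ `*` _ = fst @^-1` `]0%R, T[%classic); last first.
  by apply/seteqP; split => [z []|z zT] //; split.
apply: open_comp; last exact: interval_open.
by move=> z _; exact: cvg_fst.
Qed.

Lemma inner_cvg T (F : R -> E -> R) t x :
  {within (`]0%R, T[%classic `*` setT : set (R * E)), continuous (fun z : R * E => F z.1 z.2)} ->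
  0 < t < T -> F z.1 z.2 @[z --> (t, x)] --> F t x.
Proof.
rewrite continuous_open_subspace; last exact: open_inner.
by move=> cF tT; apply: (cF (t, x)); rewrite inE/=; split => //=; rewrite in_itv.
Qed.

(** The derivative is first put on f; W convolved with the partial derivative of f and D i convolved
    with f are then identified through their Fourier coefficients. The second clause makes the flux
    differentiable. *)
Lemma conv_deriv W M D i f : cper W -> deriv_of W M D -> C1 i f ->
  partial i (torus_conv W f) = tconv (D i) f /\
  (C1 i (partial i f) -> C1 i (tconv (D i) f)).
Proof.
move=> cW dD Cf; have [cf _ _] := Cf.
have [bD pD _ fcD] := dD i; have Di := mbounded_tintegrable bD.
have iW := cper_tintegrable cW.
have -> : torus_conv W f = tconv W f.
  apply/funext => x; rewrite torus_convE//; first exact: cper_measurable.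
  by case: cW.
have [CWf pE] := conv_partial iW Cf.
have cpf := C1_partial_cper Cf.
have E1 : tconv W (partial i f) = tconv (D i) f.
  apply: fourier_inj; [exact: tconv_cper|exact: tconv_cper|] => k th.
  have -> : tconv W (partial i f) = partial i (tconv W f) by rewrite pE.
  rewrite fc_partial// !tconv_fc// !fcD addrK subrK; ring.
split; first exact: etrans pE E1.
by move=> Cpf; rewrite -E1; have [] := conv_partial iW Cpf.
Qed.

Lemma mv_flux T W M phi rho D : 0 < T -> cper W -> deriv_of W M D ->
  mv_solution T W phi rho ->
  fourier_flux T (ext T rho) (fun i t x => ext T rho t x * tconv (D i) (ext T rho t) x).
Proof.
move=> T0 cW dD mv k th t tT.
have ce := mv_cper2 T0 mv.
have [dens _ _ [der ct cx cxx] pde] := mv.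
have io s : 0 < s < T -> s \in `]0%R, T[ by rewrite in_itv.
have le s : 0 < s < T -> 0 <= s <= T by move=> /andP[? ?]; rewrite !ltW.
have eE s : 0 < s < T -> ext T rho s = rho s by move=> sT; rewrite ext_id ?le.
have cr s : 0 < s < T -> cper (rho s) by move=> sT; rewrite -eE//; exact: cper2_cper.
have tio := io t tT.
have Cr i : C1 i (rho t).
  split; [exact: cr|by move=> x; have [_ /(_ i i)[]] := der t x tio|].
  by refine (@tube_slice R d R (fun s => partial i (rho s)) t _) => x;
    exact: (@inner_cvg T (fun s => partial i (rho s)) t x (cx i) tT).
have Cpr i : C1 i (partial i (rho t)).
  split; [exact: C1_partial_cper|by move=> x; have [_ /(_ i i)[]] := der t x tio|].
  refine (@tube_slice R d R (fun s => partial i (partial i (rho s))) t _) => x.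
  exact: (@inner_cvg T (fun s => partial i (partial i (rho s))) t x (cxx i i) tT).
pose F' s x := derive1 (fun u => rho u x) s.
(* The solution is tested against [tr k th] at an interior time, where the time derivative is
   jointly continuous. *)
have D1 : is_derive t 1 (fun s => \int[mu]_x (tr k th x * rho s x)) (\int[mu]_x (tr k th x * F' t x)).
  apply: (is_derive_tintegral tio) => //.
  - exact/mbounded_tintegrable/mbounded_tr.
  - by move=> s sT; apply: cper_mbounded; apply: cr; rewrite in_itv/= in sT.
  - move=> s x sT; have [ds _] := der s x sT.
    by rewrite /F' derive1E; exact/derivableP.
  (* The solution is periodic at all neighbouring times, and the time derivative inherits this. *)
  - move=> s sT x j; rewrite /F' !derive1E; apply: near_eq_derive.
    apply: filterS (near_in_itvoo sT) => r rT.
    have [pr _ _ _] := dens r (subset_itv_oo_cc rT).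
    exact: pr.
  - by move=> x; exact: (@inner_cvg T F' t x ct tT).
have D2 : is_derive t 1 (fun s => fc (ext T rho s) k th) (\int[mu]_x (tr k th x * F' t x)).
  apply: near_eq_is_derive D1; apply: filterS (near_in_itvoo tio) => s sT.
  rewrite eE; last by move: sT; rewrite /= in_itv.
  by apply: eq_Rintegral => x _; rewrite mulrC.
apply: is_derive_eq.
have bE i : partial i (torus_conv W (rho t)) = tconv (D i) (rho t).
  by have [] := conv_deriv cW dD (Cr i).
have Cb i : C1 i (tconv (D i) (rho t)).
  by have [_ h] := conv_deriv cW dD (Cr i); exact: h.
have CG i : C1 i (fun y => rho t y * tconv (D i) (rho t) y).
  by have [] := C1M (Cr i) (Cb i).
pose A i := partial i (partial i (rho t)).
pose B i := partial i (fun y => rho t y * tconv (D i) (rho t) y).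
have iA i : tintegrable (A i) by exact/cper_tintegrable/C1_partial_cper.
have iB i : tintegrable (B i) by exact/cper_tintegrable/C1_partial_cper.
transitivity (fc (fun x => \sum_(i < d) A i x + \sum_(i < d) B i x) k th).
  apply: eq_Rintegral => x _; rewrite mulrC; congr (_ * _).
  rewrite /F' pde//; congr (_ + _); apply: eq_bigr => i _.
  by rewrite bE.
rewrite fcD ?fc_sum//; [|exact: tintegrable_sum|exact: tintegrable_sum].
rewrite eE// /lamk mulNr mulr_suml -sumrN; congr (_ + _).
  (* Two integrations by parts add pi to the phase, which changes the sign: this gives the factor -
     kap_i^2. *)
  apply: eq_bigr => i _; rewrite (fc_partial _ _ (Cpr i)) (fc_partial _ _ (Cr i)).
  have := fc_phase k (th + pi / 2 + pi / 2) (cper_tintegrable (cr t tT)).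
  have := fc_phase k th (cper_tintegrable (cr t tT)).
  rewrite -addrA -splitr cosDpi sinDpi => -> ->; ring.
by rewrite -sumrN; apply: eq_bigr => i _; rewrite fc_partial.
Qed.

End mv_fourier.

(** * Regularity and stability *)

Section mv_estimates.
Context {R : realType} {d : nat}.
Local Notation E := 'rV[R]_d.
Local Notation Z := 'rV[int]_d.
Local Notation mu := (@torus R d).
Implicit Types (u v w : R -> E -> R) (D : 'I_d -> E -> R) (T M : R).

Definition drift u D (i : 'I_d) t x : R := u t x * tconv (D i) (u t) x.

Definition bounded_field M D :=
  forall i, [/\ mbounded (D i), Zperiodic (D i) & forall x, `|D i x| <= M].

(* All that the estimates use of a solution u whose potential has gradient D. *)
Definition mv_flow T M u D := [/\ cper2 u,
  forall t, (forall x, 0 <= u t x) /\ \int[mu]_x u t x = 1,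
  bounded_field M D & fourier_flux T u (drift u D)].

Lemma bounded_field_tintegrable M D i : bounded_field M D -> tintegrable (D i).
Proof. by move=> /(_ i)[/mbounded_tintegrable]. Qed.

Lemma cper2_drift M u D i : cper2 u -> bounded_field M D -> cper2 (drift u D i).
Proof.
move=> cu bD; apply: cper2M => //; apply: cper2_tconv => //.
exact: bounded_field_tintegrable bD.
Qed.

(** [u t] is nonnegative with mass one, so averaging D i against it keeps the bound M. *)
Lemma drift_bound T M u D i t x : mv_flow T M u D -> `|tconv (D i) (u t) x| <= M.
Proof.
move=> [cu pu bD _]; have [mD pD DM] := bD i.
have cut := cper2_cper t cu; have cr := cper_reflect x cut.
rewrite /tconv; under eq_Rintegral do rewrite mulrC.
apply: le_trans (tintegral_norm_le (cper_tintegrable cr) mD DM) _.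
have -> : \int[mu]_y `|u t (x - y)| = 1; last by rewrite mulr1.
have [u0 <-] := pu t.
rewrite -(tintegral_reflect x (cper_measurable cut) (proj2 cut)).
by apply: eq_Rintegral => y _; rewrite ger0_norm.
Qed.

Lemma sqnorm_mul_le (f g : E -> R) (C : R) : mbounded f -> mbounded g -> (forall x, `|f x| <= C) ->
  \int[mu]_x (f x * g x) ^+ 2 <= C ^+ 2 * \int[mu]_x g x ^+ 2.
Proof.
move=> bf bg fC; rewrite -RintegralZl//; last exact/mbounded_tintegrable/mboundedX.
apply: le_Rintegral => //.
- exact/mbounded_tintegrable/mboundedX/mboundedM.
- exact/mbounded_tintegrable/mboundedZ/mboundedX.
move=> x _; rewrite exprMn ler_wpM2r ?sqr_ge0//.
by rewrite -real_normK ?num_real// lerXn2r ?nnegrE// (le_trans (normr_ge0 _) (fC x)).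
Qed.

(** Bessel's inequality; square-summability is what [bootstrap_sum] asks of the field. *)
Lemma field_fourier_sq M D : bounded_field M D -> forall i,
  bsum (fun k => famp (D i) k ^+ 2) (M ^+ 2).
Proof.
move=> bD i s us; have [mD _ DM] := bD i.
under eq_bigr do rewrite famp_sq.
apply: (le_trans (bessel mD us)).
apply: tintegral_le_cst; first exact/mbounded_tintegrable/mboundedX.
move=> x; rewrite -real_normK ?num_real// lerXn2r ?nnegrE//.
exact: le_trans (normr_ge0 _) (DM x).
Qed.

(** On the Fourier side, convolution with D i multiplies |f^(k)|^2 by |D_i^(k)|^2 <= M^2. *)
Lemma sqnorm_tconv_le M D i (f : E -> R) : bounded_field M D -> cper f ->
  \int[mu]_x tconv (D i) f x ^+ 2 <= M ^+ 2 * \int[mu]_x f x ^+ 2.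
Proof.
move=> bD cf; have Di := bounded_field_tintegrable i bD.
apply: parseval_le; first exact: tconv_cper.
move=> s us; apply: (@le_trans _ _ (\sum_(k <- s) M ^+ 2 * fourier_sq f k)).
  apply: ler_sum => k _; rewrite tconv_fourier_sq// ler_wpM2r ?fourier_sq_ge0//.
  by have := bsum1 k (field_fourier_sq bD i); rewrite famp_sq.
by rewrite -mulr_sumr ler_wpM2l ?sqr_ge0// bessel//; exact: cper_mbounded.
Qed.

Section regularity.
Variables (T M : R) (u : R -> E -> R) (D : 'I_d -> E -> R).
Hypotheses (T0 : 0 < T) (fl : mv_flow T M u D).

Let e k t := fourier_sq (u t) k.
Let N k t := \sum_(i < d) fourier_sq (drift u D i t) k.
Let y t := \int[mu]_x u t x ^+ 2.
Let A := d%:R * M ^+ 2.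

Let cu : cper2 u. Proof. by case: fl. Qed.
Let bD : bounded_field M D. Proof. by case: fl. Qed.
Let fu : fourier_flux T u (drift u D). Proof. by case: fl. Qed.
Let cG i : cper2 (drift u D i). Proof. exact: cper2_drift cu bD. Qed.
Let cy : continuous y. Proof. exact: continuous_sqnorm. Qed.
Let A0 : 0 <= A. Proof. by rewrite mulr_ge0 ?sqr_ge0. Qed.
Let cN k : continuous (N k). Proof. exact: continuous_flux_energy. Qed.
Let ce k : continuous (e k). Proof. exact: continuous_fourier_sq. Qed.

Let drift_sqnorm s : \sum_(i < d) \int[mu]_x drift u D i s x ^+ 2 <= A * y s.
Proof.
rewrite /A -mulrA -[d in d%:R]card_ord mulr_natl -sumr_const; apply: ler_sum => i _.
rewrite /drift; under eq_Rintegral do rewrite mulrC.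
apply: sqnorm_mul_le => [||x].
- exact/cper_mbounded/tconv_cper/cper2_cper/cu/(bounded_field_tintegrable i bD).
- exact/cper_mbounded/cper2_cper.
- exact: drift_bound fl.
Qed.

Let N_le s t : uniq s -> \sum_(k <- s) N k t <= A * y t.
Proof.
move=> us; apply: le_trans (drift_sqnorm t); rewrite /N exchange_big/=.
by apply: ler_sum => i _; exact: bessel (cper_mbounded (cper2_cper t (cG i))) us.
Qed.

Lemma flow_sqnorm t : 0 <= t <= T -> y t <= expR (A * T) * y 0.
Proof.
move=> tT; have /andP[t0 tT'] := tT.
have := @gronwall _ y (fun=> 0) A (y 0) T T0 A0 cy (@gcont_cst _ _ 0).
move=> /(_ (fun _ _ => lexx 0)) H.
apply: (le_trans (H _ t tT)).
  move=> r rT; apply: le_trans (flux_sqnorm T0 cu cG fu rT) _; rewrite lerD2l.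
  apply: prim_le => [||s _].
  - by apply: gcont_sum => i _; exact: continuous_sqnorm.
  - apply: gcontD; last exact: gcont_cst.
    by apply: gcontM => //; exact: gcont_cst.
  - by rewrite addr0.
rewrite prim_cst// mul0r addr0 ler_wpM2r; first by [].
  by apply: Rintegral_ge0 => x _; exact: sqr_ge0.
by rewrite ler_expR ler_wpM2l.
Qed.

(** The majorant takes the whole source \int_0^T N_k, so that the supremum over t sits inside the
    sum over k; the sources add up to at most A \int y, which [flow_sqnorm] bounds. *)
Lemma regularity0 (Phi : R) : bsum (fun k => e k 0) Phi ->
  exists al : Z -> R, [/\ forall k, 0 <= al k,
    forall k t, 0 <= t <= T -> famp (u t) k <= al k &
    bsum (fun k => qk k ^+ 0 * al k ^+ 2) (Phi + A * (expR (A * T) * Phi) * T)].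
Proof.
move=> hPhi.
have TT : 0 <= T <= T by rewrite lexx ltW.
have pN0 k : 0 <= prim (N k) T.
  by apply: prim_ge0 => s _; apply: sumr_ge0 => i _; exact: fourier_sq_ge0.
have e0 k : 0 <= e k 0 + prim (N k) T by rewrite addr_ge0 ?fourier_sq_ge0.
exists (fun k => Num.sqrt (e k 0 + prim (N k) T)); split => [k|k t tT|].
- exact: sqrtr_ge0.
- rewrite ler_wsqrtr//.
  apply: (@le_trans _ _ (e k t + lamk k * prim (e k) t)).
    by rewrite lerDl mulr_ge0 ?lamk_ge0// prim_fourier_ge0.
  apply: le_trans (flux_dissipation T0 cu cG fu k tT) _.
  rewrite lerD2l; apply: prim_mono => //; first exact: cN.
  by move=> s _; apply: sumr_ge0 => i _; exact: fourier_sq_ge0.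
move=> s us; under eq_bigr do rewrite expr0 mul1r sqr_sqrtr//.
rewrite big_split/=; apply: lerD; first exact: hPhi.
rewrite -prim_sum//.
have y0 : y 0 <= Phi by apply: parseval_le => //; exact: cper2_cper.
rewrite -(prim_cst _ (ltW T0)); apply: prim_le.
- exact: gcont_sum.
- exact: gcont_cst.
move=> t tT; apply: le_trans (N_le t us) _; rewrite ler_wpM2l//.
by apply: le_trans (flow_sqnorm tT) _; rewrite ler_pM2l ?expR_gt0.
Qed.

(** The term a bounds the energies; the rest bounds the d flux components, with the 8 of
    [fourier_sqM_le] and the constant of [bootstrap_sum] for M2 = M^2. *)
Definition regC (s : nat) (a : R) : R := a + d%:R * (8 * ((2 ^+ s * (M ^+ 2 + a)) ^+ 2 * a)).

(** Both occurrences of u^ in the drift are replaced by the majorant al, so that be is constant in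
    time, as [dissipation_sup] demands. *)
Lemma regularity_drift (s : nat) (al : Z -> R) (a : R) : (forall k, 0 <= al k) ->
  (forall k t, 0 <= t <= T -> famp (u t) k <= al k) ->
  bsum (fun k => qk k ^+ s * al k ^+ 2) a ->
  exists be : Z -> R, [/\ forall k, 0 <= be k,
    forall k t, 0 <= t <= T -> e k t + N k t <= be k &
    bsum (fun k => qk k ^+ s * be k) (regC s a)].
Proof.
move=> al0 ual ha.
have /boolp.choice[c hc] i : exists c : Z -> R,
    (forall k, bsum (fun l => famp (D i) l * al l * al (k - l)) (c k)) /\
    bsum (fun k => qk k ^+ s * c k ^+ 2) ((2 ^+ s * (M ^+ 2 + a)) ^+ 2 * a).
  have [c h1 h2] := bootstrap_sum (famp_ge0 (D i)) al0 ha (field_fourier_sq bD i).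
  by exists c.
exists (fun k => al k ^+ 2 + \sum_(i < d) 8 * c i k ^+ 2); split => [k|k t tT|].
- rewrite addr_ge0 ?sqr_ge0// sumr_ge0// => i _.
  by apply: mulr_ge0 => //; exact: sqr_ge0.
- apply: lerD.
    by rewrite /e -famp_sq lerXn2r ?nnegrE ?famp_ge0// ual.
  apply: ler_sum => i _; have cut := cper2_cper t cu.
  have Di := bounded_field_tintegrable i bD.
  apply: fourier_sqM_le => //; first exact: tconv_cper.
  move=> r ur; apply: le_trans ((hc i).1 k r ur); apply: ler_sum => l _.
  have -> : famp (tconv (D i) (u t)) l = famp (D i) l * famp (u t) l.
    by rewrite /famp tconv_fourier_sq// sqrtrM ?fourier_sq_ge0.
  rewrite -!mulrA ler_wpM2l ?famp_ge0// ler_pM ?famp_ge0//; exact: ual.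
apply: (@bsum_le _ _ _ (fun k => qk k ^+ s * al k ^+ 2 + \sum_(i < d) 8 * (qk k ^+ s * c i k ^+ 2))).
  by move=> k; rewrite mulrDr mulr_sumr; under [X in _ + X <= _]eq_bigr do rewrite mulrCA.
apply: bsumD => //; rewrite -[X in X%:R * _]card_ord; apply: bsum_sum => i.
by apply: bsumZ => //; case: (hc i).
Qed.

(** Since lam_k = qk k - 1, the energy inequality reads e' <= - qk e + (e + N): moving one e to the
    source avoids the vanishing rate at k = 0. This is why be bounds e + N. *)
Lemma regularity_gain (be : Z -> R) : (forall k, 0 <= be k) ->
  (forall k t, 0 <= t <= T -> e k t + N k t <= be k) ->
  (forall k t, 0 <= t <= T -> e k t <= e k 0 + be k / qk k) /\
  (forall k, qk k * prim (e k) T <= e k 0 + be k * T).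
Proof.
move=> be0 hbe; split => [k t tT|k].
  have [e' [De He]] := flux_energy cG fu k.
  apply: (dissipation_sup T0 (qk_gt0 k) (be0 k) (@ce k) _ De _ tT); first exact: fourier_sq_ge0.
  move=> s sT; apply: le_trans (He s sT) _.
  have sT' : 0 <= s <= T by case/andP: sT => ? ?; rewrite !ltW.
  have := hbe k s sT'; rewrite /qk -/(e k s) -/(N k s); lra.
have TT : 0 <= T <= T by rewrite lexx ltW.
have := flux_dissipation T0 cu cG fu k TT; rewrite -/(e k) -/(N k) => H.
have pe : prim (fun t => e k t + N k t) T <= be k * T.
  rewrite -(prim_cst _ (ltW T0)); apply: prim_le; [exact: gcontD|exact: gcont_cst|exact: hbe].
rewrite primD// in pe.
have : 0 <= fourier_sq (u T) k by exact: fourier_sq_ge0.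
rewrite /qk mulrDl mul1r {3}/e; lra.
Qed.

(* Bound on sum_k (1 + lam_k)^s sup_t |u^(t, k)|^2, where Phi bounds the H^s norms of u 0. *)
Fixpoint regA (Phi : R) (s : nat) : R :=
  if s is s'.+1 then Phi + regC s' (regA Phi s')
  else Phi + A * (expR (A * T) * Phi) * T.

Lemma qk_exp_le (k : Z) (s s' : nat) : (s <= s')%N -> qk k ^+ s <= qk k ^+ s' :> R.
Proof. by move=> ss; rewrite ler_weXn2l ?qk_ge1. Qed.

Lemma bsum_exp_le (deg s : nat) (m : Z -> R) (Phi : R) : (forall k, 0 <= m k) -> (s <= deg)%N ->
  bsum (fun k => qk k ^+ deg * m k) Phi -> bsum (fun k => qk k ^+ s * m k) Phi.
Proof. by move=> m0 sd; apply: bsum_le => k; rewrite ler_wpM2r// qk_exp_le. Qed.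

(** Induction on s: the gain divides be by [qk], so the weight qk^s on be becomes qk^(s + 1) on
    al^2, as long as the initial data afford it. *)
Lemma regularity (deg : nat) (Phi : R) (s : nat) : (s <= deg)%N ->
  bsum (fun k => qk k ^+ deg * e k 0) Phi ->
  exists al : Z -> R, [/\ forall k, 0 <= al k,
    forall k t, 0 <= t <= T -> famp (u t) k <= al k &
    bsum (fun k => qk k ^+ s * al k ^+ 2) (regA Phi s)].
Proof.
move=> sd hPhi; have e0 k t : 0 <= e k t by exact: fourier_sq_ge0.
elim: s sd => [|s ih] sd.
  apply: regularity0; apply: bsum_le (bsum_exp_le (fun k => e0 k 0) sd hPhi) => k.
  by rewrite expr0 mul1r.
have [al [al0 ual ha]] := ih (ltnW sd).
have [be [be0 hbe hB]] := regularity_drift al0 ual ha.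
have [sup _] := regularity_gain be0 hbe.
have q0 (k : Z) : 0 < qk k :> R := qk_gt0 k.
have h0 k : 0 <= e k 0 + be k / qk k by rewrite addr_ge0// divr_ge0// ltW.
exists (fun k => Num.sqrt (e k 0 + be k / qk k)); split => [k|k t tT|].
- exact: sqrtr_ge0.
- by rewrite ler_wsqrtr// sup.
apply: (@bsum_le _ _ _ (fun k => qk k ^+ s.+1 * e k 0 + qk k ^+ s * be k)).
  move=> k; rewrite sqr_sqrtr// mulrDr lerD2l exprSr -mulrA.
  by rewrite [qk k * (_ / _)]mulrC divfK// gt_eqF.
apply: bsumD => //; exact: bsum_exp_le hPhi.
Qed.

(** 2 al <= qk^d al^2 + qk^(- d): the first term sums to at most [regA Phi d], the second to at most
    6^d by [bsum_qk_inv]. *)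
Lemma flow_sup (Phi : R) t x : 0 <= t <= T ->
  bsum (fun k => qk k ^+ d * e k 0) Phi -> `|u t x| <= (regA Phi d + 6 ^+ d) / 2.
Proof.
move=> tT hPhi; have [al [al0 ual ha]] := regularity (leqnn d) hPhi.
apply: fourier_sup; first exact: cper2_cper.
move=> s us; rewrite mulrC; apply: le_trans (bsumZ _ (bsumD ha bsum_qk_inv) us); last by rewrite invr_ge0.
apply: ler_sum => k _; apply: le_trans (ual k t tT) _.
have q0 : 0 < qk k ^+ d :> R by rewrite exprn_gt0// qk_gt0.
rewrite ler_pdivlMl//.
have := sqr_ge0 (qk k ^+ d * al k - 1); rewrite sqrrB mulr1 expr1n => h.
have : 0 <= (qk k ^+ d)^-1 * ((qk k ^+ d * al k) ^+ 2 - qk k ^+ d * al k *+ 2 + 1).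
  by rewrite mulr_ge0// invr_ge0 ltW.
have -> : (qk k ^+ d)^-1 * ((qk k ^+ d * al k) ^+ 2 - qk k ^+ d * al k *+ 2 + 1) =
    qk k ^+ d * al k ^+ 2 + (qk k ^+ d)^-1 - 2 * al k.
  by field; rewrite gt_eqF.
lra.
Qed.

(** The dissipation integrated over [0, T] carries one more power of [qk] than the initial data. *)
Lemma flow_parabolic_gain (deg : nat) (Phi : R) :
  bsum (fun k => qk k ^+ deg * e k 0) Phi ->
  bsum (fun k => qk k ^+ deg.+1 * prim (e k) T) (Phi + T * regC deg (regA Phi deg)).
Proof.
move=> hPhi; have [al [al0 ual ha]] := regularity (leqnn deg) hPhi.
have [be [be0 hbe hB]] := regularity_drift al0 ual ha.
have [_ gain] := regularity_gain be0 hbe.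
apply: bsum_le (bsumD hPhi (bsumZ (ltW T0) hB)) => k.
rewrite exprSr -mulrA [T * _]mulrCA -mulrDr ler_wpM2l ?exprn_ge0 ?(ltW (qk_gt0 _))//.
by rewrite [T * _]mulrC gain.
Qed.

End regularity.

Section stability.
Variables (T M K : R) (u1 u2 : R -> E -> R) (D1 D2 : 'I_d -> E -> R).
Hypotheses (T0 : 0 < T) (fl1 : mv_flow T M u1 D1) (fl2 : mv_flow T M u2 D2).
Hypothesis u2K : forall t x, 0 <= t <= T -> `|u2 t x| <= K.
Hypothesis init : forall k th, fc (u1 0) k th = fc (u2 0) k th.

(* D (W1 - W2) * rho2 *)
Definition drift_gap i t x : R := tconv (D1 i) (u2 t) x - tconv (D2 i) (u2 t) x.

Let w t x := u1 t x - u2 t x.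
Let y t := \int[mu]_x w t x ^+ 2.
Let F t := \sum_(i < d) \int[mu]_x drift_gap i t x ^+ 2.
(** The 3 comes from (a + b + c)^2 <= 3 (a^2 + b^2 + c^2) for the three parts of the flux of w; the
    part with [drift_gap] is the source and stays out of the rate. *)
Let A := d%:R * (3 * (M ^+ 2 + K ^+ 2 * M ^+ 2)).

Lemma stability t : 0 <= t <= T ->
  y t <= expR (A * T) * (3 * K ^+ 2 * prim F T).
Proof.
have [cu1 pu1 bD1 fu1] := fl1; have [cu2 pu2 bD2 fu2] := fl2.
have cw : cper2 w by exact: cper2B.
have cG1 i : cper2 (drift u1 D1 i) by exact: cper2_drift cu1 bD1.
have cG2 i : cper2 (drift u2 D2 i) by exact: cper2_drift cu2 bD2.
have cgap i : cper2 (drift_gap i).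
  by apply: cper2B; apply: cper2_tconv => //; [exact: bounded_field_tintegrable bD1|exact: bounded_field_tintegrable bD2].
have cy : continuous y by exact: continuous_sqnorm.
have cF : continuous F by apply: gcont_sum => i _; exact: continuous_sqnorm.
have F0 s : 0 <= F s.
  by apply: sumr_ge0 => i _; apply: Rintegral_ge0 => x _; exact: sqr_ge0.
have y00 : y 0 = 0.
  (* Both initial values are continuous, so equal coefficients force equality everywhere. *)
  have w0 : u1 0 = u2 0 by apply: fourier_inj => //; exact: cper2_cper.
  rewrite /y /w w0; under eq_Rintegral do rewrite subrr expr0n/=.
  exact: tintegral_cst.
have fw := fourier_fluxB cu1 cu2 cG1 cG2 fu1 fu2.
pose G i t x := drift u1 D1 i t x - drift u2 D2 i t x.
have cG i : cper2 (G i) by exact: cper2B.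
have GE s i : 0 <= s <= T -> \int[mu]_x G i s x ^+ 2 <=
    3 * (M ^+ 2 + K ^+ 2 * M ^+ 2) * y s + 3 * K ^+ 2 * \int[mu]_x drift_gap i s x ^+ 2.
  move=> sT; have D1i := bounded_field_tintegrable i bD1.
  (* a is bounded through [drift_bound]; in b and c the factor u2 is bounded by K, and b also uses
     the L^2 bound for convolution with D1 i. *)
  pose a x := tconv (D1 i) (u1 s) x * w s x.
  pose b x := u2 s x * tconv (D1 i) (w s) x.
  pose c x := u2 s x * drift_gap i s x.
  have mw : mbounded (w s) by exact/cper_mbounded/cper2_cper.
  have mu2 : mbounded (u2 s) by exact/cper_mbounded/cper2_cper.
  have mt1 : mbounded (tconv (D1 i) (u1 s)) by exact/cper_mbounded/tconv_cper/cper2_cper.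
  have mtw : mbounded (tconv (D1 i) (w s)) by exact/cper_mbounded/tconv_cper/cper2_cper.
  have mg : mbounded (drift_gap i s) by exact/cper_mbounded/cper2_cper.
  have ma : mbounded a by exact: mboundedM.
  have mb : mbounded b by exact: mboundedM.
  have mc : mbounded c by exact: mboundedM.
  have GabcE x : G i s x = a x + b x + c x.
    have tw : tconv (D1 i) (w s) x = tconv (D1 i) (u1 s) x - tconv (D1 i) (u2 s) x.
      rewrite /tconv /w; under eq_Rintegral do rewrite mulrBr.
      by rewrite RintegralB//; apply: tintegrableM => //; apply: cper_mbounded;
        apply: cper_reflect; exact: cper2_cper.
    by rewrite /a /b /c tw /G /drift /drift_gap /w; ring.
  apply: (@le_trans _ _ (\int[mu]_x (3 * a x ^+ 2 + 3 * b x ^+ 2 + 3 * c x ^+ 2))).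
    apply: le_Rintegral => //.
    - apply/mbounded_tintegrable/mboundedX/cper_mbounded/cper2_cper; exact: cG.
    - apply/mbounded_tintegrable; apply: mboundedD; first apply: mboundedD;
        by apply: mboundedZ; apply: mboundedX.
    move=> x _; rewrite GabcE.
    have := sqr_ge0 (a x - b x); have := sqr_ge0 (b x - c x); have := sqr_ge0 (a x - c x); nra.
  have mX (f : E -> R) : mbounded f -> tintegrable (fun x => 3 * f x ^+ 2).
    by move=> mf; apply/mbounded_tintegrable/mboundedZ/mboundedX.
  have mX1 (f : E -> R) : mbounded f -> tintegrable (fun x => f x ^+ 2).
    by move=> mf; apply/mbounded_tintegrable/mboundedX.
  rewrite RintegralD//; [|by apply: tintegrableD; exact: mX|exact: mX].
  rewrite RintegralD//; [|exact: mX|exact: mX].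
  rewrite !RintegralZl//; [|exact: mX1|exact: mX1|exact: mX1].
  have ia : \int[mu]_x a x ^+ 2 <= M ^+ 2 * y s.
    by apply: sqnorm_mul_le => // x; exact: drift_bound fl1.
  have ib : \int[mu]_x b x ^+ 2 <= K ^+ 2 * (M ^+ 2 * y s).
    apply: le_trans (sqnorm_mul_le mu2 mtw (fun x => u2K x sT)) _.
    rewrite ler_wpM2l ?sqr_ge0//; apply: sqnorm_tconv_le => //; exact: cper2_cper.
  have ic := sqnorm_mul_le mu2 mg (fun x => u2K x sT).
  rewrite -/(c _) in ic; lra.
have A0 : 0 <= A.
  apply: mulr_ge0 => //; apply: mulr_ge0 => //.
  by apply: addr_ge0; [exact: sqr_ge0|apply: mulr_ge0; exact: sqr_ge0].
move=> tT; have /andP[t0 tT'] := tT.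
have H := @gronwall _ y (fun s => 3 * K ^+ 2 * F s) A 0 T T0 A0 cy.
have K0 : 0 <= 3 * K ^+ 2 by rewrite mulr_ge0// sqr_ge0.
apply: (le_trans (H _ _ _ t tT)).
- by apply: gcontM => //; exact: gcont_cst.
- by move=> s _; rewrite mulr_ge0.
- move=> r rT; have /andP[r0 rT'] := rT.
  apply: le_trans (flux_sqnorm T0 cw cG fw rT) _; rewrite -/(y 0) y00 !add0r.
  apply: prim_le => [||s /andP[s0 sr]].
  + by apply: gcont_sum => i _; exact: continuous_sqnorm.
  + by apply: gcontD; apply: gcontM => //; exact: gcont_cst.
  have sT : 0 <= s <= T by rewrite s0 (le_trans sr).
  rewrite /A -mulrA -[X in X%:R * _]card_ord mulr_natl -sumr_const /F mulr_sumr -big_split/=.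
  by apply: ler_sum => i _; exact: GE.
rewrite add0r primZ//; apply: ler_pM.
- exact: expR_ge0.
- by apply: mulr_ge0 => //; apply: prim_ge0.
- by rewrite ler_expR ler_wpM2l.
- by rewrite ler_wpM2l//; apply: prim_mono.
Qed.

End stability.
End mv_estimates.

(** * Sobolev norms *)

Lemma poweR2 (R : realType) (x : \bar R) : (0 <= x -> x `^ 2 = x ^+ 2)%E.
Proof.
case: x => [r| |]//=; first by rewrite lee_fin => r0; rewrite powR_mulrn// EFin_expe.
by rewrite mulyy pnatr_eq0.
Qed.

Lemma Lnorm2_sq (R : realType) (dT : measure_display) (T : measurableType dT)
    (nu : {measure set T -> \bar R}) (f : T -> R) :
  ('N[nu]_2%:E[EFin \o f] ^+ 2 = \int[nu]_x (f x ^+ 2)%:E)%E.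
Proof.
have r0 : (2 : R) != 0 by [].
rewrite -poweR2 ?Lnorm_ge0// poweR_Lnorm//; apply: eq_integral => x _.
by rewrite /= powR_mulrn// real_normK ?num_real.
Qed.

Lemma bsum_esum (R : realType) (K : countType) (m : K -> R) (S : R) : (forall a, 0 <= m a) ->
  bsum m S <-> (\esum_(k in [set: K]) (m k)%:E <= S%:E)%E.
Proof.
move=> m0; split => [h|h s us].
  apply: ub_ereal_sup => _ [X [fX _] <-]; rewrite fsbig_finite//= sumEFin lee_fin.
  exact: h (finmap.fset_uniq _).
rewrite -lee_fin; apply: le_trans h; rewrite -sumEFin fsbig_seq//; apply: esum_ge.
by exists [set` s] => //; split => //; exact: finite_seq.
Qed.

Section sobolev_sums.
Context {R : realType} {d : nat}.
Local Notation E := 'rV[R]_d.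
Local Notation Z := 'rV[int]_d.
Local Notation mu := (@torus R d).
Implicit Types (f g V W : E -> R) (k l : Z) (th : R).

Lemma sobolev_weight k (n : nat) :
  (1 + (2 * pi) ^+ 2 * \sum_(i < d) (k ord0 i)%:~R ^+ 2) `^ n%:R = qk k ^+ n :> R.
Proof.
have -> : 1 + (2 * pi) ^+ 2 * \sum_(i < d) (k ord0 i)%:~R ^+ 2 = qk k :> R.
  by rewrite /qk /lamk mulr_sumr; congr (1 + _); apply: eq_bigr => i _; rewrite [RHS]exprMn.
by rewrite powR_mulrn// ltW// qk_gt0.
Qed.

Lemma sobolev_norm_natE (n : nat) f : sobolev_norm n%:R f =
  sqrte (\esum_(k in [set: Z]) (qk k ^+ n * fourier_sq f k)%:E)%E.
Proof.
rewrite /sobolev_norm ler0n /sobolev_norm_ge0 poweR12_sqrt; last first.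
  by apply: esum_ge0 => k _; rewrite lee_fin mulr_ge0 ?powR_ge0 ?fourier_sq_ge0.
by congr sqrte; apply: eq_esum => k _; rewrite sobolev_weight.
Qed.

Lemma weight_ge0 (n : nat) f k : 0 <= qk k ^+ n * fourier_sq f k.
Proof. by rewrite mulr_ge0 ?fourier_sq_ge0// exprn_ge0// ltW// qk_gt0. Qed.

(** [fine] sends +oo to 0, so the finiteness of the norm is what makes its square a bound. *)
Lemma sobolev_norm_bsum (n : nat) f : (sobolev_norm n%:R f < +oo)%E ->
  bsum (fun k => qk k ^+ n * fourier_sq f k) (fine (sobolev_norm n%:R f) ^+ 2).
Proof.
rewrite sobolev_norm_natE => h; apply/bsum_esum; first exact: weight_ge0.
have : (0 <= \esum_(k in [set: Z]) (qk k ^+ n * fourier_sq f k)%:E)%E.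
  by apply: esum_ge0 => k _; rewrite lee_fin weight_ge0.
move: h; case: (\esum_(_ in _) _)%E => //= r _; rewrite lee_fin => r0.
by rewrite sqr_sqrtr.
Qed.

Lemma sobolev_norm_le1 (n : nat) f : bsum (fun k => qk k ^+ n * fourier_sq f k) 1 ->
  (sobolev_norm_ge0 n%:R f <= 1)%E.
Proof.
move=> /bsum_esum h; have -> : sobolev_norm_ge0 n%:R f = sobolev_norm n%:R f.
  by rewrite /sobolev_norm ler0n.
rewrite sobolev_norm_natE; have {h} := h (weight_ge0 n f).
have : (0 <= \esum_(k in [set: Z]) (qk k ^+ n * fourier_sq f k)%:E)%E.
  by apply: esum_ge0 => k _; rewrite lee_fin weight_ge0.
case: (\esum_(_ in _) _)%E => //= r; rewrite !lee_fin => r0 r1.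
by rewrite -sqrtr1 ler_wsqrtr.
Qed.

Lemma sobolev_norm_lty (m n : nat) f : (m <= n)%N ->
  (sobolev_norm n%:R f < +oo)%E -> (sobolev_norm m%:R f < +oo)%E.
Proof.
move=> mn /sobolev_norm_bsum/(bsum_exp_le (fourier_sq_ge0 f) mn)/(bsum_esum _ (weight_ge0 m f)).
rewrite [sobolev_norm m%:R f]sobolev_norm_natE.
by case: (\esum_(_ in _) _)%E => //= r; rewrite ltry.
Qed.

Lemma Lnorm2_sq_cper f : cper f ->
  ('N[mu]_2%:E[EFin \o f] ^+ 2 = (\int[mu]_x f x ^+ 2)%:E)%E.
Proof.
move=> cf; rewrite Lnorm2_sq /Rintegral fineK//.
apply: integrable_fin_num => //; exact/mbounded_tintegrable/mboundedX/cper_mbounded.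
Qed.

Lemma weak_derivB i V W g h : tintegrable V -> tintegrable W ->
  is_weak_deriv [:: i] V g -> is_weak_deriv [:: i] W h ->
  is_weak_deriv [:: i] (fun x => V x - W x) (fun x => g x - h x).
Proof.
move=> iV iW [pg mg ig hg] [ph mh ih hh]; split.
- by move=> x k; rewrite pg ph.
- exact: measurable_funB.
- exact: (tintegrableB ig ih).
move=> psi tpsi.
have [ppsi cpsi] := tpsi.
have b0 : mbounded psi by apply: cper_mbounded; split => //; have [] := cpsi 0%N.
have b1 : mbounded (partial i psi).
  apply: cper_mbounded; split; last exact: Zperiodic_partial.
  by have [_ /(_ i)[_ []]] := cpsi 1%N.
under eq_Rintegral do rewrite mulrBl.
rewrite RintegralB//; [|exact: tintegrableM|exact: tintegrableM].
rewrite hg// hh// -mulrBr -RintegralB//; [|exact: tintegrableM|exact: tintegrableM].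
by congr (_ * _); apply: eq_Rintegral => x _; rewrite mulrBl.
Qed.

Lemma weak_deriv_subP i V W : in_W2inf V -> in_W2inf W ->
  is_weak_deriv [:: i] (fun x => V x - W x) (weak_deriv [:: i] (fun x => V x - W x)).
Proof.
move=> V2 W2; apply: (xgetPex (cst 0)).
have cV : cper V by case: V2.
have cW : cper W by case: W2.
by exists (fun x => weak_deriv [:: i] V x - weak_deriv [:: i] W x); apply: weak_derivB;
  [exact: cper_tintegrable|exact: cper_tintegrable|exact: W2inf_weak_deriv|exact: W2inf_weak_deriv].
Qed.

(** The version picked by [weak_deriv] and the truncated fields have matching Fourier coefficients,
    hence the same convolution with a continuous function. *)
Lemma weak_gradient_gap i V W M D1 D2 (u : R -> E -> R) t :
  in_W2inf V -> in_W2inf W -> deriv_of V M D1 -> deriv_of W M D2 -> cper2 u ->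
  torus_conv (weak_deriv [:: i] (fun x => V x - W x)) (u t) = drift_gap u D1 D2 i t.
Proof.
move=> V2 W2 dV dW cu; have cut := cper2_cper t cu.
have cV : cper V by case: V2.
have cW : cper W by case: W2.
have wd := weak_deriv_subP i V2 W2.
have [pg mg gi _] := wd.
have [mD1 _ _ fD1] := dV i; have [mD2 _ _ fD2] := dW i.
have iD1 := mbounded_tintegrable mD1; have iD2 := mbounded_tintegrable mD2.
have iV := cper_tintegrable cV; have iW := cper_tintegrable cW.
have fg k th : fc (weak_deriv [:: i] (fun x => V x - W x)) k th = fc (D1 i) k th - fc (D2 i) k th.
  rewrite (weak_deriv_fc _ _ (tintegrableB iV iW) wd) fcB// fD1 fD2; ring.
have -> : torus_conv (weak_deriv [:: i] (fun x => V x - W x)) (u t) =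
    tconv (weak_deriv [:: i] (fun x => V x - W x)) (u t).
  by apply/funext => x; rewrite torus_convE.
apply: fourier_inj; [exact: tconv_cper|by apply: cperB; exact: tconv_cper|] => k th.
rewrite fcB; [|exact/cper_tintegrable/tconv_cper|exact/cper_tintegrable/tconv_cper].
by rewrite !tconv_fc// !fg; ring.
Qed.

Lemma drift_gap_fourier_sq i V W M D1 D2 (u : R -> E -> R) t k :
  cper V -> cper W -> deriv_of V M D1 -> deriv_of W M D2 -> cper2 u ->
  fourier_sq (drift_gap u D1 D2 i t) k =
    kap k i ^+ 2 * fourier_sq (fun x => V x - W x) k * fourier_sq (u t) k.
Proof.
move=> cV cW dV dW cu; have cut := cper2_cper t cu.
have [mD1 _ _ fD1] := dV i; have [mD2 _ _ fD2] := dW i.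
have iD1 := mbounded_tintegrable mD1; have iD2 := mbounded_tintegrable mD2.
have iD := tintegrableB iD1 iD2.
have cVW := cper_tintegrable (cperB cV cW).
have -> : drift_gap u D1 D2 i t = tconv (fun x => D1 i x - D2 i x) (u t).
  apply/funext => x; rewrite /drift_gap /tconv -RintegralB//.
  - by apply: eq_Rintegral => y _; rewrite mulrBl.
  - exact/(tintegrableM iD1)/cper_mbounded/cper_reflect.
  - exact/(tintegrableM iD2)/cper_mbounded/cper_reflect.
rewrite tconv_fourier_sq//; congr (_ * _).
have fD th : fc (fun x => D1 i x - D2 i x) k th = - (kap k i * fc (fun x => V x - W x) k (th + pi / 2)).
  by rewrite !fcB ?fD1 ?fD2; [ring|exact: cper_tintegrable|exact: cper_tintegrable|done|done].
rewrite !fourier_sqE !coscE !sincE !fD add0r addNr [fc _ k (pi / 2)]fc_phase// cos_pihalf sin_pihalf.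
by rewrite sincE; ring.
Qed.

Lemma mv_mv_flow T W M phi rho D : 0 < T -> cper W -> deriv_of W M D ->
  mv_solution T W phi rho -> mv_flow T M (ext T rho) D.
Proof.
move=> T0 cW dW mv; split.
- exact: mv_cper2 mv.
- move=> t; have [_ _ r0 r1] := mv_density t T0 mv; split => //.
  by rewrite /Rintegral r1.
- by move=> i; have [] := dW i.
- exact: mv_flux mv.
Qed.

Lemma qkN k : qk (- k) = qk k :> R.
Proof. by rewrite /qk /lamk; congr (1 + _); apply: eq_bigr => i _; rewrite /kap mxE intrN mulrN sqrrN. Qed.

(* The frequencies of [tr k th] are k and -k, which have the same weight. *)
Lemma fourier_sq_tr_weight k th l (n : nat) :
  qk l ^+ n * fourier_sq (tr k th : E -> R) l = qk k ^+ n * fourier_sq (tr k th : E -> R) l.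
Proof.
have [<-//|kl] := eqVneq k l.
have [kl0|kl0] := eqVneq (k + l) 0.
  by rewrite -(subr0 l) -kl0 opprD addrCA subrr addr0 qkN.
have f0 et : fc (tr k th : E -> R) l et = 0.
  by rewrite /fc tintegral_tr_mul (negbTE kl) (negbTE kl0) !mul0r addr0 mul0r.
by rewrite fourier_sqE coscE sincE !f0 expr0n/= addr0 !mulr0.
Qed.

Lemma fourier_sqZ (a : R) f k : tintegrable f ->
  fourier_sq (fun x => a * f x) k = a ^+ 2 * fourier_sq f k.
Proof.
move=> fi; have fa th : fc (fun x => a * f x) k th = a * fc f k th.
  rewrite /fc -RintegralZl//; last exact: tintegrableM fi (mbounded_tr _ _).
  by apply: eq_Rintegral => x _; rewrite mulrA.
by rewrite !fourier_sqE !coscE !sincE !fa; ring.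
Qed.

Lemma dual_sobolev_pairing (n : nat) V g : (0 < n)%N -> cper g ->
  bsum (fun k => qk k ^+ n * fourier_sq g k) 1 ->
  ((`|\int[mu]_x (V x * g x)|)%:E <= sobolev_norm (- n%:R) V)%E.
Proof.
move=> n0 cg /sobolev_norm_le1 g1; rewrite /sobolev_norm ifF; last first.
  by rewrite oppr_ge0 lern0 eqn0Ngt n0.
apply: ereal_sup_ubound; exists g => //; rewrite opprK; split => //.
split; [by case: cg|exact: cper_measurable| |exact: le_lt_trans g1 (ltry _)].
have := Lnorm2_sq_cper cg; have := Lnorm_ge0 mu 2%:E (EFin \o g).
by case: ('N[mu]_2%:E[_])%E => [r| |]//=; rewrite ltry.
Qed.

Lemma dual_sobolev_ge0 (n : nat) V : (0 < n)%N -> (0 <= sobolev_norm (- n%:R) V)%E.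
Proof.
move=> n0; have c0 : cper (cst 0 : E -> R) by split => //; exact: gcont_cst.
apply: le_trans (dual_sobolev_pairing V n0 c0 _); first by rewrite lee_fin.
move=> s _; rewrite big1 ?ler01// => k _; have -> : fourier_sq (cst 0 : E -> R) k = 0.
  have f0 th : fc (cst 0 : E -> R) k th = 0.
    by rewrite /fc; under eq_Rintegral do rewrite /= mul0r; exact: tintegral_cst.
  by rewrite fourier_sqE coscE sincE !f0 expr0n/= addr0.
by rewrite mulr0.
Qed.

Lemma dual_sobolev_fourier_sq (n : nat) V k (N : R) : (0 < n)%N -> tintegrable V ->
  (sobolev_norm (- n%:R) V <= N%:E)%E -> fourier_sq V k <= 2 * N ^+ 2 * qk k ^+ n.
Proof.
move=> n0 iV VN.
have q0 : 0 < qk k ^+ n :> R by rewrite exprn_gt0// qk_gt0.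
(* By Bessel the coefficients of [tr k th] have square sum at most 1, all at the weight of k, so the
   scaling qk^(- n / 2) puts it in the unit ball of H^n. Two phases give the factor 2. *)
pose a : R := (Num.sqrt (qk k ^+ n))^-1.
have s0 : 0 < Num.sqrt (qk k ^+ n) :> R by rewrite sqrtr_gt0.
have a2 : a ^+ 2 = (qk k ^+ n)^-1 by rewrite /a exprVn sqr_sqrtr// ltW.
have fcN th : fc V k th ^+ 2 <= N ^+ 2 * qk k ^+ n.
  have ct := cper_tr k th (R := R).
  have cg : cper (fun x => a * tr k th x).
    by split; [apply: gcontM; [exact: gcont_cst|by case: ct]|move=> x l; rewrite (proj2 ct)].
  have h : `|\int[mu]_x (V x * (a * tr k th x))| <= N.
    rewrite -lee_fin; apply: le_trans VN; apply: dual_sobolev_pairing => // s us.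
    apply: (@le_trans _ _ (\sum_(l <- s) fourier_sq (tr k th : E -> R) l)).
      apply: ler_sum => l _; rewrite fourier_sqZ; last exact: cper_tintegrable.
      by rewrite mulrCA fourier_sq_tr_weight a2 mulKf// gt_eqF.
    apply: (le_trans (bessel (mbounded_tr k th) us)).
    apply: tintegral_le_cst => [|x]; first exact/mbounded_tintegrable/mboundedX/mbounded_tr.
    by rewrite -real_normK ?num_real// exprn_ile1// tr_norm_le1.
  have fE : \int[mu]_x (V x * (a * tr k th x)) = a * fc V k th.
    rewrite /fc -RintegralZl//; last exact: tintegrableM iV (mbounded_tr _ _).
    by apply: eq_Rintegral => x _; rewrite mulrCA.
  rewrite fE in h; have : (a * fc V k th) ^+ 2 <= N ^+ 2.
    by rewrite -real_normK ?num_real// lerXn2r ?nnegrE// (le_trans _ h).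
  by rewrite exprMn a2 ler_pdivrMl// mulrC.
rewrite fourier_sqE coscE sincE; have := fcN 0; have := fcN (- (pi / 2)); lra.
Qed.

(** Monotone convergence along the increasing sets [enum_idx n] exchanges the sum over k with the
    time integral. *)
Lemma time_parseval (u : R -> E -> R) (T S : R) : 0 < T -> cper2 u ->
  (forall s : seq Z, uniq s -> \sum_(k <- s) prim (fun t => fourier_sq (u t) k) T <= S) ->
  prim (fun t => \int[mu]_x u t x ^+ 2) T <= S.
Proof.
move=> T0 cu hS.
pose g n t : R := \sum_(k <- enum_idx n) fourier_sq (u t) k.
have cg n : continuous (g n) by apply: gcont_sum => k _; exact: continuous_fourier_sq.
have g0 n t : 0 <= g n t by apply: sumr_ge0 => k _; exact: fourier_sq_ge0.
have bs t : bsum (fourier_sq (u t)) (\int[mu]_x u t x ^+ 2).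
  by move=> s us; apply: bessel => //; exact/cper_mbounded/cper2_cper.
have gcvg t : cvgn (fun n => g n t) by apply: tsum_cvg (bs t) => k; exact: fourier_sq_ge0.
have gnd t : nondecreasing_seq (fun n => g n t) by apply: tsum_ndecr => k; exact: fourier_sq_ge0.
pose y t := \int[mu]_x u t x ^+ 2.
have cy : continuous y := continuous_sqnorm cu.
have yE t : (y t)%:E = limn (fun n => (g n t)%:E).
  rewrite EFin_lim//; congr (_%:E); apply/le_anti/andP; split.
    apply: parseval_le; first exact: cper2_cper.
    by apply: bsum_tsum (bs t) => k; exact: fourier_sq_ge0.
  by apply: limr_le => //; apply: nearW => n; apply: bs; exact: enum_idx_uniq.
have mI : measurable (`[0, T]%classic : set (measurableTypeR R)) by [].
have mg n : measurable_fun `[0, T] (fun t => (g n t)%:E).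
  by apply/measurable_EFinP; apply: measurable_funTS; exact: continuous_measurable_fun.
rewrite -/(prim y T) -lee_fin /prim /Rintegral fineK; last exact/integrable_fin_num/prim_integrable.
under eq_integral do rewrite yE.
rewrite monotone_convergence//; last 2 first.
- by move=> n t _; rewrite lee_fin.
- by move=> t _ m n mn; rewrite lee_fin; exact: gnd.
apply: lime_le.
  apply: ereal_nondecreasing_is_cvgn => m n mn; apply: ge0_le_integral => //.
  - by move=> t _; rewrite lee_fin.
  - exact: mg.
  - exact: mg.
  - by move=> t _; rewrite lee_fin; exact: gnd.
apply: nearW => n; rewrite -[leLHS]fineK; last exact/integrable_fin_num/prim_integrable.
rewrite lee_fin -/(Rintegral _ _ _) -/(prim (g n) T) /g prim_sum.
  by apply: hS; exact: enum_idx_uniq.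
by move=> k; exact: continuous_fourier_sq.
Qed.

(** The space-time measure is a probability, so a bound at every time passes to the norm with no
    factor T. The continuous w supplies measurability. *)
Lemma L2_spacetime_le (T B : R) (hT : 0 < T) (u w : R -> E -> R) : 0 <= B -> cper2 w ->
  (forall t, 0 <= t <= T -> u t = w t) ->
  (forall t, 0 <= t <= T -> \int[mu]_x w t x ^+ 2 <= B) ->
  (L2_spacetime hT u ^+ 2 <= B%:E)%E.
Proof.
move=> B0 cw uw wB; rewrite /L2_spacetime Lnorm2_sq.
pose I := `[0, T]%classic `*` setT : set (R * E).
have -> : (fun z : R * E => u z.1 z.2) \_ I = (fun z : R * E => w z.1 z.2) \_ I.
  apply/funext => z; rewrite !patchE; case: ifPn => //; rewrite inE => -[/= z1 _].
  by rewrite uw//; move: z1; rewrite in_itv.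
set v := _ \_ I.
have mv : measurable_fun setT v.
  apply/(measurable_restrict _ _ _) => //; first exact: measurableX.
  by apply: measurable_funTS; apply: continuous_measurable_prod; case: cw.
have mv2 : measurable_fun setT (fun z => (v z ^+ 2)%:E).
  by apply/measurable_EFinP; exact: measurable_funX.
rewrite /spacetime/= fubini_tonelli1//; last by move=> z; rewrite lee_fin sqr_ge0.
have h t : (fubini_F mu (fun z => (v z ^+ 2)%:E) t <= B%:E)%E.
  rewrite /fubini_F.
  case: (boolP (0 <= t <= T)) => tT.
    have tI x : v (t, x) = w t x by rewrite /v patchE mem_set//; split => //=; rewrite in_itv.
    under eq_integral do rewrite tI.
    rewrite -[leLHS]fineK; first by rewrite lee_fin; exact: wB.
    apply: integrable_fin_num => //; exact/mbounded_tintegrable/mboundedX/cper_mbounded/cper2_cper.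
  have tI x : v (t, x) = 0.
    by rewrite /v patchE memNset// => -[/=]; rewrite in_itv/= (negbTE tT).
  by under eq_integral do rewrite tI expr0n/=; rewrite integral0 lee_fin.
apply: (@le_trans _ _ (\int[uniformR hT]_t B%:E)%E).
  apply: ge0_le_integral => //.
  - by move=> t _; apply: integral_ge0 => x _; rewrite lee_fin sqr_ge0.
  - by apply: measurable_fun_fubini_tonelli_F => // z; rewrite lee_fin sqr_ge0.
rewrite integral_cst// [X in (_ * X)%E](_ : _ = 1%E) ?mule1//.
exact: (@probability_setT _ _ _ (uniformR hT)).
Qed.

(** Duality costs the weight qk^n and the derivative costs kap_i^2 <= qk: together exactly the order
    n + 1 assumed of the time integrals. *)
Lemma drift_gap_prim_le i (n : nat) V W M D1 D2 (u : R -> E -> R) (T N C : R) :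
  0 < T -> (0 < n)%N -> cper V -> cper W -> deriv_of V M D1 -> deriv_of W M D2 -> cper2 u ->
  (sobolev_norm (- n%:R) (fun x => V x - W x)%R <= N%:E)%E ->
  bsum (fun k => qk k ^+ n.+1 * prim (fun t => fourier_sq (u t) k) T) C ->
  prim (fun t => \int[mu]_x drift_gap u D1 D2 i t x ^+ 2) T <= 2 * N ^+ 2 * C.
Proof.
move=> T0 n0 cV cW dV dW cu VN hC.
have N0 : 0 <= 2 * N ^+ 2 by apply: mulr_ge0 => //; exact: sqr_ge0.
have [mD1 _ _ _] := dV i; have [mD2 _ _ _] := dW i.
apply: time_parseval => //.
  by apply: cper2B; apply: cper2_tconv => //; exact: mbounded_tintegrable.
apply: bsum_le (bsumZ N0 hC) => k.
under [X in prim X]funext do rewrite (drift_gap_fourier_sq i _ k cV cW dV dW cu).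
rewrite primZ; last exact: continuous_fourier_sq.
rewrite [leRHS]mulrA; apply: ler_wpM2r; first by apply: prim_ge0 => t _; exact: fourier_sq_ge0.
have Vk := dual_sobolev_fourier_sq k n0 (cper_tintegrable (cperB cV cW)) VN.
have kq : kap k i ^+ 2 <= qk k :> R.
  rewrite /qk /lamk (bigD1 i)//= addrCA lerDl addr_ge0// sumr_ge0// => j _; exact: sqr_ge0.
apply: le_trans (ler_pM (sqr_ge0 _) (fourier_sq_ge0 _ _) kq Vk) _.
by rewrite [leLHS]mulrC (exprSr (qk k)) mulrA.
Qed.
End sobolev_sums.

Theorem lemma3 (R : realType) (d : nat) (T M : R) (hd : (0 < d)%N) (hT : 0 < T) :
  (exists C : R -> R,
    forall (W1 W2 phi : 'rV[R]_d -> R) (rho1 rho2 : R -> 'rV[R]_d -> R),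
      in_W2inf W1 -> in_W2inf W2 ->
      (W2inf_norm W1 <= M%:E)%E -> (W2inf_norm W2 <= M%:E)%E ->
      prob_density phi -> in_sobolev (3 + d)%:R phi ->
      mv_solution T W1 phi rho1 -> mv_solution T W2 phi rho2 ->
      (L2_spacetime hT (fun t x => (rho1 t x - rho2 t x)%R) ^+ 2 <=
       (C (fine (sobolev_norm d%:R phi)))%:E *
       \int[lebesgue_measure]_(t in `[0%R, T])
         \sum_(i < d)
           'N[torus d]_2%:E[EFin \o
              torus_conv (weak_deriv [:: i] (fun x => (W1 x - W2 x)%R)) (rho2 t)] ^+ 2)%E)
  /\
  (forall beta : nat, (3 + d <= beta)%N -> ~~ odd beta ->
   exists C : R -> R,
    forall (W1 W2 phi : 'rV[R]_d -> R) (rho1 rho2 : R -> 'rV[R]_d -> R),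
      in_W2inf W1 -> in_W2inf W2 ->
      (W2inf_norm W1 <= M%:E)%E -> (W2inf_norm W2 <= M%:E)%E ->
      prob_density phi -> in_sobolev (3 + d)%:R phi ->
      mv_solution T W1 phi rho1 -> mv_solution T W2 phi rho2 ->
      in_sobolev beta%:R phi ->
      (L2_spacetime hT (fun t x => (rho1 t x - rho2 t x)%R) <=
       (C (fine (sobolev_norm beta%:R phi)))%:E *
       sobolev_norm (- beta%:R) (fun x => (W1 x - W2 x)%R))%E).
Proof.
(* K bounds |rho2| by [flow_sup], B being a bound for the H^d norm of phi; CI is the constant of
   [stability] for this K. *)
pose K (B : R) : R := (@regA R d T M (B ^+ 2) d + 6 ^+ d) / 2.
pose CI (B : R) : R := expR (d%:R * (3 * (M ^+ 2 + K B ^+ 2 * M ^+ 2)) * T) * (3 * K B ^+ 2).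
have CI0 B : 0 <= CI B by rewrite mulr_ge0 ?expR_ge0// mulr_ge0// sqr_ge0.
(* Shared by both parts: B is the H^d norm in the first and the H^beta norm, which controls the same
   sums, in the second. *)
have energy (W1 W2 phi : 'rV[R]_d -> R) rho1 rho2 B (D1 D2 : 'I_d -> 'rV[R]_d -> R) :
    in_W2inf W1 -> in_W2inf W2 -> deriv_of W1 M D1 -> deriv_of W2 M D2 ->
    prob_density phi -> bsum (fun k => qk k ^+ d * fourier_sq phi k) (B ^+ 2) ->
    mv_solution T W1 phi rho1 -> mv_solution T W2 phi rho2 ->
    (L2_spacetime hT (fun t x => (rho1 t x - rho2 t x)%R) ^+ 2 <= (CI B * prim (fun t =>
      \sum_(i < d) \int[torus d]_x drift_gap (ext T rho2) D1 D2 i t x ^+ 2) T)%:E)%E.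
  move=> W1s W2s dW1 dW2 pphi hB mv1 mv2.
  have cW1 : cper W1 by case: W1s.
  have cW2 : cper W2 by case: W2s.
  have fl1 := mv_mv_flow hT cW1 dW1 mv1; have fl2 := mv_mv_flow hT cW2 dW2 mv2.
  have c1 := mv_cper2 hT mv1; have c2 := mv_cper2 hT mv2.
  have init k th : fc (ext T rho1 0) k th = fc (ext T rho2 0) k th.
    by rewrite (mv_init k th hT pphi mv1) (mv_init k th hT pphi mv2).
  have e0 : bsum (fun k => qk k ^+ d * fourier_sq (ext T rho2 0) k) (B ^+ 2).
    apply: bsum_le hB => k.
    by rewrite !fourier_sqE !coscE !sincE !(mv_init _ _ hT pphi mv2).
  apply: (@L2_spacetime_le _ _ T _ hT _ (fun t x => ext T rho1 t x - ext T rho2 t x)).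
  - apply: mulr_ge0 => //; apply: prim_ge0 => t _; apply: sumr_ge0 => i _.
    by apply: Rintegral_ge0 => x _; exact: sqr_ge0.
  - exact: cper2B.
  - by move=> t tT; rewrite !ext_id.
  move=> t tT; rewrite /CI -mulrA.
  by apply: (stability hT fl1 fl2 _ init tT) => s x sT; exact: flow_sup fl2 _ _ x sT e0.
split.
  exists CI => W1 W2 phi rho1 rho2 W1s W2s W1M W2M pphi Hphi mv1 mv2.
  have [D1 dW1] := W2inf_deriv W1s W1M; have [D2 dW2] := W2inf_deriv W2s W2M.
  have c2 := mv_cper2 hT mv2.
  have hphi : (sobolev_norm d%:R phi < +oo)%E.
    apply: (@sobolev_norm_lty _ _ _ (3 + d)%N); first exact: leq_addl.
    by case: Hphi => _ _ _; rewrite /sobolev_norm ler0n.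
  have := energy W1 W2 phi rho1 rho2 _ D1 D2 W1s W2s dW1 dW2 pphi (sobolev_norm_bsum hphi) mv1 mv2.
  set B := fine _; set F := (fun t => \sum_(i < d) _).
  have cF : continuous F.
    apply: gcont_sum => i _; apply: continuous_sqnorm.
    have [mD1 _ _ _] := dW1 i; have [mD2 _ _ _] := dW2 i.
    by apply: cper2B; apply: cper2_tconv => //; exact: mbounded_tintegrable.
  have FE : (\int[lebesgue_measure]_(t in `[0%R, T]) \sum_(i < d)
      'N[torus d]_2%:E[EFin \o
        torus_conv (weak_deriv [:: i] (fun x => (W1 x - W2 x)%R)) (rho2 t)] ^+ 2 =
      (prim F T)%:E)%E.
    rewrite /prim /Rintegral fineK; last exact/integrable_fin_num/prim_integrable.
    apply: eq_integral => t tI; have {tI} tT : 0 <= t <= T by move: tI; rewrite inE/= in_itv.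
    rewrite -sumEFin; apply: eq_bigr => i _; rewrite -(ext_id rho2 tT).
    rewrite (weak_gradient_gap i t W1s W2s dW1 dW2 c2) Lnorm2_sq_cper//.
    have [mD1 _ _ _] := dW1 i; have [mD2 _ _ _] := dW2 i.
    by apply: cperB; apply: tconv_cper; (exact: mbounded_tintegrable || exact: cper2_cper).
  by move=> h; rewrite FE -EFinM.
move=> beta dbeta _.
have b0 : (0 < beta)%N by apply: leq_trans dbeta; rewrite addSn.
have db : (d <= beta)%N by apply: leq_trans dbeta; exact: leq_addl.
(* The constant of [flow_parabolic_gain] for deg = beta. *)
pose C2 (B : R) : R := B ^+ 2 + T * @regC R d M beta (@regA R d T M (B ^+ 2) beta).
(* The + 1 makes the constant positive, so that the right-hand side is +oo when the dual norm is. *)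
exists (fun B => Num.sqrt (CI B * (d%:R * (2 * C2 B))) + 1).
move=> W1 W2 phi rho1 rho2 W1s W2s W1M W2M pphi _ mv1 mv2 Hphi.
have [D1 dW1] := W2inf_deriv W1s W1M; have [D2 dW2] := W2inf_deriv W2s W2M.
have cW1 : cper W1 by case: W1s.
have cW2 : cper W2 by case: W2s.
have c2 := mv_cper2 hT mv2.
have hphi : (sobolev_norm beta%:R phi < +oo)%E.
  by case: Hphi => _ _ _; rewrite /sobolev_norm ler0n.
have hB := sobolev_norm_bsum hphi.
set B := fine _ in hB *.
have hBd := bsum_exp_le (fourier_sq_ge0 phi) db hB.
have h := energy W1 W2 phi rho1 rho2 B D1 D2 W1s W2s dW1 dW2 pphi hBd mv1 mv2.
have gain : bsum (fun k => qk k ^+ beta.+1 * prim (fun t => fourier_sq (ext T rho2 t) k) T) (C2 B).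
  apply: flow_parabolic_gain (mv_mv_flow hT cW2 dW2 mv2) _ _ _ => //.
  apply: bsum_le hB => k.
  by rewrite !fourier_sqE !coscE !sincE !(mv_init _ _ hT pphi mv2).
have C20 := bsum_ge0 gain.
set c := CI B * (d%:R * (2 * C2 B)).
have c0 : 0 <= c by rewrite mulr_ge0// mulr_ge0// mulr_ge0.
have sc0 : 0 <= Num.sqrt c by exact: sqrtr_ge0.
have NE : (0 <= sobolev_norm (- beta%:R) (fun x => (W1 x - W2 x)%R))%E.
  exact: dual_sobolev_ge0.
case EN : (sobolev_norm (- beta%:R) (fun x => (W1 x - W2 x)%R)) NE => [N| |]// NE; last first.
  by rewrite gt0_muley ?leey// lte_fin ltr_wpDl.
rewrite lee_fin in NE.
have Fle : prim (fun t => \sum_(i < d) \int[torus d]_x drift_gap (ext T rho2) D1 D2 i t x ^+ 2) T <=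
    d%:R * (2 * N ^+ 2 * C2 B).
  rewrite prim_sum; last first.
    move=> i; apply: continuous_sqnorm.
    have [mD1 _ _ _] := dW1 i; have [mD2 _ _ _] := dW2 i.
    by apply: cper2B; apply: cper2_tconv => //; exact: mbounded_tintegrable.
  rewrite -[d in d%:R]card_ord mulr_natl -sumr_const; apply: ler_sum => i _.
  by apply: (drift_gap_prim_le i hT b0 cW1 cW2 dW1 dW2 c2 _ gain); rewrite EN.
rewrite -EFinM; apply: lee_sqrE; first by rewrite lee_fin mulr_ge0// addr_ge0.
apply: (le_trans h); rewrite -EFin_expe lee_fin.
apply: (le_trans (ler_wpM2l (CI0 B) Fle)).
apply: (@le_trans _ _ (c * N ^+ 2)); first by rewrite le_eqVlt; apply/orP; left; apply/eqP; rewrite /c; ring.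
rewrite exprMn; apply: ler_wpM2r; first exact: sqr_ge0.
rewrite -[leLHS]sqr_sqrtr// lerXn2r ?nnegrE//; last by rewrite lerDl.
Qed.
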